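(* Suppose $(f,c,\mathcal{X})$ is regular problem data, $\mathcal{A}$ is a constraint dissolving mapping for it, $f$, $c$ and $\mathcal{A}$ are twice differentiable over $\mathcal{Y}$, and $\mathcal{X}$ is second-order directionally differentiable. Then for any $x\in\mathcal{K}$ that is a second-order stationary point of (NCP), $x$ is a second-order stationary point of (CDP) with $\beta\ge\beta_x$.
   Context: **Problem.** $\mathcal{X}\subseteq\mathbb{R}^n$ is a closed convex set, $f:\mathbb{R}^n\to\mathbb{R}$, and $c:\mathcal{Y}\to\mathbb{R}^p$ where $\mathcal{Y}\subseteq\mathbb{R}^n$ is an open set containing $\mathcal{X}$. (NCP) is the problem $\min f(x)$ subject to $c(x)=0$, $x\in\mathcal{X}$, and $\mathcal{K}:=\{x\in\mathcal{X}: c(x)=0\}$. **Notation.** $\|\cdot\|$ is the $\ell_2$ vector norm / operator norm. $\mathcal{T}_{\mathcal{X}}(x)$, $\mathcal{N}_{\mathcal{X}}(x)$ are the tangent and normal cones of $\mathcal{X}$ at $x$; $\mathrm{aff}(\mathcal{X})$ is the affine hull; $\mathcal{E}:=\mathrm{aff}(\mathcal{X})-x$ (any $x\in\mathcal{X}$) is the associated linear subspace; $P_{\mathcal{E}}$ is the orthogonal projection matrix onto $\mathcal{E}$. $\nabla c(x)=[\nabla c_1(x),\dots,\nabla c_p(x)]\in\mathbb{R}^{n\times p}$ and $\nabla\mathcal{A}(x)=[\nabla\mathcal{A}_1(x),\dots,\nabla\mathcal{A}_n(x)]\in\mathbb{R}^{n\times n}$ are transposed Jacobians. $\nabla f(\mathcal{A}(x))$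 means $\nabla f$ evaluated at $\mathcal{A}(x)$. $\nabla^2c(x)[\lambda]:=\sum_{i=1}^p\lambda_i\nabla^2c_i(x)$. $\sigma_r(\cdot)$ is the $r$-th largest singular value. **Regular problem data.** $f$ is continuously differentiable with locally Lipschitz gradient on $\mathbb{R}^n$; $c$ is continuously differentiable with locally Lipschitz Jacobian on $\mathcal{Y}$; and there is $r>0$, independent of $x$, such that for every $x\in\mathcal{K}$ there is $\tau_x>0$ with: (a) $\dim\{\nabla c(y)^\top d: d\in\mathcal{E}\}=r$ for all $y\in\mathcal{Y}\cap\mathrm{aff}(\mathcal{X})$ with $\|y-x\|\le\tau_x$; (b) $\dim\{\nabla c(y)^\top d: d\in\mathcal{T}_{\mathcal{X}}(y)\cap-\mathcal{T}_{\mathcal{X}}(y)\}=r$ for all $y\in\mathcal{X}$ with $\|y-x\|\le\tau_x$. **Constraint dissolving mapping.** A mapping $\mathcal{A}:\mathcal{X}\to\mathbb{R}^n$ (here, by the twice-differentiability hypothesis, extended to $\mathcal{Y}$) such that: (1) $\mathcal{A}$ is locally Lipschitz smooth (continuously differentiable with locally Lipschitz derivative) over $\mathcal{X}$; (2) $\mathcal{A}(x)=x$ and $\nabla\mathcal{A}(x)\nabla c(x)=0$ for all $x\in\mathcal{K}$; (3) there is a locally Lipschitz mapping $\mathcal{R}_{\mathcal{A}}:\mathcal{X}\to\mathbb{R}^{n\times n}$ with $\mathcal{R}_{\mathcal{A}}(x)=0$ for $x\in\mathcal{K}$, and for each $x\in\mathcal{K}$ there is $\omega_x>0$ such that $(\nabla\mathcal{A}(y)-I_n-\mathcal{R}_{\mathcal{A}}(y))v=0$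 for all $y\in\mathcal{X}$ with $\|y-x\|\le\omega_x$ and all $v\in\mathcal{N}_{\mathcal{X}}(y)$. **(CDP).** $\min_{x\in\mathcal{X}} h(x):=f(\mathcal{A}(x))+\frac{\beta}{2}\|c(x)\|^2$, $\beta\ge0$. **First-order stationarity.** $x\in\mathcal{K}$ is first-order stationary for (NCP) if $0\in\nabla f(x)+\mathrm{range}(\nabla c(x))+\mathcal{N}_{\mathcal{X}}(x)$; $x\in\mathcal{X}$ is first-order stationary for (CDP) if $0\in\nabla h(x)+\mathcal{N}_{\mathcal{X}}(x)$. **Second-order objects.** For closed $\mathcal{S}$, $x\in\mathcal{S}$, $w\in\mathbb{R}^n$: $\mathcal{T}^2_{\mathcal{S}}(x,w):=\{z:\liminf_{t\downarrow0}\mathrm{dist}(z,(\mathcal{S}-x-tw)/(\tfrac12t^2))=0\}$. Support function: $\zeta(w,\mathcal{S}):=\sup_{y\in\mathcal{S}}\langle w,y\rangle$ (equal to $-\infty$ if $\mathcal{S}=\emptyset$). Inner sets: $\mathcal{T}^i_{\mathcal{S}}(x):=\{w:\mathrm{dist}(x+tw,\mathcal{S})=o(t),\ t\downarrow0\}$, $\mathcal{T}^{i,2}_{\mathcal{S}}(x,w):=\{z:\mathrm{dist}(x+tw+\tfrac12t^2z,\mathcal{S})=o(t^2),\ t\downarrow0\}$. $\mathcal{S}$ is second-order directionally differentiable if for all $x\in\mathcal{S}$ and $w\in\mathcal{T}_{\mathcal{S}}(x)$: $\mathcal{T}^i_{\mathcal{S}}(x)=\mathcal{T}_{\mathcal{S}}(x)$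 and $\mathcal{T}^{i,2}_{\mathcal{S}}(x,w)=\mathcal{T}^2_{\mathcal{S}}(x,w)$. **Second-order stationary point of (CDP):** a first-order stationary point $x\in\mathcal{X}$ such that, with $\Gamma=-\nabla h(x)$, $\langle d,\nabla^2h(x)d\rangle-\zeta(\Gamma,\mathcal{T}^2_{\mathcal{X}}(x,d))\ge0$ for all $d\in\mathcal{C}_1(x):=\{d\in\mathcal{T}_{\mathcal{X}}(x):\langle d,\nabla h(x)\rangle=0\}$. **Second-order stationary point of (NCP):** a first-order stationary point $x\in\mathcal{K}$ such that $\sup_{(\lambda,\Gamma)\in\mathcal{M}_2(x)}\{\langle d,(\nabla^2f(x)+\nabla^2c(x)[\lambda])d\rangle-\zeta(\Gamma,\mathcal{T}^2_{\mathcal{X}}(x,d))\}\ge0$ for all $d\in\mathcal{C}_2(x)$, where $\mathcal{M}_2(x):=\{(\lambda,\Gamma)\in\mathbb{R}^p\times\mathbb{R}^n:\nabla f(x)+\nabla c(x)\lambda+\Gamma=0,\ \Gamma\in\mathcal{N}_{\mathcal{X}}(x)\}$ and $\mathcal{C}_2(x):=\{d\in\mathcal{T}_{\mathcal{X}}(x):\langle\nabla f(x),d\rangle=0,\ d^\top\nabla c(x)=0\}$. **Constants.** Let $\tilde{\mathcal{Y}}\subseteq\mathcal{Y}$ be an open set containing $\mathcal{X}$ such that for every $x\in\mathcal{M}:=\{y\in\tilde{\mathcal{Y}}\cap\mathrm{aff}(\mathcal{X}): c(y)=0\}$ the dimension of $\nabla c(\cdot)^\top\mathcal{E}$ is constant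 near $x$. Put $\pi(x):=\sigma_r(P_{\mathcal{E}}\nabla c(x))$. For $x\in\mathcal{K}$ let $\kappa_x>0$ be such that for all $y\in\mathrm{aff}(\mathcal{X})$ with $\|y-x\|\le\kappa_x$: $\mathrm{dist}(y,\mathcal{M})\le\frac{2}{\pi(x)}\|c(y)\|$ and $\|P_{\mathcal{E}}\nabla c(y)c(y)\|\ge\frac{\pi(x)}{2}\|c(y)\|$ (such $\kappa_x$ exists). Let $\rho_x$ be the largest $\rho\in(0,\min\{\tau_x,\omega_x,\kappa_x\}]$ with $\inf\{\pi(y):y\in\mathcal{X},\|y-x\|\le\rho\}\ge\frac12\pi(x)$, and $\Theta_x:=\{y\in\mathcal{X}:\|y-x\|\le\rho_x\}$. Define $\sigma_{x,c}:=\pi(x)$ and, with suprema over $y\in\Theta_x$ (for ratios, over those $y$ with $c(y)\neq0$; these quantities are well defined and finite): $M_{x,f}:=\sup\|\nabla f(\mathcal{A}(y))\|$, $M_{x,A}:=\sup\|\nabla\mathcal{A}(y)\|$, $M_{x,R}:=\sup\frac{\|\mathcal{R}_{\mathcal{A}}(y)\|}{\|c(y)\|}$, $M_{x,I}:=\sup\frac{\|P_{\mathcal{E}}\nabla\mathcal{A}(y)(\nabla\mathcal{A}(y)-I_n)\|}{\|c(y)\|}$, $L_{x,A}:=\sup_{y\neq z\in\Theta_x}\frac{\|\nabla\mathcal{A}(y)-\nabla\mathcal{A}(z)\|}{\|y-z\|}$. Then $\beta_x:=\max\left\{\frac{8M_{x,f}(M_{x,I}+M_{x,R}M_{x,A})}{\sigma_{x,c}},\frac{M_{x,f}L_{x,A}(1+M_{x,A}+M_{x,A}^2)}{\sigma_{x,c}^2}\right\}$.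 *)

(* Defs.v *)
From HB Require Import structures.
From mathcomp Require Import all_boot all_order all_algebra.
From mathcomp Require Import all_classical all_reals all_analysis.

Set Implicit Arguments.
Unset Strict Implicit.
Unset Printing Implicit Defensive.

Import Order.TTheory GRing.Theory Num.Theory.
Import numFieldNormedType.Exports.

Local Open Scope classical_set_scope.
Local Open Scope ring_scope.

(* Vectors of R^n are row vectors 'rV[R]_n.  The library norm on matrices is
   the sup norm: it is used below only through the topology it induces and the
   notions (differentiability, local Lipschitz continuity) that do not depend
   on the choice of a norm; every explicit norm is the Euclidean one. *)

Section Euclidean.
Variable R : realType.
Implicit Types n m p : nat.

Definition dot n (u v : 'rV[R]_n) : R := \sum_(i < n) u 0 i * v 0 i.

Definition l2norm n (v : 'rV[R]_n) : R := Num.sqrt (dot v v).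

(* The matrix-vector product M v, for v seen as a column. *)
Definition mulmxv m n (M : 'M[R]_(m, n)) (v : 'rV[R]_n) : 'rV[R]_m :=
  v *m M^T.

Definition opnorm m n (M : 'M[R]_(m, n)) : R :=
  sup [set l2norm (mulmxv M v) | v in [set v : 'rV[R]_n | l2norm v <= 1]].

(* Only meaningful for S nonempty, which holds at each use below. *)
Definition dist n (z : 'rV[R]_n) (S : set 'rV[R]_n) : R :=
  inf [set l2norm (z - y) | y in S].

(* S is a linear subspace of dimension k. *)
Definition has_dim n (S : set 'rV[R]_n) (k : nat) : Prop :=
  exists2 U : {vspace 'rV[R]_n}, S = [set` U] & \dim U = k.

Definition aff n (S : set 'rV[R]_n) : set 'rV[R]_n :=
  [set z | exists k (a : 'I_k -> R) (u : 'I_k -> 'rV[R]_n),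
    [/\ forall i, S (u i), \sum_i a i = 1 & z = \sum_i a i *: u i]].

(* aff(S) - x does not depend on x in S; the union over x avoids a choice. *)
Definition aff_dir n (S : set 'rV[R]_n) : set 'rV[R]_n :=
  [set y - x | y in aff S & x in S].

Definition is_orthoproj n (E : set 'rV[R]_n) (P : 'M[R]_n) : Prop :=
  [/\ P^T = P, P *m P = P & range (mulmxv P) = E].

(* The real eigenvalues of M with multiplicity, in nonincreasing order; a junk
   value is returned if char_poly M does not split over R, which does not
   happen for a symmetric matrix. *)
Definition eigenseq n (M : 'M[R]_n) : seq R :=
  xget [::] [set s | sorted >=%R s /\
                     char_poly M = \prod_(a <- s) ('X - a%:P)].

(* The r-th largest singular value, counting from r = 1. *)
Definition singval (r : nat) m n (B : 'M[R]_(m, n)) : R :=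
  Num.sqrt (eigenseq (B^T *m B))`_r.-1.

End Euclidean.

Section Calculus.
Variable R : realType.
Implicit Types n m p : nat.

(* With row vectors, 'D_v c x = v *m jacobian c x, so that the library's
   [jacobian c x] is the n x p transposed Jacobian [grad c_1, ..., grad c_p]. *)
Definition grad n (f : 'rV[R]_n -> R) (x : 'rV[R]_n) : 'rV[R]_n :=
  \row_i 'D_(delta_mx 0 i) f x.

Definition hess n (f : 'rV[R]_n -> R) (x : 'rV[R]_n) : 'M[R]_n :=
  jacobian (grad f) x.

Definition hess_comb n p (c : 'rV[R]_n -> 'rV[R]_p) (x : 'rV[R]_n)
    (lam : 'rV[R]_p) : 'M[R]_n :=
  \sum_(i < p) lam 0 i *: hess (fun y => c y 0 i) x.

(* F is continuously differentiable on D with locally Lipschitz derivative;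
   dF is the representation of the derivative (gradient or Jacobian). *)
Definition loc_lip_smooth n (V W : normedModType R) (D : set 'rV[R]_n)
    (F : 'rV[R]_n -> V) (dF : 'rV[R]_n -> W) : Prop :=
  [/\ forall x, D x -> differentiable F x,
      {within D, continuous dF} &
      [locally [lipschitz dF x | x in D]]].

(* For D open. *)
Definition twice_differentiable n (V W : normedModType R) (D : set 'rV[R]_n)
    (F : 'rV[R]_n -> V) (dF : 'rV[R]_n -> W) : Prop :=
  forall x, D x -> differentiable F x /\ differentiable dF x.

End Calculus.

Section Cones.
Variables (R : realType) (n : nat).
Implicit Types (S : set 'rV[R]_n) (x w z d v : 'rV[R]_n).

(* The contingent (Bouligand) cone: liminf of dist(d, (S - x)/t) as t decreases
   to 0 is 0.  For S closed convex it is the closure of the cone of feasible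
   directions. *)
Definition tangent_cone S x : set 'rV[R]_n :=
  [set d | limf_einf
    (fun t : R => (dist d [set t^-1 *: (y - x) | y in S])%:E) 0^'+ = 0%E].

(* The normal cone of a convex set; only used at points x of S. *)
Definition normal_cone S x : set 'rV[R]_n :=
  [set v | forall y, S y -> dot v (y - x) <= 0].

Definition tangent2 S x w : set 'rV[R]_n :=
  [set z | limf_einf
    (fun t : R => (dist z
       [set (2^-1 * t ^+ 2)^-1 *: (y - x - t *: w) | y in S])%:E) 0^'+ = 0%E].

Definition inner_tangent S x : set 'rV[R]_n :=
  [set w | (fun t : R => dist (x + t *: w) S : R^o) =o_ (0^'+)
           (fun t : R => t : R^o)].

Definition inner_tangent2 S x w : set 'rV[R]_n :=
  [set z | (fun t : R => dist (x + t *: w + (2^-1 * t ^+ 2) *: z) S : R^o)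
             =o_ (0^'+) (fun t : R => t ^+ 2 : R^o)].

Definition second_order_dir_diff S : Prop :=
  forall x w, S x -> tangent_cone S x w ->
    inner_tangent S x = tangent_cone S x /\
    inner_tangent2 S x w = tangent2 S x w.

Definition support_fun w S : \bar R := ereal_sup [set (dot w y)%:E | y in S].

End Cones.

Section Problem.
Variables (R : realType) (n p : nat).
Variables (X Y : set 'rV[R]_n).
Variables (f : 'rV[R]_n -> R) (c : 'rV[R]_n -> 'rV[R]_p).
(* c and A are total functions; their values outside Y are irrelevant. *)

Definition feasible : set 'rV[R]_n := [set x | X x /\ c x = 0].

Definition regular_data (r : nat) (tau : 'rV[R]_n -> R) : Prop :=
  [/\ loc_lip_smooth setT f (grad f),
      loc_lip_smooth Y c (jacobian c),
      (0 < r)%N &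
      forall x, feasible x ->
        [/\ 0 < tau x,
            forall y, Y y -> aff X y -> l2norm (y - x) <= tau x ->
              has_dim [set mulmxv (jacobian c y)^T d | d in aff_dir X] r &
            forall y, X y -> l2norm (y - x) <= tau x ->
              has_dim [set mulmxv (jacobian c y)^T d | d in
                [set d | tangent_cone X y d /\ tangent_cone X y (- d)]] r]].

Definition constraint_dissolving (A : 'rV[R]_n -> 'rV[R]_n)
    (RA : 'rV[R]_n -> 'M[R]_n) (omega : 'rV[R]_n -> R) : Prop :=
  [/\ loc_lip_smooth X A (jacobian A),
      forall x, feasible x -> A x = x /\ jacobian A x *m jacobian c x = 0,
      [locally [lipschitz RA x | x in X]],
      forall x, feasible x -> RA x = 0 &
      forall x, feasible x -> 0 < omega x /\
        forall y v, X y -> l2norm (y - x) <= omega x -> normal_cone X y v ->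
          mulmxv (jacobian A y - 1%:M - RA y) v = 0].

Definition cdp_obj (A : 'rV[R]_n -> 'rV[R]_n) (beta : R) (y : 'rV[R]_n) : R :=
  f (A y) + beta / 2 * l2norm (c y) ^+ 2.

Definition cdp_fosp (h : 'rV[R]_n -> R) (x : 'rV[R]_n) : Prop :=
  X x /\ exists2 v, normal_cone X x v & 0 = grad h x + v.

Definition ncp_fosp (x : 'rV[R]_n) : Prop :=
  feasible x /\ exists lam v, normal_cone X x v /\
    0 = grad f x + mulmxv (jacobian c x) lam + v.

Definition cdp_critical (h : 'rV[R]_n -> R) (x : 'rV[R]_n) : set 'rV[R]_n :=
  [set d | tangent_cone X x d /\ dot d (grad h x) = 0].

Definition cdp_sosp (h : 'rV[R]_n -> R) (x : 'rV[R]_n) : Prop :=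
  cdp_fosp h x /\
  forall d, cdp_critical h x d ->
    (0 <= (dot d (mulmxv (hess h x) d))%:E
          - support_fun (- grad h x) (tangent2 X x d))%E.

Definition ncp_multipliers (x : 'rV[R]_n) : set ('rV[R]_p * 'rV[R]_n) :=
  [set lg | grad f x + mulmxv (jacobian c x) lg.1 + lg.2 = 0 /\
            normal_cone X x lg.2].

Definition ncp_critical (x : 'rV[R]_n) : set 'rV[R]_n :=
  [set d | [/\ tangent_cone X x d, dot (grad f x) d = 0 &
               d *m jacobian c x = 0]].

Definition ncp_sosp (x : 'rV[R]_n) : Prop :=
  ncp_fosp x /\
  forall d, ncp_critical x d ->
    (0 <= ereal_sup
      [set (dot d (mulmxv (hess f x + hess_comb c x lg.1) d))%:E
           - support_fun lg.2 (tangent2 X x d) | lg in ncp_multipliers x])%E.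

End Problem.

Section Constants.
Variables (R : realType) (n p : nat).
Variables (X Y : set 'rV[R]_n).
Variables (f : 'rV[R]_n -> R) (c : 'rV[R]_n -> 'rV[R]_p).
Variables (A : 'rV[R]_n -> 'rV[R]_n) (RA : 'rV[R]_n -> 'M[R]_n).
(* P is the orthogonal projection matrix onto aff_dir X. *)
Variables (r : nat) (P : 'M[R]_n).

Definition manifold (Yt : set 'rV[R]_n) : set 'rV[R]_n :=
  [set y | [/\ Yt y, aff X y & c y = 0]].

(* "Near x" is relative to aff(X), as in the rank condition of regular data. *)
Definition manifold_nbhd (Yt : set 'rV[R]_n) : Prop :=
  [/\ open Yt, X `<=` Yt, Yt `<=` Y &
      forall x, manifold Yt x -> exists k eps, 0 < eps /\
        forall y, Yt y -> aff X y -> l2norm (y - x) <= eps ->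
          has_dim [set mulmxv (jacobian c y)^T d | d in aff_dir X] k].

Definition sval_r (y : 'rV[R]_n) : R := singval r (P *m jacobian c y).

(* Restricted to y in Y since c is only specified there. *)
Definition is_kappa (Yt : set 'rV[R]_n) (x : 'rV[R]_n) (kappa : R) : Prop :=
  0 < kappa /\
  forall y, Y y -> aff X y -> l2norm (y - x) <= kappa ->
    dist y (manifold Yt) <= 2 / sval_r x * l2norm (c y) /\
    sval_r x / 2 * l2norm (c y)
      <= l2norm (mulmxv (P *m jacobian c y) (c y)).

Definition rho_admissible (x : 'rV[R]_n) (bound rho : R) : Prop :=
  [/\ 0 < rho, rho <= bound &
      2^-1 * sval_r x
        <= inf [set sval_r y | y in [set y | X y /\ l2norm (y - x) <= rho]]].

Definition is_rho (x : 'rV[R]_n) (bound rho : R) : Prop :=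
  rho_admissible x bound rho /\
  forall rho', rho_admissible x bound rho' -> rho' <= rho.

Definition Theta (x : 'rV[R]_n) (rho : R) : set 'rV[R]_n :=
  [set y | X y /\ l2norm (y - x) <= rho].

(* Supremum in [0, +oo] of a set of nonnegative reals: adding 0 only matters
   for the empty set, and the value is +oo for an unbounded set. *)
Definition sup0 (S : set R) : \bar R := ereal_sup (EFin @` (0 |` S)).

Section AtPoint.
Variable T : set 'rV[R]_n.

Definition M_f : \bar R := sup0 [set l2norm (grad f (A y)) | y in T].

Definition M_A : \bar R := sup0 [set opnorm (jacobian A y) | y in T].

Definition M_R : \bar R :=
  sup0 [set opnorm (RA y) / l2norm (c y) | y in [set y | T y /\ c y != 0]].

Definition M_I : \bar R :=
  sup0 [set opnorm (P *m jacobian A y *m (jacobian A y - 1%:M)) / l2norm (c y)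
       | y in [set y | T y /\ c y != 0]].

Definition L_A : \bar R :=
  sup0 [set opnorm (jacobian A yz.1 - jacobian A yz.2) / l2norm (yz.1 - yz.2)
       | yz in [set yz | [/\ T yz.1, T yz.2 & yz.1 != yz.2]]].

End AtPoint.

Definition beta_bound (x : 'rV[R]_n) (rho : R) : \bar R :=
  let T := Theta x rho in
  let s := sval_r x in
  (maxe ((8 / s)%:E * (M_f T * (M_I T + M_R T * M_A T)))
        ((s ^- 2)%:E * (M_f T * L_A T * (1 + M_A T + M_A T ^+ 2))))%E.

End Constants.

(* Main.v *)
From HB Require Import structures.
Require Import Defs.
From mathcomp Require Import all_boot all_order all_algebra.
From mathcomp Require Import all_classical all_reals all_analysis.
From mathcomp Require Import ring lra.
From mathcomp Require complex.

Set Implicit Arguments.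
Unset Strict Implicit.
Unset Printing Implicit Defensive.

Import Order.TTheory GRing.Theory Num.Theory.
Import numFieldNormedType.Exports.

Local Open Scope classical_set_scope.
Local Open Scope ring_scope.

(** Write h for the penalized objective, J and JA for the Jacobians of c and A at
x, and B for the derivative of the Jacobian of A at x.

The multiplier Gamma of the constrained problem is forced.  The transpose of JA
fixes the normals of X at x and annihilates the gradients of c, so applying it to
grad f + J lam + Gamma = 0 leaves Gamma = - grad f JA^T, which is - grad h.
First-order stationarity therefore carries over, and by polarity d |-> d JA maps
tangent directions to tangent directions.  A critical direction d of the
penalized problem splits as d1 + d2, where d1 = d JA is critical for the
constrained problem and d2 JA = 0: indeed every direction tangent to X and
killed by J is tangent to the feasible set ([tangent_feasible_set]), hence fixed
by JA ([dissolving_fixes_tangent]).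

The two second-order conditions use the second-order tangent sets along d and
along d1.  They are compared by [tangent2_transport]: to each z tangent of second
order along d corresponds some z' tangent of second order along d1 with
<Gamma, z'> >= <Gamma, z> + 2 <Gamma, d2 (B d1)> - eps.  The point z' comes from
projecting a shifted ray x + t d1 + kappa t^2 Gamma on X: the residuals are
normals of X at nearby points, and the condition that JA(y) nearly fixes the
normals at y, tested against d1 and d2, yields both the curvature term above and
<Gamma, d1 (B d1)> = 0 ([normal_curvature_d1]).

The quadratic form of the Hessian of h at d is the sum of that of f at d1, of
<grad f, d (B d)> and of beta |d J|^2.  Expand the middle term along d1 + d2; the
two mixed terms agree ([second_derivative_sym]).  Substitute
grad f = - J lam - Gamma and the derivative along d1 of the identity
JA(y) J(y) = 0 on the feasible set ([dissolving_second_order]): the (d1, d1) term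
becomes the curvature of c in the Lagrangian, and the mixed terms become
- 2 <Gamma, d2 (B d1)>, which the transport absorbs.  What is left is
<grad f, d2 (B d2)>.  The vector d2 depends only on d J: it is u - u JA for the
preimage u of d J orthogonal to the kernel of J in the direction space, and |u| <= |d J| / sigma_r
([singval_rank_gap], [kernel_complement]).  The Lipschitz quotient of the Jacobian
of A bounds B on the direction space of X ([lipschitz_derivative_bound]), and the
second term of the threshold for beta is exactly what makes beta |d J|^2 dominate
([oblique_bound]). *)

(** * The Euclidean inner product and norm *)

Section EuclideanTheory.
Variable R : realType.
Implicit Types n m p : nat.

Lemma dotC n (u v : 'rV[R]_n) : dot u v = dot v u.
Proof. by apply: eq_bigr => i _; rewrite mulrC. Qed.

Lemma dotDl n (u v w : 'rV[R]_n) : dot (u + v) w = dot u w + dot v w.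
Proof. by rewrite /dot -big_split; apply: eq_bigr => i _; rewrite mxE mulrDl. Qed.

Lemma dotZl n a (u w : 'rV[R]_n) : dot (a *: u) w = a * dot u w.
Proof. by rewrite /dot mulr_sumr; apply: eq_bigr => i _; rewrite mxE mulrA. Qed.

Lemma dotNl n (u w : 'rV[R]_n) : dot (- u) w = - dot u w.
Proof. by rewrite -scaleN1r dotZl mulN1r. Qed.

Lemma dotBl n (u v w : 'rV[R]_n) : dot (u - v) w = dot u w - dot v w.
Proof. by rewrite dotDl dotNl. Qed.

Lemma dotDr n (u v w : 'rV[R]_n) : dot w (u + v) = dot w u + dot w v.
Proof. by rewrite dotC dotDl !(dotC w). Qed.

Lemma dotZr n a (u w : 'rV[R]_n) : dot w (a *: u) = a * dot w u.
Proof. by rewrite dotC dotZl (dotC w). Qed.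

Lemma dotNr n (u w : 'rV[R]_n) : dot w (- u) = - dot w u.
Proof. by rewrite dotC dotNl (dotC w). Qed.

Lemma dotBr n (u v w : 'rV[R]_n) : dot w (u - v) = dot w u - dot w v.
Proof. by rewrite dotDr dotNr. Qed.

Lemma dot0l n (w : 'rV[R]_n) : dot 0 w = 0.
Proof. by rewrite -(scale0r 0) dotZl mul0r. Qed.

Lemma dot0r n (w : 'rV[R]_n) : dot w 0 = 0.
Proof. by rewrite dotC dot0l. Qed.

Definition dotE := (dotDl, dotDr, dotZl, dotZr, dotNl, dotNr, dot0l, dot0r).

Lemma dot_trmx n (u v : 'rV[R]_n) : dot u v = (u *m v^T) 0 0.
Proof. by rewrite mxE; apply: eq_bigr => i _; rewrite !mxE. Qed.

Lemma dot_mulmxl n m (M : 'M[R]_(n, m)) u v : dot (u *m M) v = dot u (v *m M^T).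
Proof. by rewrite !dot_trmx trmx_mul trmxK mulmxA. Qed.

Lemma dot_ge0 n (u : 'rV[R]_n) : 0 <= dot u u.
Proof. by apply: sumr_ge0 => i _; rewrite -expr2 sqr_ge0. Qed.

Lemma dot_eq0 n (u : 'rV[R]_n) : (dot u u == 0) = (u == 0).
Proof.
apply/eqP/eqP => [h|->]; last by rewrite dot0l.
apply/rowP => i; rewrite mxE; apply/eqP.
have h1 j : true -> 0 <= u 0 j * u 0 j by rewrite -expr2 sqr_ge0.
have /eqP : u 0 i * u 0 i = 0 by exact: (psumr_eq0P h1 h).
by rewrite mulf_eq0 orbb.
Qed.

Lemma l2_ge0 n (u : 'rV[R]_n) : 0 <= l2norm u.
Proof. exact: sqrtr_ge0. Qed.

Lemma l2_sqr n (u : 'rV[R]_n) : l2norm u ^+ 2 = dot u u.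
Proof. by rewrite sqr_sqrtr // dot_ge0. Qed.

Lemma l2_eq0 n (u : 'rV[R]_n) : (l2norm u == 0) = (u == 0).
Proof. by rewrite -dot_eq0 -l2_sqr sqrf_eq0. Qed.

Lemma l2_gt0 n (u : 'rV[R]_n) : (0 < l2norm u) = (u != 0).
Proof. by rewrite lt_def l2_ge0 andbT l2_eq0. Qed.

Lemma l2_0 n : l2norm (0 : 'rV[R]_n) = 0.
Proof. by apply/eqP; rewrite l2_eq0. Qed.

Lemma l2Z n a (u : 'rV[R]_n) : l2norm (a *: u) = `|a| * l2norm u.
Proof. by rewrite /l2norm !dotE mulrA sqrtrM -?expr2 ?sqr_ge0 // sqrtr_sqr. Qed.

Lemma l2N n (u : 'rV[R]_n) : l2norm (- u) = l2norm u.
Proof. by rewrite -scaleN1r l2Z normrN1 mul1r. Qed.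

Lemma l2B n (u v : 'rV[R]_n) : l2norm (u - v) = l2norm (v - u).
Proof. by rewrite -opprB l2N. Qed.

Lemma cauchy_schwarz n (u v : 'rV[R]_n) : `|dot u v| <= l2norm u * l2norm v.
Proof.
have [->|v0] := eqVneq v 0; first by rewrite dot0r normr0 mulr_ge0 ?l2_ge0.
rewrite -(@ler_pXn2r _ 2) ?nnegrE ?mulr_ge0 ?l2_ge0 //.
rewrite exprMn !l2_sqr real_normK ?num_real //.
have v1 : 0 < dot v v by rewrite lt_def dot_ge0 dot_eq0 v0.
suff : 0 <= dot v v * (dot u u * dot v v - dot u v ^+ 2).
  by rewrite pmulr_rge0 // subr_ge0.
have := dot_ge0 (dot v v *: u - dot u v *: v); rewrite !dotE (dotC v u).
by congr (_ <= _); ring.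
Qed.

Lemma dot_le n (u v : 'rV[R]_n) : dot u v <= l2norm u * l2norm v.
Proof. exact: le_trans (ler_norm _) (cauchy_schwarz u v). Qed.

Lemma l2D n (u v : 'rV[R]_n) : l2norm (u + v) <= l2norm u + l2norm v.
Proof.
rewrite -(@ler_pXn2r _ 2) ?nnegrE ?addr_ge0 ?l2_ge0 //.
rewrite sqrrD !l2_sqr !dotE (dotC v u); have := dot_le u v; lra.
Qed.

Lemma l2BD n (u v : 'rV[R]_n) : l2norm (u - v) <= l2norm u + l2norm v.
Proof. by rewrite -(l2N v) l2D. Qed.

Lemma l2_tri n (w u v : 'rV[R]_n) : l2norm (u - v) <= l2norm (u - w) + l2norm (w - v).
Proof. by have := l2D (u - w) (w - v); rewrite addrA subrK. Qed.

Lemma l2_sum n I (r : seq I) (P : pred I) (F : I -> 'rV[R]_n) :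
  l2norm (\sum_(i <- r | P i) F i) <= \sum_(i <- r | P i) l2norm (F i).
Proof.
elim/big_rec2: _ => [|i y1 y2 _ h]; first by rewrite l2_0.
by apply: le_trans (l2D _ _) _; rewrite lerD2l.
Qed.

Lemma coord_le_l2 n (u : 'rV[R]_n) i : `|u 0 i| <= l2norm u.
Proof.
rewrite -(@ler_pXn2r _ 2) ?nnegrE ?l2_ge0 // l2_sqr real_normK ?num_real //.
rewrite /dot (bigD1 i) //= -expr2 lerDl; apply: sumr_ge0 => j _.
by rewrite -expr2 sqr_ge0.
Qed.

(** Differentiability, neighbourhoods and Lipschitz continuity on row vectors
are stated with the sup norm; together with [l2_le_norm] this carries them over
to the Euclidean norm. *)
Lemma norm_le_l2 n (u : 'rV[R]_n) : `|u| <= l2norm u.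
Proof.
rewrite [leLHS]mx_normrE; apply: bigmax_le; first exact: l2_ge0.
by move=> [i j] _ /=; rewrite ord1 coord_le_l2.
Qed.

Lemma coord_le_norm m n (M : 'M[R]_(m, n)) i j : `|M i j| <= `|M|.
Proof. by rewrite [leRHS]mx_normrE (le_bigmax _ (fun ij => `|M ij.1 ij.2|) (i, j)). Qed.

Lemma l2_le_norm n (u : 'rV[R]_n) : l2norm u <= n%:R * `|u|.
Proof.
rewrite [X in l2norm X]row_sum_delta; apply: le_trans (l2_sum _ _ _) _.
rewrite mulr_natl -[X in _ *+ X]card_ord -sumr_const.
apply: ler_sum => i _; rewrite l2Z.
have -> : l2norm (delta_mx 0 i : 'rV[R]_n) = 1.
  rewrite /l2norm /dot (bigD1 i) //= big1 => [|j ji].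
    by rewrite addr0 mxE !eqxx mulr1 sqrtr1.
  by rewrite mxE eqxx (negPf ji) mul0r.
by rewrite mulr1 coord_le_norm.
Qed.

Lemma l2_mulmx n m (M : 'M[R]_(n, m)) (u : 'rV[R]_n) :
  l2norm (u *m M) <= m%:R * n%:R * `|M| * l2norm u.
Proof.
apply: le_trans (l2_le_norm _) _; rewrite -!mulrA ler_wpM2l //.
rewrite [leLHS]mx_normrE; apply: bigmax_le => [|[i j] _ /=].
  by rewrite !mulr_ge0 // l2_ge0.
rewrite mxE; apply: le_trans (ler_norm_sum _ _ _) _.
rewrite mulr_natl -[X in _ *+ X]card_ord -sumr_const.
apply: ler_sum => k _; rewrite normrM mulrC ord1.
by rewrite ler_pM // ?coord_le_l2 // coord_le_norm.
Qed.

Lemma mulmx_bounded n m (M : 'M[R]_(n, m)) :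
  exists2 C, 0 < C & forall u : 'rV[R]_n, l2norm (u *m M) <= C * l2norm u.
Proof.
exists (m%:R * n%:R * `|M| + 1) => [|u].
  by rewrite ltr_wpDl // !mulr_ge0.
by apply: le_trans (l2_mulmx _ _) _; rewrite ler_wpM2r ?l2_ge0 // lerDl.
Qed.

Lemma opnorm_has_sup m n (M : 'M[R]_(m, n)) :
  has_sup [set l2norm (mulmxv M v) | v in [set v : 'rV[R]_n | l2norm v <= 1]].
Proof.
split; first by exists (l2norm (mulmxv M 0)), 0; rewrite //= l2_0.
have [C C0 h] := mulmx_bounded M^T; exists C => _ [v /= v1 <-].
by apply: le_trans (h v) _; rewrite ler_piMr // ltW.
Qed.

Lemma opnorm_ge0 m n (M : 'M[R]_(m, n)) : 0 <= opnorm M.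
Proof.
apply: le_trans (sup_upper_bound (opnorm_has_sup M) _); first exact: (l2_ge0 (mulmxv M 0)).
by exists 0; rewrite //= l2_0.
Qed.

Lemma opnormP m n (M : 'M[R]_(m, n)) v : l2norm (mulmxv M v) <= opnorm M * l2norm v.
Proof.
have [->|v0] := eqVneq v 0; first by rewrite /mulmxv mul0mx !l2_0 mulr0.
have v1 : 0 < l2norm v by rewrite l2_gt0.
rewrite -ler_pdivrMr // mulrC.
have := sup_upper_bound (opnorm_has_sup M); apply.
have vi : 0 <= (l2norm v)^-1 by rewrite invr_ge0 ltW.
exists ((l2norm v)^-1 *: v); rewrite /mulmxv /= -?scalemxAl l2Z ger0_norm //.
by rewrite mulVf // gt_eqF.
Qed.

(** The operator norm also bounds the transposed action, which is the one in
which Jacobians act on directions: pair u M with itself and move M across. *)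
Lemma opnorm_trP m n (M : 'M[R]_(m, n)) (u : 'rV[R]_m) :
  l2norm (u *m M) <= opnorm M * l2norm u.
Proof.
have [h|h] := eqVneq (u *m M) 0.
  by rewrite h l2_0 mulr_ge0 ?opnorm_ge0 ?l2_ge0.
rewrite -(@ler_pM2l _ (l2norm (u *m M))) ?l2_gt0 // -expr2 l2_sqr dot_mulmxl.
apply: le_trans (dot_le _ _) _; rewrite mulrC mulrCA mulrA ler_wpM2r ?l2_ge0 //.
exact: opnormP.
Qed.

Lemma pythagoras n (u v : 'rV[R]_n) : dot u v = 0 ->
  l2norm (u - v) ^+ 2 = l2norm u ^+ 2 + l2norm v ^+ 2.
Proof. by move=> h; rewrite !l2_sqr !dotE (dotC v u) h; ring. Qed.

End EuclideanTheory.

(** * Topology and distances in the Euclidean norm *)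

Section Topology.
Variables (R : realType) (n : nat).
Implicit Types (e : R) (S X : set 'rV[R]_n) (x y z d q : 'rV[R]_n).

Lemma nbhs_l2 (p : 'rV[R]_n) (B : set 'rV[R]_n) : nbhs p B ->
  exists2 e, 0 < e & forall y, l2norm (y - p) < e -> B y.
Proof.
move=> /nbhs_ballP [e /= e0 h]; exists e => // y hy; apply: h.
rewrite -ball_normE /= -normrN opprB.
exact: le_lt_trans (norm_le_l2 _) hy.
Qed.

Lemma closed_l2 S (p : 'rV[R]_n) : closed S ->
  (forall e, 0 < e -> exists2 y, S y & l2norm (y - p) < e) -> S p.
Proof.
move=> cS h; apply: cS => B /nbhs_l2 [e e0 hB].
by have [y Sy yp] := h e e0; exists y; split=> //; apply: hB.
Qed.

Lemma open_l2 S (p : 'rV[R]_n) : open S -> S p ->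
  exists2 e, 0 < e & forall y, l2norm (y - p) < e -> S y.
Proof. by move=> oS Sp; apply/nbhs_l2/open_nbhs_nbhs. Qed.

Lemma bounded_cluster (u : nat -> 'rV[R]_n) C :
  (forall k, l2norm (u k) <= C) ->
  exists p, forall e N, 0 < e -> exists2 k, (N <= k)%N & l2norm (u k - p) < e.
Proof.
move=> uC; pose A := [set v : 'rV[R]_n | forall i, `[- C, C]%classic (v ord0 i)].
have cA : compact A.
  by apply: (rV_compact (A := fun=> `[- C, C]%classic)) => i; exact: segment_compact.
have uA k : A (u k).
  move=> i /=; rewrite in_itv /= -ler_norml.
  exact: le_trans (coord_le_l2 _ _) (uC k).
have FA : (u @ \oo) A by exists 0%N => // k _; exact: uA.
have [p [_ hp]] := cA (u @ \oo) (fmap_proper_filter u _) FA.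
exists p => e N e0.
have e1 : 0 < e / (n%:R + 1) by rewrite divr_gt0 // ltr_wpDl.
have FN : (u @ \oo) [set u k | k in [set k | (N <= k)%N]].
  by exists N => // k /= Nk; exists k.
have [v [[k /= Nk <-] hv]] := hp _ _ FN (nbhsx_ballx p _ e1).
exists k => //; apply: le_lt_trans (l2_le_norm _) _.
move: hv; rewrite -ball_normE /= -normrN opprB => hv.
rewrite ltr_pdivlMr // ?ltr_wpDl // in hv; apply: le_lt_trans hv.
by rewrite mulrC ler_wpM2l // lerDl.
Qed.

Lemma dist_ge0 z S : 0 <= dist z S.
Proof.
rewrite /dist; have [->|/set0P[y Sy]] := eqVneq S set0.
  by rewrite image_set0 inf0.
by apply: lb_le_inf => [|_ [w _ <-]]; [exists (l2norm (z - y)), y | exact: l2_ge0].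
Qed.

Lemma dist_le z S y : S y -> dist z S <= l2norm (z - y).
Proof.
move=> Sy; apply: ge_inf; last by exists y.
by exists 0 => _ [w _ <-]; exact: l2_ge0.
Qed.

Lemma dist_lt z S e : S !=set0 -> dist z S < e -> exists2 y, S y & l2norm (z - y) < e.
Proof.
move=> [y0 Sy0]; rewrite /dist => h.
have [|_ [y Sy <-] hy] := inf_lt _ h; last by exists y.
by exists (l2norm (z - y0)), y0.
Qed.

(** The lower bound by zero is free for a nonnegative function, so the filter
quantifiers of the lower limit reduce to one existential statement.  The cones
are only manipulated through this form. *)
Lemma liminf0P (g : R -> R) : (forall t, 0 <= g t) ->
  limf_einf (fun t => (g t)%:E) 0^'+ = 0%E <->
  forall e dl : R, 0 < e -> 0 < dl -> exists t, [/\ 0 < t, t < dl & g t < e].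
Proof.
move=> g0; rewrite limf_einfE; split=> [h e dl e0 dl0|h].
  pose V := [set t : R | 0 < t /\ t < dl].
  have FV : (0^'+ : set_system R) V.
    by near=> t; split; near: t; [exact: nbhs_right_gt|exact: nbhs_right_lt].
  have : (ereal_inf [set (g t)%:E | t in V] < e%:E)%E.
    apply: (@le_lt_trans _ _ 0%E); last by rewrite lte_fin.
    by rewrite -h; apply: ereal_sup_ubound; exists V.
  move=> /ereal_inf_lt [_ [t [t0 tdl] <-]]; rewrite lte_fin => ge.
  by exists t.
apply/eqP; rewrite eq_le; apply/andP; split.
  apply: ge_ereal_sup => _ [V FV <-].
  apply/lee_addgt0Pr => e e0; rewrite add0e.
  have [dl /= dl0 hV] := FV.
  have [t [t0 tdl ge]] := h e dl e0 dl0.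
  apply: (@le_trans _ _ (g t)%:E); last by rewrite lee_fin ltW.
  apply: ereal_inf_lbound; exists t => //; apply: hV => //.
  by rewrite /= sub0r normrN gtr0_norm.
apply: le_ereal_sup_tmp; exists (ereal_inf [set (g t)%:E | t in setT]).
  by exists setT => //; exact: filterT.
by apply/ereal_infP => _ [t _ <-]; rewrite lee_fin.
Unshelve. all: by end_near. Qed.

End Topology.

(** * Tangent sets and projections on convex sets *)

Section Archimedean.
Variable R : realType.

Lemma small_inv (e : R) : 0 < e -> exists N, forall k, (N <= k)%N -> k.+1%:R^-1 < e.
Proof.
move=> e0; have ei : 0 <= e^-1 by rewrite invr_ge0 ltW.
exists (Num.bound e^-1) => k hk; rewrite -[e]invrK ltf_pV2 ?posrE ?invr_gt0 //.
have /andP[_ h] := truncn_itv ei.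
apply: lt_le_trans (archi_boundP ei) _; rewrite ler_nat; exact: leqW.
Qed.

Lemma le_mul_eps (C a b : R) : 0 <= C -> (forall e, 0 < e -> a <= b + C * e) -> a <= b.
Proof.
move=> C0 h; apply/ler_addgt0Pr => e e0.
have C1 : 0 < C + 1 by rewrite ltr_wpDl.
apply: le_trans (h (e / (C + 1)) (divr_gt0 e0 C1)) _.
by rewrite lerD2l mulrCA ger_pMr // ler_pdivrMr // mul1r lerDl.
Qed.

Lemma le_mul_eps1 (C a b : R) :
  0 <= C -> (forall e, 0 < e -> e <= 1 -> a <= b + C * e) -> a <= b.
Proof.
move=> C0 h; apply: (le_mul_eps C0) => e e0.
have m0 : 0 < Num.min e 1 by rewrite lt_min e0 ltr01.
apply: le_trans (h _ m0 _) _; first by rewrite ge_min lexx orbT.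
by rewrite lerD2l ler_wpM2l // ge_min lexx.
Qed.

End Archimedean.

Section ConvexGeometry.
Variables (R : realType) (n : nat) (X : set 'rV[R]_n).
Implicit Types (e dl t : R) (S : set 'rV[R]_n) (x y z d q w v : 'rV[R]_n).

(** Clears the scale factor g t in the distance to a blown-up set, for the
first-order and second-order tangent sets at once. *)
Lemma scaled_dist (g : R -> R) (phi : R -> 'rV[R]_n -> 'rV[R]_n) z S :
  S !=set0 -> (forall t, 0 < t -> 0 < g t) ->
  limf_einf (fun t =>
    (dist z [set (g t)^-1 *: (phi t y) | y in S])%:E) 0^'+ = 0%E <->
  forall e dl, 0 < e -> 0 < dl ->
    exists t y, [/\ 0 < t, t < dl, S y & l2norm (phi t y - g t *: z) <= e * g t].
Proof.
move=> S0 g0.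
have key t y : 0 < t ->
    l2norm (phi t y - g t *: z) = g t * l2norm (z - (g t)^-1 *: phi t y).
  move=> /g0 gt0; rewrite -[g t in X in _ = X * _]gtr0_norm // -l2Z scalerBr scalerA mulfV ?gt_eqF //.
  by rewrite scale1r l2B.
rewrite (liminf0P (fun t => dist_ge0 _ _)); split=> h e dl e0 dl0.
  have [t [t0 tdl /dist_lt []]] := h e dl e0 dl0.
    by have [y Sy] := S0; exists ((g t)^-1 *: phi t y), y.
  move=> _ [y Sy <-] hy; exists t, y; split=> //.
  by rewrite key // mulrC ler_pM2r ?g0 // ltW.
have [t [y [t0 tdl Sy]]] := h (e / 2) dl (divr_gt0 e0 (ltr0Sn _ 1)) dl0.
rewrite key // mulrC ler_pM2r ?g0 // => hy; exists t; split=> //.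
apply: le_lt_trans (_ : _ <= l2norm (z - (g t)^-1 *: phi t y)) _.
  by apply: dist_le; exists y.
by apply: le_lt_trans hy _; lra.
Qed.

Lemma tangentP S x d : S x -> tangent_cone S x d <->
  forall e dl, 0 < e -> 0 < dl ->
    exists t y, [/\ 0 < t, t < dl, S y & l2norm (y - x - t *: d) <= e * t].
Proof. by move=> Sx; apply: (scaled_dist (fun t y => y - x)) => //; exists x. Qed.

Lemma tangent2P S x w z : S x -> tangent2 S x w z <->
  forall e dl, 0 < e -> 0 < dl -> exists t y, [/\ 0 < t, t < dl, S y &
    l2norm (y - x - t *: w - (2^-1 * t ^+ 2) *: z) <= e * (2^-1 * t ^+ 2)].
Proof.
move=> Sx; apply: (scaled_dist (fun t y => y - x - t *: w)); first by exists x.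
by move=> t t0; rewrite mulr_gt0 ?invr_gt0 ?exprn_gt0.
Qed.

Hypothesis X_closed : closed X.
Hypothesis X_convex : convex_set (X : set (convex_lmodType 'rV[R]_n)).

Lemma convex_comb x y t : X x -> X y -> 0 <= t -> t <= 1 -> X (x + t *: (y - x)).
Proof.
move=> Xx Xy t0 t1.
have := X_convex (Itv01 t0 t1) (mem_set Xy) (mem_set Xx).
rewrite inE; congr (X _); change (t *: y + (1 - t) *: x = x + t *: (y - x)).
by rewrite scalerBl scale1r scalerBr addrC -addrA [- _ + _]addrC.
Qed.

(** A minimizing sequence is bounded and its cluster point attains the distance.
The residual is normal to X because moving from the nearest point towards any
w in X cannot decrease the distance to first order. *)
Lemma projection q : X !=set0 -> exists y, [/\ X y, normal_cone X y (q - y) &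
  forall w, X w -> l2norm (q - y) <= l2norm (q - w)].
Proof.
move=> X0; have dlt k : dist q X < dist q X + k.+1%:R^-1 by rewrite ltrDl.
have /all_sig2 [u uX hu] k := cid2 (dist_lt X0 (dlt k)).
have [|p hp] := @bounded_cluster _ _ u (l2norm q + (dist q X + 1)).
  move=> k; rewrite -[u k](subKr q); apply: le_trans (l2BD _ _) _.
  rewrite lerD2l (le_trans (ltW (hu k))) // lerD2l invf_le1 ?ltr0Sn //.
  by rewrite ler1n.
have Xp : X p.
  apply: closed_l2 => // e e0; have [k _ hk] := hp e 0%N e0; by exists (u k).
have pmin w : X w -> l2norm (q - p) <= l2norm (q - w).
  move=> Xw; apply: le_trans (dist_le q Xw).
  apply: (@le_mul_eps _ 2) => // e e0.
  have [N hN] := small_inv e0; have [k Nk hk] := hp e N e0.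
  apply: le_trans (l2_tri (u k) _ _) _.
  by move: (hu k) (hN k Nk) hk; set i := _.+1%:R^-1; lra.
exists p; split=> // w Xw; rewrite leNgt; apply/negP => a0.
set a := dot _ _ in a0; set b := dot (w - p) (w - p).
have b0 : 0 <= b by exact: dot_ge0.
pose t := Num.min 1 (a / (b + 1)).
have b1 : 0 < b + 1 by rewrite ltr_wpDl.
have t0 : 0 < t by rewrite lt_min ltr01 divr_gt0.
have t1 : t <= 1 by rewrite ge_min lexx.
have := pmin _ (convex_comb Xp Xw (ltW t0) t1).
rewrite opprD addrA -ler_sqr ?nnegrE ?l2_ge0 // !l2_sqr.
move: (q - p) (w - p) @a a0 @b b0 @t b1 t0 t1 => u1 w1 a a0 b b0 t b1 t0 t1.
rewrite [leRHS]dotBl [in leRHS]dotBr [in leRHS]dotBr !dotZr !dotZl (dotC w1 u1) -/a -/b => h.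
have : 2 * a <= t * b.
  by rewrite -(ler_pM2l t0); move: h; lra.
have : t * b <= a.
  apply: (@le_trans _ _ (a / (b + 1) * b)).
    by rewrite ler_wpM2r // ge_min lexx orbT.
  by rewrite mulrAC ler_pdivrMr // ler_pM2l // lerDl.
by move: a0; lra.
Qed.

(** Half of the bipolar theorem: the residuals of projecting x + t w, divided
by t, accumulate at a normal vector v with |v|^2 <= <v, w>, so the polarity
of w forces them to zero and w is tangent. *)
Lemma polar_normal_tangent x w : X x ->
  (forall v, normal_cone X x v -> dot w v <= 0) -> tangent_cone X x w.
Proof.
move=> Xx hw; have X0 : X !=set0 by exists x.
apply/tangentP => // e dl e0 dl0.
pose t k : R := dl / k.+2%:R.
have t0 k : 0 < t k by rewrite divr_gt0.
have tdl k : t k < dl by rewrite ltr_pdivrMr // ltr_pMr // ltr1n.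
have /all_sig [y hy] k := cid (projection (x + t k *: w) X0).
pose v k := (t k)^-1 *: (x + t k *: w - y k).
have tv k : t k *: v k = x + t k *: w - y k by rewrite scalerA mulfV ?gt_eqF // scale1r.
have Xy k : X (y k) by case: (hy k).
have vN k : normal_cone X (y k) (v k).
  move=> z Xz; rewrite dotZl; case: (hy k) => _ /(_ z Xz) h _.
  by rewrite pmulr_rle0 // invr_gt0.
have vw k : l2norm (v k) <= l2norm w.
  rewrite -(ler_pM2l (t0 k)) -[X in X * _](gtr0_norm (t0 k)) -l2Z tv.
  rewrite -[X in X * l2norm w](gtr0_norm (t0 k)) -l2Z.
  by case: (hy k) => _ _ /(_ x Xx); rewrite [in leRHS]addrAC subrr add0r.
have yx k : y k - x = t k *: (w - v k).
  by rewrite scalerBr tv; apply/rowP => i; rewrite !mxE; ring.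
have yxn k : l2norm (y k - x) <= t k * (2 * l2norm w).
  rewrite yx l2Z gtr0_norm // ler_pM2l //; apply: le_trans (l2BD _ _) _.
  by have := vw k; lra.
have [v0 hv0] := bounded_cluster vw.
have v0N : normal_cone X x v0.
  move=> z Xz; apply: (@le_mul_eps _ (l2norm (z - x) + l2norm w * (dl * (2 * l2norm w)))).
    by rewrite addr_ge0 ?mulr_ge0 ?l2_ge0 // ltW.
  move=> eps eps0; have [N hN] := small_inv eps0; have [k Nk hk] := hv0 eps N eps0.
  have -> : dot v0 (z - x) = dot (v k) (z - y k) + dot (v k) (y k - x) - dot (v k - v0) (z - x).
    by rewrite !dotE; ring.
  have h1 := vN k z Xz.
  have tk : t k <= dl * eps.
    rewrite ler_pM2l //; apply: le_trans (ltW (hN k Nk)).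
    by rewrite lef_pV2 ?posrE // ler_nat.
  have h2 : dot (v k) (y k - x) <= l2norm w * (dl * (2 * l2norm w)) * eps.
    apply: le_trans (dot_le _ _) _; rewrite -mulrA ler_pM ?l2_ge0 //.
    apply: le_trans (yxn k) _; rewrite [leRHS]mulrAC ler_wpM2r //.
    by rewrite mulr_ge0 // l2_ge0.
  have h3 : - dot (v k - v0) (z - x) <= l2norm (z - x) * eps.
    rewrite -dotNl; apply: le_trans (dot_le _ _) _.
    by rewrite l2N mulrC ler_wpM2l ?l2_ge0 // ltW.
  lra.
have w1 : 0 < l2norm w + 1 by rewrite ltr_wpDl ?l2_ge0.
have eps0 : 0 < e ^+ 2 / (l2norm w + 1) by rewrite divr_gt0 // exprn_gt0.
have [k _ hk] := hv0 _ 0%N eps0.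
exists (t k), (y k); split=> //.
have -> : y k - x - t k *: w = - (t k *: v k).
  by rewrite yx scalerBr addrAC subrr add0r.
rewrite l2N l2Z gtr0_norm // mulrC ler_pM2r //.
rewrite -ler_sqr ?nnegrE ?l2_ge0 //; last exact: ltW.
rewrite l2_sqr.
have h1 : dot (v k) (v k) <= dot (v k) w.
  have := vN k x Xx; rewrite -opprB yx dotNr dotZr dotBr.
  by rewrite oppr_le0 pmulr_rge0 // subr_ge0.
apply: (le_trans h1).
have -> : dot (v k) w = dot w v0 + dot (v k - v0) w by rewrite !dotE (dotC w); ring.
have h2 : dot (v k - v0) w <= e ^+ 2 / (l2norm w + 1) * l2norm w.
  by apply: le_trans (dot_le _ _) _; rewrite ler_wpM2r ?l2_ge0 // ltW.
have h3 : e ^+ 2 / (l2norm w + 1) * l2norm w <= e ^+ 2.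
  by rewrite mulrAC ler_pdivrMr // ler_pM2l ?exprn_gt0 // lerDl.
have := hw _ v0N; lra.
Qed.

End ConvexGeometry.

(** * Convex sets inside their affine hull *)

Section AffineHull.
Variables (R : realType) (n : nat) (X : set 'rV[R]_n) (P : 'M[R]_n).
Implicit Types (e dl t eta : R) (x y z d q w v : 'rV[R]_n).

Hypothesis P_proj : is_orthoproj (aff_dir X) P.

Lemma orthoproj_tr : P^T = P. Proof. by case: P_proj. Qed.

Lemma aff_dirP d : aff_dir X d <-> d *m P = d.
Proof.
have [PT PP PE] := P_proj; rewrite -PE /mulmxv PT; split=> [[v _ <-]|dP].
  by rewrite -mulmxA PP.
by exists d.
Qed.

Lemma aff_dirD d w : aff_dir X d -> aff_dir X w -> aff_dir X (d + w).
Proof. by rewrite !aff_dirP mulmxDl => -> ->. Qed.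

Lemma aff_dirZ (a : R) d : aff_dir X d -> aff_dir X (a *: d).
Proof. by rewrite !aff_dirP -scalemxAl => ->. Qed.

Lemma aff_dirB d w : aff_dir X d -> aff_dir X w -> aff_dir X (d - w).
Proof. by move=> hd hw; rewrite -scaleN1r; apply: aff_dirD => //; apply: aff_dirZ. Qed.

Lemma sub_aff y : X y -> aff X y.
Proof.
move=> Xy; exists 1%N, (fun=> 1), (fun=> y); split=> //.
  by rewrite big_ord1.
by rewrite big_ord1 scale1r.
Qed.

Lemma aff_subr x y : X x -> aff X y -> aff_dir X (y - x).
Proof. by move=> Xx ay; exists y => //; exists x. Qed.

Lemma X_subr x y : X x -> X y -> aff_dir X (y - x).
Proof. by move=> Xx /sub_aff; apply: aff_subr. Qed.

(** The direction space is closed: it is the kernel of P - 1. *)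
Lemma tangent_aff_dir x d : X x -> tangent_cone X x d -> aff_dir X d.
Proof.
move=> Xx /tangentP -/(_ Xx) h; apply/aff_dirP/eqP; rewrite -subr_eq0 -l2_eq0.
have [C C0 hC] := mulmx_bounded (P - 1%:M).
rewrite eq_le l2_ge0 andbT; apply: (@le_mul_eps _ C _ 0) => [|e e0]; first exact: ltW.
have [t [y [t0 _ Xy hy]]] := h e 1 e0 ltr01.
have /aff_dirP yP := X_subr Xx Xy.
have := hC (y - x - t *: d); rewrite mulmxBr mulmx1 mulmxBl yP -scalemxAl.
rewrite (_ : _ - _ = - (t *: (d *m P - d))); last first.
  by apply/rowP => i; rewrite !mxE; ring.
rewrite l2N l2Z gtr0_norm // add0r => hC'.
rewrite -(ler_pM2l t0) (le_trans hC') // mulrCA ler_pM2l //.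
by rewrite mulrC.
Qed.

Hypothesis X_convex : convex_set (X : set (convex_lmodType 'rV[R]_n)).

Lemma convex_scale x p t : X x -> X (x + p) -> 0 <= t -> t <= 1 -> X (x + t *: p).
Proof.
by move=> Xx Xp t0 t1; have := convex_comb X_convex Xx Xp t0 t1; rewrite addrAC subrr add0r.
Qed.

Lemma convex_add x p q t s : X x -> X (x + p) -> X (x + q) ->
  0 <= t -> 0 <= s -> t + s <= 1 -> X (x + (t *: p + s *: q)).
Proof.
move=> Xx Xp Xq; rewrite le_eqVlt => /orP[/eqP<-|t0].
  by rewrite scale0r !add0r; apply: convex_scale.
move=> s0 ts; have ts0 : 0 < t + s by rewrite ltr_pwDl.
have -> : t *: p + s *: q = (t + s) *: (p + (s / (t + s)) *: (q - p)).
  rewrite scalerDr scalerA mulrCA mulfV ?gt_eqF // mulr1 scalerBr.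
  by apply/rowP => i; rewrite !mxE; ring.
apply: convex_scale => //; last exact: ltW.
have -> : x + (p + (s / (t + s)) *: (q - p)) =
    x + p + (s / (t + s)) *: (x + q - (x + p)).
  by apply/rowP => i; rewrite !mxE; ring.
apply: convex_comb => //; first by rewrite divr_ge0 // ltW.
by rewrite ler_pdivrMr // mul1r lerDr ltW.
Qed.

Lemma convex_sum x I (r : seq I) (F : I -> 'rV[R]_n) (a : I -> R) :
  X x -> (forall i, X (x + F i)) -> (forall i, 0 <= a i) ->
  \sum_(i <- r) a i <= 1 -> X (x + \sum_(i <- r) a i *: F i).
Proof.
move=> Xx XF a0 a1; pose s := \sum_(i <- r) a i.
suff [w Xw ->] : exists2 w, X (x + w) & \sum_(i <- r) a i *: F i = s *: w.
  by apply: convex_scale => //; apply: sumr_ge0.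
rewrite /s {a1 s}; elim: r => [|i r [w Xw hw]].
  by exists 0; rewrite ?addr0 // !big_nil scale0r.
rewrite !big_cons hw; set s := \sum_(j <- r) a j.
have s0 : 0 <= s by apply: sumr_ge0.
have [h|h] := eqVneq (a i + s) 0.
  have ai : a i = 0 by apply/eqP; rewrite eq_le a0 andbT; move: h s0; lra.
  have s00 : s = 0 by move: h; rewrite ai add0r.
  by exists 0; rewrite ?addr0 // ai s00 addr0 !scale0r addr0.
have h0 : 0 < a i + s by rewrite lt_def h addr_ge0.
exists ((a i / (a i + s)) *: F i + (s / (a i + s)) *: w).
  have hi := ltW h0.
  by apply: convex_add => //; rewrite ?divr_ge0 // -mulrDl mulfV.
by rewrite scalerDr !scalerA ![(a i + s) * _]mulrC !divfK ?gt_eqF.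
Qed.

(** The directions that, up to a positive factor, are differences of two
feasible steps from x; they form the linear span of X - x. *)
Let gen x d := exists eta p q,
  [/\ 0 < eta, X (x + p), X (x + q) & eta *: d = p - q].

Let genZ x (a : R) d : X x -> gen x d -> gen x (a *: d).
Proof.
move=> Xx [eta [p [q [eta0 Xp Xq h]]]].
have [a0|a0|->] := ltgtP a 0.
- exists (eta / - a), q, p; split=> //; first by rewrite divr_gt0 ?oppr_gt0.
  rewrite scalerA -mulrA invrN mulNr mulVf ?lt_eqF // mulrN1 scaleNr h.
  by rewrite opprB.
- exists (eta / a), p, q; split=> //; first by rewrite divr_gt0.
  by rewrite scalerA -mulrA mulVf ?gt_eqF // mulr1.
- by exists 1, 0, 0; split; rewrite ?addr0 // scale0r scaler0 subrr.
Qed.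

Let genD x d w : X x -> gen x d -> gen x w -> gen x (d + w).
Proof.
move=> Xx [e1 [p1 [q1 [e10 Xp1 Xq1 h1]]]] [e2 [p2 [q2 [e20 Xp2 Xq2 h2]]]].
pose s := e1 + e2; have s0 : 0 < s by rewrite addr_gt0.
exists (e1 * e2 / s), ((e2 / s) *: p1 + (e1 / s) *: p2), ((e2 / s) *: q1 + (e1 / s) *: q2).
have hs : e2 / s + e1 / s <= 1 by rewrite -mulrDl addrC mulfV // gt_eqF.
split.
- by rewrite divr_gt0 ?mulr_gt0.
- by apply: convex_add => //; rewrite divr_ge0 // ltW.
- by apply: convex_add => //; rewrite divr_ge0 // ltW.
- rewrite opprD addrACA -!scalerBr -h1 -h2 !scalerA scalerDr.
  by congr (_ *: _ + _ *: _); ring.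
Qed.

Let gen_aff x d : X x -> aff_dir X d -> gen x d.
Proof.
move=> Xx [_ [k [a [u [Xu a1 ->]]]] [x0 Xx0 <-]].
have gX y : X y -> gen x (y - x).
  move=> Xy; exists 1, (y - x), 0; split=> //; rewrite ?addr0 ?scale1r ?subr0 //.
  by rewrite addrC subrK.
have -> : \sum_i a i *: u i - x0 = \sum_i a i *: (u i - x) + (-1) *: (x0 - x).
  under [in RHS]eq_bigr do rewrite scalerBr.
  rewrite sumrB -scaler_suml a1 scale1r scaleN1r.
  by rewrite opprB addrA subrK.
apply: genD => //; last by apply: genZ => //; exact: gX.
elim/big_rec: _ => [|i y _ hy]; last by apply: genD => //; apply: genZ => //; exact: gX.
by exists 1, 0, 0; split; rewrite ?addr0 // scaler0 subrr.
Qed.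

(** A relatively interior direction.  Each row of the projection is, up to a
positive factor, a difference p i - q i of feasible steps; in a sum of all p i
and q i with equal small weights, the weights can be perturbed independently
while staying nonnegative, which moves the sum over a relative ball. *)
Lemma relint_direction x : X x -> exists b eta, [/\ aff_dir X b, 0 < eta &
  forall d t, aff_dir X d -> l2norm d <= eta -> 0 <= t -> t <= 1 ->
    X (x + t *: (b + d))].
Proof.
move=> Xx.
have Prow i : aff_dir X (row i P).
  by apply/aff_dirP; case: P_proj => _ PP _; rewrite -row_mul PP.
have /all_sig [et hp] i := cid (gen_aff Xx (Prow i)).
have /all_sig [p hq] i := cid (hp i).
have /all_sig [q h] i := cid (hq i).
have et0 i : 0 < et i by case: (h i).
have Xp i : X (x + p i) by case: (h i).
have Xq i : X (x + q i) by case: (h i).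
have hr i : et i *: row i P = p i - q i by case: (h i).
(* The weights 2 m +- 2 (d i / et i) below lie in [0, 4 m] and add up to at most 1. *)
pose m : R := (4 * n).+1%:R^-1.
have m0 : 0 < m by rewrite invr_gt0.
pose S := \sum_i (et i)^-1.
have S0 : 0 <= S by apply: sumr_ge0 => i _; rewrite invr_ge0 ltW.
have S1 : 0 < S + 1 by rewrite ltr_wpDl.
have XsE y : X (x + y) -> aff_dir X y.
  by move=> /(X_subr Xx); rewrite addrAC subrr add0r.
pose b := \sum_i m *: (p i + q i).
have XeE : aff_dir X b.
  rewrite /b; elim/big_rec: _ => [|i y _ hy]; first by apply/aff_dirP; rewrite mul0mx.
  by apply: aff_dirD => //; apply: aff_dirZ; apply: aff_dirD; apply: XsE.
exists b, (m / (S + 1)); split=> //; first by rewrite divr_gt0.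
move=> d t dE hd t0 t1; apply: convex_scale => //.
have dS i : `|d 0 i / et i| <= m.
  rewrite normrM (gtr0_norm (_ : 0 < (et i)^-1)) ?invr_gt0 //.
  apply: le_trans (_ : m / (S + 1) * (S + 1) <= _); last by rewrite divfK // gt_eqF.
  rewrite ler_pM ?invr_ge0 ?(ltW (et0 i)) //.
    exact: le_trans (coord_le_l2 _ _) hd.
  rewrite /S (bigD1 i) //= -addrA lerDl addr_ge0 //; apply: sumr_ge0 => j _.
  by rewrite invr_ge0 ltW.
have bnd (s : 'I_n -> R) : (forall i, `|s i| <= m) -> \sum_i (2 * m + 2 * s i) <= 1.
  move=> hs; apply: (@le_trans _ _ (\sum_(i < n) 4 * m)).
    by apply: ler_sum => i _; have := hs i; rewrite ler_norml => /andP[_]; lra.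
  rewrite sumr_const card_ord.
  have -> : (4 * m) *+ n = (4 * n)%:R * m by rewrite -mulr_natl natrM; ring.
  rewrite /m ler_pdivrMr ?ltr0Sn //.
  by rewrite mul1r ler_nat leqnSn.
have -> : b + d = 2^-1 *: (\sum_(i : 'I_n) (2 * m + 2 * (d 0 i / et i)) *: p i)
    + 2^-1 *: (\sum_(i : 'I_n) (2 * m + 2 * - (d 0 i / et i)) *: q i).
  have {1}-> : d = \sum_i (d 0 i / et i) *: (p i - q i).
    rewrite -{1}((aff_dirP _).1 dE) mulmx_sum_row; apply: eq_bigr => i _.
    by rewrite -hr scalerA divfK // gt_eqF.
  rewrite /b !scaler_sumr -!big_split; apply: eq_bigr => i _ /=.
  by apply/rowP => j; rewrite !mxE; field; rewrite gt_eqF.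
apply: convex_add => //; last by lra.
  apply: convex_sum => // [i|]; last exact: bnd.
  by have := dS i; rewrite ler_norml => /andP[]; lra.
apply: convex_sum => // [i|]; last by apply: bnd => i; rewrite normrN.
by have := dS i; rewrite ler_norml => /andP[]; lra.
Qed.

End AffineHull.

(** * First-order expansions along a direction *)

Section FirstOrderExpansions.
Variables (R : realType) (n : nat).
Implicit Types (e dl t eta : R) (x y z d h : 'rV[R]_n).

Lemma diff_l2 (W : normedModType (R : numFieldType)) (F : 'rV[R]_n -> W) x : differentiable F x ->
  forall e, 0 < e -> exists2 dl, 0 < dl & forall h, l2norm h < dl ->
    `|F (x + h) - F x - 'D_h F x| <= e * l2norm h.
Proof.
move=> dF0; move: (dF0) => /diff_locally /eqaddoP dF e e0; have [dl dl0 h] := nbhs_l2 (dF e e0).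
exists dl => // v hv; rewrite deriveE //; have := h v; rewrite subr0 => /(_ hv).
rewrite !fctE /= [v + x]addrC opprD addrA => h1.
by apply: le_trans h1 _; rewrite ler_pM2l // norm_le_l2.
Qed.

Lemma diff_bounded (W : normedModType (R : numFieldType)) (F : 'rV[R]_n -> W) x : differentiable F x ->
  exists2 C, 0 < C & forall h, `|'D_h F x| <= C * l2norm h.
Proof.
move=> dF; move: (dF) => /diff_continuous /linear_lipschitz [C C0 hC]; exists C => // h; rewrite deriveE //.
by apply: le_trans (hC h) _; rewrite ler_pM2l // norm_le_l2.
Qed.

(** Differentiability used along curves that are only asymptotically tangent
to d: the expansion in t tolerates an o(t) deviation of the point. *)
Lemma diff_along (W : normedModType (R : numFieldType)) (F : 'rV[R]_n -> W) x d :
  differentiable F x -> forall e, 0 < e -> exists eta dl, [/\ 0 < eta, 0 < dl &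
    forall t y, 0 < t -> t < dl -> l2norm (y - x - t *: d) <= eta * t ->
      `|F y - F x - t *: 'D_d F x| <= e * t].
Proof.
move=> dF e e0; have [C C0 hC] := diff_bounded dF.
have D0 : 0 < l2norm d + 1 by rewrite ltr_wpDl ?l2_ge0.
have [dl dl0 hdl] := diff_l2 dF (divr_gt0 (divr_gt0 e0 (ltr0Sn _ 1)) D0).
exists (Num.min 1 (e / 2 / C)), (dl / (l2norm d + 1)); split.
- by rewrite lt_min ltr01 !divr_gt0.
- by rewrite divr_gt0.
move=> t y t0; rewrite ltr_pdivlMr // => tdl hy.
have hy1 : l2norm (y - x - t *: d) <= t.
  by apply: le_trans hy _; rewrite ger_pMl // ge_min lexx.
have hy2 : C * l2norm (y - x - t *: d) <= e / 2 * t.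
  apply: (@le_trans _ _ (C * (e / 2 / C * t))); last first.
    by rewrite mulrA mulrCA mulfV ?gt_eqF // mulr1.
  rewrite ler_pM2l //; apply: le_trans hy _.
  by rewrite ler_wpM2r ?ge_min ?lexx ?orbT // ltW.
have hyx : l2norm (y - x) <= t * (l2norm d + 1).
  have -> : y - x = (y - x - t *: d) + t *: d by rewrite subrK.
  apply: le_trans (l2D _ _) _; rewrite l2Z gtr0_norm //; lra.
have := hdl (y - x) (le_lt_trans hyx tdl).
rewrite [x + (y - x)]addrC subrK => h1.
have -> : F y - F x - t *: 'D_d F x =
    (F y - F x - 'D_(y - x) F x) + 'D_(y - x - t *: d) F x.
  have -> : 'D_(y - x - t *: d) F x = 'D_(y - x) F x - t *: 'D_d F x.
    by rewrite !deriveE // linearB linearZ.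
  by rewrite addrA subrK.
apply: le_trans (ler_normD _ _) _.
have h2 : `|F y - F x - 'D_(y - x) F x| <= e / 2 * t.
  apply: le_trans h1 _.
  apply: (@le_trans _ _ (e / 2 / (l2norm d + 1) * (t * (l2norm d + 1)))).
    by rewrite ler_wpM2l // !divr_ge0 ?ltW.
  by rewrite [t * _]mulrC mulrA divfK // gt_eqF.
have := hC (y - x - t *: d); lra.
Qed.

Lemma diff_eq0_along (W : normedModType (R : numFieldType)) (F : 'rV[R]_n -> W) x d :
  differentiable F x ->
  (forall e dl, 0 < e -> 0 < dl -> exists t y,
     [/\ 0 < t, t < dl, l2norm (y - x - t *: d) <= e * t & F y = F x]) ->
  'D_d F x = 0.
Proof.
move=> dF hF; apply/eqP; rewrite -normr_le0.
apply: (@le_mul_eps _ 1 _ 0) => // e e0; rewrite add0r mul1r.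
have [eta [dl [eta0 dl0 h]]] := diff_along d dF e0.
have [t [y [t0 tdl hy Fy]]] := hF eta dl eta0 dl0.
have := h t y t0 tdl hy; rewrite Fy subrr sub0r normrN normrZ gtr0_norm //.
by rewrite mulrC ler_pM2r.
Qed.

End FirstOrderExpansions.

(** * The tangent cone of the feasible set *)

Section TangentCone.
Variables (R : realType) (n : nat) (X : set 'rV[R]_n) (x : 'rV[R]_n).
Implicit Types (e dl t : R) (y z d w : 'rV[R]_n).

Hypothesis X_convex : convex_set (X : set (convex_lmodType 'rV[R]_n)).
Hypothesis Xx : X x.

(** Convexity shrinks a good approximation at one scale to all smaller ones, so
that the lower limit defining the tangent cone is a limit. *)
Lemma tangent_inner d : tangent_cone X x d -> forall e, 0 < e ->
  exists2 dl, 0 < dl & forall t, 0 < t -> t < dl ->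
    exists2 y, X y & l2norm (y - x - t *: d) <= e * t.
Proof.
move=> /tangentP -/(_ Xx) h e e0; have [s [y [s0 _ Xy hy]]] := h e 1 e0 ltr01.
exists s => // t t0 ts; exists (x + (t / s) *: (y - x)).
  apply: convex_comb => //; first by rewrite divr_ge0 // ltW.
  by rewrite ler_pdivrMr // mul1r ltW.
have -> : x + (t / s) *: (y - x) - x - t *: d = (t / s) *: (y - x - s *: d).
  by apply/rowP => i; rewrite !mxE; field; rewrite gt_eqF.
rewrite l2Z ger0_norm; last by rewrite divr_ge0 // ltW.
apply: (@le_trans _ _ (t / s * (e * s))).
  by rewrite ler_wpM2l // divr_ge0 // ltW.
by rewrite mulrCA divfK // gt_eqF.
Qed.

Lemma tangentZ (a : R) d : 0 <= a -> tangent_cone X x d -> tangent_cone X x (a *: d).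
Proof.
move=> a0 hd; apply/tangentP => // e dl e0 dl0.
have a1 : 0 < a + 1 by rewrite ltr_wpDl.
have [dl1 dl10 h] := tangent_inner hd (divr_gt0 e0 a1).
move: a0; rewrite le_eqVlt => /orP[/eqP <-|a0].
  exists (dl / 2), x; split=> //; first by rewrite divr_gt0.
    by lra.
  by rewrite scale0r scaler0 subrr subr0 l2_0 mulr_ge0 // ltW // divr_gt0.
pose s := Num.min dl (dl1 / a) / 2.
have m0 : 0 < Num.min dl (dl1 / a) by rewrite lt_min dl0 divr_gt0.
have s0 : 0 < s by rewrite divr_gt0.
have : s < Num.min dl (dl1 / a) by rewrite /s; lra.
rewrite lt_min => /andP[sdl]; rewrite ltr_pdivlMr // mulrC => sdl1.
have [y Xy hy] := h (a * s) (mulr_gt0 a0 s0) sdl1.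
exists s, y; split=> //; rewrite scalerA mulrC; apply: le_trans hy _.
by rewrite mulrA ler_pM2r // mulrAC ler_pdivrMr // ler_pM2l // lerDl.
Qed.

Lemma tangentD d w :
  tangent_cone X x d -> tangent_cone X x w -> tangent_cone X x (d + w).
Proof.
move=> hd hw; apply/tangentP => // e dl e0 dl0.
have [d1 d10 h1] := tangent_inner hd (divr_gt0 e0 (ltr0Sn _ 1)).
have [d2 d20 h2] := tangent_inner hw (divr_gt0 e0 (ltr0Sn _ 1)).
pose m := Num.min dl (Num.min d1 d2).
have m0 : 0 < m by rewrite !lt_min dl0 d10.
have : m / 2 < m by lra.
have m2 : 0 < m / 2 by rewrite divr_gt0.
rewrite {2}/m !lt_min => /and3P[hdl hd1 hd2].
have [y1 Xy1 hy1] := h1 _ m2 hd1; have [y2 Xy2 hy2] := h2 _ m2 hd2.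
exists (m / 2 / 2), (y1 + 2^-1 *: (y2 - y1)); split; first by rewrite divr_gt0.
- by apply: le_lt_trans hdl; rewrite ler_pdivrMr // ler_pMr // ler1n.
- by apply: convex_comb => //; lra.
have -> : y1 + 2^-1 *: (y2 - y1) - x - (m / 2 / 2) *: (d + w) =
    2^-1 *: (y1 - x - (m / 2) *: d) + 2^-1 *: (y2 - x - (m / 2) *: w).
  by apply/rowP => i; rewrite !mxE; field.
by apply: le_trans (l2D _ _) _; rewrite !l2Z ger0_norm //; lra.
Qed.

Lemma tangent_feasible d : X (x + d) -> tangent_cone X x d.
Proof.
move=> Xd; apply/tangentP => // e dl e0 dl0; pose m := Num.min dl 1.
have m0 : 0 < m by rewrite lt_min dl0 ltr01.
have : m / 2 < m by lra.
rewrite {2}/m lt_min => /andP[hdl h1].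
exists (m / 2), (x + (m / 2) *: d); split=> //; first by rewrite divr_gt0.
  by apply: convex_scale => //; rewrite ?ltW // divr_gt0.
by rewrite [x + _]addrC addrK subrr l2_0 mulr_ge0 // ltW // divr_gt0.
Qed.

Variable P : 'M[R]_n.
Hypothesis P_proj : is_orthoproj (aff_dir X) P.
Variables (p : nat) (c : 'rV[R]_n -> 'rV[R]_p).
Hypothesis c_diff : differentiable c x.
Hypothesis cx : c x = 0.
Let J := jacobian c x.

(** The rank conditions enter through [lineality_onto], which compares the two
constant ranks at x; the error bound is the metric regularity of c at x relative
to the affine hull. *)
Hypothesis lineality_onto : forall d, aff_dir X d -> exists l,
  [/\ tangent_cone X x l, tangent_cone X x (- l) & l *m J = d *m J].
Variables (K0 dl0 : R).
Hypothesis (K0_ge0 : 0 <= K0) (dl0_gt0 : 0 < dl0).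
Hypothesis error_bound : forall y e, X y -> l2norm (y - x) <= dl0 -> 0 < e ->
  exists m, [/\ aff_dir X (m - x), c m = 0 & l2norm (m - y) <= K0 * l2norm (c y) + e].

(** A small multiple of a relatively interior
direction, corrected by an element of the lineality space to stay in the
kernel, pushes the ray inside X with a margin proportional to t; the zero of c
provided by the error bound is o(t) away, hence still in X. *)
Lemma tangent_feasible_set d : tangent_cone X x d -> d *m J = 0 ->
  forall e, 0 < e -> exists2 dl, 0 < dl & forall t, 0 < t -> t < dl ->
    exists k, [/\ X k, c k = 0 & l2norm (k - x - t *: d) <= e * t].
Proof.
move=> hd dJ e e0; have [b [eta [bE eta0 hb]]] := relint_direction P_proj X_convex Xx.
have [l [Tl TNl lJ]] := lineality_onto bE.
have lE := tangent_aff_dir P_proj Xx Tl; have dE := tangent_aff_dir P_proj Xx hd.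
(* s (b - l) is the inward correction: b moves into the relative interior, and
   subtracting l restores the kernel of J; s makes it smaller than e. *)
pose s := e / (l2norm (b - l) + eta).
have bl0 : 0 < l2norm (b - l) + eta by rewrite ltr_wpDl // l2_ge0.
have s0 : 0 < s by rewrite divr_gt0.
pose w := d + s *: - l.
have wT : tangent_cone X x w := tangentD hd (tangentZ (ltW s0) TNl).
have wE := tangent_aff_dir P_proj Xx wT.
have m0 : 0 < s * eta / 2 by rewrite divr_gt0 // mulr_gt0.
have [dl1 dl10 hw] := tangent_inner wT m0.
pose u := d + s *: (b - l).
have uJ : u *m J = 0 by rewrite mulmxDl dJ -scalemxAl mulmxBl lJ subrr scaler0 addr0.
(* The midpoint of y, which approximates w at scale 2 t, and of a feasible
     point along b that absorbs both v and the error of y. *)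
have inX t v : 0 < t -> 2 * t < dl1 -> 2 * t * s <= 1 -> aff_dir X v ->
    l2norm v <= s * eta / 2 -> X (x + t *: (u + v)).
  move=> t0 tdl ts vE hv.
  have t20 : 0 < 2 * t by rewrite mulr_gt0.
  have [y Xy hy] := hw _ t20 tdl.
  pose r := (2 * t)^-1 *: (y - x) - w.
  have rE : aff_dir X r.
    by apply: (aff_dirB P_proj) => //; apply: (aff_dirZ P_proj); exact: X_subr.
  have yr : y = x + (2 * t) *: (w + r).
    by rewrite /r addrCA subrr addr0 scalerA mulfV ?gt_eqF // scale1r addrC subrK.
  have hr : l2norm r <= s * eta / 2.
    rewrite -(ler_pM2l t20) -[X in X * l2norm r](gtr0_norm t20) -l2Z [leRHS]mulrC.
    by rewrite scalerBr scalerA mulfV ?gt_eqF // scale1r.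
  have vrE : aff_dir X (s^-1 *: (v - r)).
    by apply: (aff_dirZ P_proj); exact: (aff_dirB P_proj).
  have vr : l2norm (s^-1 *: (v - r)) <= eta.
    rewrite l2Z gtr0_norm ?invr_gt0 // mulrC ler_pdivrMr // mulrC.
    by apply: le_trans (l2BD _ _) _; lra.
  have := hb _ (2 * t * s) vrE vr (ltW (mulr_gt0 t20 s0)) ts.
  rewrite scalerDr scalerA mulfK ?gt_eqF // => Xq.
  have := @convex_add _ _ _ X_convex x (y - x) _ 2^-1 2^-1 Xx _ Xq.
  rewrite [x + (y - x)]addrC subrK => /(_ Xy); have h2 : 0 <= 2^-1 :> R by [].
  move=> /(_ h2 h2) h; have {}h := h ltac:(lra).
  by congr (X _): h; rewrite yr /u /w; apply/rowP => i; rewrite !mxE; field; rewrite gt_eqF.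
pose e' := s * eta / 2 / (K0 * p%:R + 1).
have Kp : 0 < K0 * p%:R + 1 by rewrite ltr_wpDl // mulr_ge0.
have e'0 : 0 < e' by rewrite divr_gt0.
have [eta2 [dl2 [eta20 dl20 hc]]] := diff_along u c_diff e'0.
have u1 : 0 < l2norm u + 1 by rewrite ltr_wpDl ?l2_ge0.
exists (Num.min (Num.min dl1 s^-1 / 2) (Num.min dl2 (dl0 / (l2norm u + 1)))).
  by rewrite !lt_min dl20 !divr_gt0 // lt_min dl10 invr_gt0.
move=> t t0; rewrite !lt_min => /and3P[].
rewrite ltr_pdivlMr // mulrC lt_min => /andP[tdl1 ts].
move=> tdl2; rewrite ltr_pdivlMr // => tdl0.
have ts1 : 2 * t * s <= 1 by rewrite -ler_pdivlMr // mul1r ltW.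
have E0 : aff_dir X 0 by apply/(aff_dirP P_proj); rewrite mul0mx.
have Xy : X (x + t *: u).
  by rewrite -[u]addr0; apply: inX => //; rewrite l2_0 ltW.
have cy : l2norm (c (x + t *: u)) <= p%:R * e' * t.
  apply: le_trans (l2_le_norm _) _; rewrite -mulrA ler_wpM2l //.
  have := hc t (x + t *: u) t0 tdl2.
  rewrite [x + _]addrC addrK subrr l2_0 cx subr0 deriveEjacobian // uJ.
  by rewrite scaler0 subr0; apply; rewrite mulr_ge0 ?ltW.
have yx : l2norm (x + t *: u - x) <= dl0.
  rewrite [x + _]addrC addrK l2Z gtr0_norm //; apply: le_trans (ltW tdl0).
  by rewrite ler_pM2l // lerDl.
have [m [mE cm hm]] := error_bound Xy yx (mulr_gt0 e'0 t0).
have {}hm : l2norm (m - (x + t *: u)) <= s * eta / 2 * t.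
  apply: le_trans hm _; apply: (@le_trans _ _ (K0 * (p%:R * e' * t) + e' * t)).
    by rewrite lerD2r ler_wpM2l.
  have -> : K0 * (p%:R * e' * t) + e' * t = e' * (K0 * p%:R + 1) * t by ring.
  by rewrite /e' divfK // gt_eqF.
have uE : aff_dir X u.
  by apply: (aff_dirD P_proj) => //; apply: (aff_dirZ P_proj); exact: (aff_dirB P_proj).
exists m; split=> //.
  have -> : m = x + t *: (u + t^-1 *: (m - (x + t *: u))).
    rewrite scalerDr scalerA mulfV ?gt_eqF // scale1r.
    by apply/rowP => i; rewrite !mxE; ring.
  apply: inX => //.
    apply: (aff_dirZ P_proj); rewrite opprD addrA; apply: (aff_dirB P_proj) => //.
    exact: (aff_dirZ P_proj).
  by rewrite l2Z gtr0_norm ?invr_gt0 // mulrC ler_pdivrMr.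
have -> : m - x - t *: d = m - (x + t *: u) + (t * s) *: (b - l).
  by apply/rowP => i; rewrite /u !mxE; ring.
apply: le_trans (l2D _ _) _; rewrite l2Z (gtr0_norm (mulr_gt0 t0 s0)).
have -> : e = s * (l2norm (b - l) + eta) by rewrite /s divfK // gt_eqF.
have : 0 <= s * eta * t by apply: mulr_ge0; [apply: mulr_ge0|]; exact: ltW.
by move: hm; lra.
Qed.

(** A relatively interior direction absorbs any small element of the kernel of J,
so tangent directions in the kernel span it, and a linear map fixing them fixes
all of the kernel. *)
Lemma kernel_span d : aff_dir X d -> d *m J = 0 -> exists w1 w2 (a : R),
  [/\ tangent_cone X x w1, w1 *m J = 0, tangent_cone X x w2, w2 *m J = 0
    & d = a *: (w1 - w2)].
Proof.
move=> dE dJ; have [b [eta [bE eta0 hb]]] := relint_direction P_proj X_convex Xx.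
have [l [Tl TNl lJ]] := lineality_onto bE.
have D1 : 0 < l2norm d + 1 by rewrite ltr_wpDl ?l2_ge0.
pose s := eta / (l2norm d + 1); have s0 : 0 < s by rewrite divr_gt0.
have Tb v : aff_dir X v -> l2norm v <= eta -> tangent_cone X x (b + v).
  move=> vE hv; apply: tangent_feasible.
  by have := hb v 1 vE hv ler01 (lexx _); rewrite scale1r.
exists (b + s *: d - l), (b + 0 - l), s^-1; split.
- apply: (tangentD _ TNl); apply: Tb; first exact: (aff_dirZ P_proj).
  rewrite l2Z gtr0_norm // /s mulrAC ler_pdivrMr // ler_pM2l //.
  by rewrite lerDl.
- by rewrite mulmxBl mulmxDl -scalemxAl dJ scaler0 addr0 lJ subrr.
- apply: (tangentD _ TNl); apply: Tb; last by rewrite l2_0 ltW.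
  by apply/(aff_dirP P_proj); rewrite mul0mx.
- by rewrite mulmxBl addr0 lJ subrr.
- have -> : b + s *: d - l - (b + 0 - l) = s *: d by apply/rowP => i; rewrite !mxE; ring.
  by rewrite scalerA mulVf ?gt_eqF // scale1r.
Qed.

End TangentCone.

(** * Transport of second-order tangents between directions *)

Section SecondOrderTransport.
Variables (R : realType) (n : nat) (X K : set 'rV[R]_n) (x G : 'rV[R]_n).
Variable JA : 'rV[R]_n -> 'M[R]_n.
Implicit Types (e dl t eps : R) (y z d w u v : 'rV[R]_n).

Hypothesis X_closed : closed X.
Hypothesis X_convex : convex_set (X : set (convex_lmodType 'rV[R]_n)).
Hypothesis Xx : X x.
Hypothesis Kx : K x.
Hypothesis GN : normal_cone X x G.
Hypothesis JA_diff : differentiable JA x.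
Let B d := 'D_d JA x.

Variables (LR om : R).
Hypothesis (LR_ge0 : 0 <= LR) (om_gt0 : 0 < om).
(** The dissolving condition on normals; its residual is locally Lipschitz and
vanishes on K, hence the distance to k. *)
Hypothesis normal_fixed : forall y v u k, X y -> l2norm (y - x) <= om ->
  normal_cone X y v -> K k -> l2norm (k - x) <= om ->
  `|dot (u *m JA y) v - dot u v| <= LR * l2norm (y - k) * (l2norm u * l2norm v).

Variables d1 d2 : 'rV[R]_n.
Hypothesis d1_fixed : d1 *m JA x = d1.
Hypothesis d2_killed : d2 *m JA x = 0.
Hypothesis G_d1 : dot G d1 = 0.
Hypothesis d1_tangent : forall e, 0 < e -> exists2 dl, 0 < dl &
  forall t, 0 < t -> t < dl -> exists2 k, K k & l2norm (k - x - t *: d1) <= e * t.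

(** A direction killed by JA x is nearly orthogonal to the normals at nearby
points: dot d2 v is close to dot (d2 JA(y)) v, and JA(y) is close to JA x. *)
Lemma normal_d2_small : exists C dl, [/\ 0 <= C, 0 < dl & forall y v, X y ->
  l2norm (y - x) < dl -> normal_cone X y v ->
  `|dot d2 v| <= C * l2norm (y - x) * l2norm v].
Proof.
have [C C0 hC] := diff_bounded JA_diff.
have [dl dl0 hdl] := diff_l2 JA_diff ltr01.
pose C2 := (n%:R * n%:R * (1 + C) + LR) * l2norm d2.
exists C2, (Num.min dl om); split; [|by rewrite lt_min dl0|].
  by rewrite mulr_ge0 ?l2_ge0 ?addr_ge0 // !mulr_ge0 ?addr_ge0 // ltW.
move=> y v Xy; rewrite lt_min => /andP[ydl yom] vN.
have J1 : `|JA y - JA x| <= (1 + C) * l2norm (y - x).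
  have := hdl _ ydl; rewrite [x + _]addrC subrK mul1r => h1.
  have -> : JA y - JA x = (JA y - JA x - 'D_(y - x) JA x) + 'D_(y - x) JA x by rewrite subrK.
  by apply: le_trans (ler_normD _ _) _; have := hC (y - x); lra.
have J2 : l2norm (d2 *m JA y) <= n%:R * n%:R * ((1 + C) * l2norm (y - x)) * l2norm d2.
  rewrite -[_ *m _]subr0 -d2_killed -mulmxBr; apply: le_trans (l2_mulmx _ _) _.
  by rewrite ler_wpM2r ?l2_ge0 // ler_wpM2l // mulr_ge0.
have J3 : `|dot (d2 *m JA y) v| <=
    n%:R * n%:R * ((1 + C) * l2norm (y - x)) * l2norm d2 * l2norm v.
  by apply: le_trans (cauchy_schwarz _ _) _; rewrite ler_wpM2r ?l2_ge0.
have xx : l2norm (x - x) <= om by rewrite subrr l2_0 ltW.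
have J4 := normal_fixed d2 Xy (ltW yom) vN Kx xx.
have -> : dot d2 v = dot (d2 *m JA y) v - (dot (d2 *m JA y) v - dot d2 v) by ring.
apply: le_trans (ler_normB _ _) _; rewrite /C2.
by move: J3 J4; lra.
Qed.

(** Points of X next to the ray of direction d1, carrying normals close to G,
against which the second-order perturbation z of the ray of direction d1 + d2
can be tested.  They are the projections of x + t d1 + s G with s = kappa t^2:
the factor kappa balances the distance to the ray, which must be O(t^2),
against the deviation of the normal from G, which must be small. *)
Lemma nearby_normals z : tangent2 X x (d1 + d2) z -> forall eps, 0 < eps -> eps <= 1 ->
  exists2 C, 0 <= C & forall dl, 0 < dl -> exists t y v yh,
    [/\ 0 < t, t < dl & l2norm (yh - x - t *: (d1 + d2) - (2^-1 * t ^+ 2) *: z)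
                         <= eps * (2^-1 * t ^+ 2)] /\
    [/\ X y, X yh, normal_cone X y v, l2norm (v - G) <= eps &
     l2norm (y - x - t *: d1) <= C * t ^+ 2 /\ dot (v - G) (y - x - t *: d1) <= 0].
Proof.
move=> /tangent2P -/(_ Xx) hz eps eps0 eps1.
have [C2 [dl2 [C20 dl20 hC2]]] := normal_d2_small.
pose C1 := 2 * (l2norm d1 + l2norm G).
have C10 : 0 <= C1 by rewrite mulr_ge0 // addr_ge0 ?l2_ge0.
pose C3 := C2 * C1 + 2^-1 * (l2norm z + 1).
have C30 : 0 <= C3 by rewrite addr_ge0 ?mulr_ge0 ?addr_ge0 ?l2_ge0.
pose kap := C3 * (l2norm G + 1) / eps ^+ 2 + 1.
have kap0 : 0 < kap.
  apply: ltr_wpDl => //; apply: divr_ge0; last by apply: exprn_ge0; exact: ltW.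
  by apply: mulr_ge0 => //; rewrite addr_ge0 ?l2_ge0.
exists (kap * eps); first by rewrite mulr_ge0 // ltW.
move=> dl dl0; have C11 : 0 < C1 + 1 by rewrite ltr_wpDl.
have dlm0 : 0 < Num.min dl (Num.min kap^-1 (dl2 / (C1 + 1))).
  by rewrite !lt_min dl0 invr_gt0 kap0 divr_gt0.
have [t [yh [t0 + Xyh hyh]]] := hz eps _ eps0 dlm0.
rewrite !lt_min => /and3P[tdl tk]; rewrite ltr_pdivlMr // => tdl2.
have X0 : X !=set0 by exists x.
pose s := kap * t ^+ 2; have t20 : 0 < t ^+ 2 by rewrite exprn_gt0.
have s0 : 0 < s by rewrite mulr_gt0.
have st : s <= t.
  rewrite /s expr2 mulrA -[leRHS]mul1r ler_pM2r // -[leRHS](mulfV (lt0r_neq0 kap0)).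
  by rewrite ler_pM2l // ltW.
(* v below is the residual of the projection divided by s: a normal at y. *)
have [y [Xy yN ymin]] := projection X_closed X_convex (x + t *: d1 + s *: G) X0.
pose g := x + t *: d1 - y; pose v := G + s^-1 *: g.
have vE : s *: v = x + t *: d1 + s *: G - y.
  by rewrite scalerDr scalerA mulfV ?gt_eqF // scale1r /g; apply/rowP => i; rewrite !mxE; ring.
have vN : normal_cone X y v.
  move=> w Xw; have := yN w Xw; rewrite -vE dotZl.
  by rewrite pmulr_rle0.
have yx : l2norm (y - x) <= C1 * t.
  have -> : y - x = (t *: d1 + s *: G) - (x + t *: d1 + s *: G - y).
    by apply/rowP => i; rewrite !mxE; ring.
  apply: le_trans (l2BD _ _) _.
  have h1 := ymin x Xx; rewrite -[x + _ + _]addrA [X in _ <= l2norm X]addrAC subrr add0r in h1.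
  have h2 : l2norm (t *: d1 + s *: G) <= t * (l2norm d1 + l2norm G).
    apply: le_trans (l2D _ _) _; rewrite !l2Z !gtr0_norm // mulrDr lerD2l.
    by rewrite ler_wpM2r ?l2_ge0.
  by move: h1 h2; rewrite addrA /C1; lra.
have yx2 : l2norm (y - x) < dl2.
  apply: le_lt_trans yx (le_lt_trans _ tdl2).
  by rewrite mulrC ler_pM2l // lerDl.
have hd2 : `|dot d2 v| <= C2 * C1 * t * l2norm v.
  apply: le_trans (hC2 y v Xy yx2 vN) _.
  by rewrite ler_wpM2r ?l2_ge0 // -mulrA ler_wpM2l.
have vg : dot v g <= C3 * t ^+ 2 * l2norm v.
  pose r := yh - x - t *: (d1 + d2) - (2^-1 * t ^+ 2) *: z.
  have := vN yh Xyh.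
  have -> : yh - y = g + t *: d2 + (2^-1 * t ^+ 2) *: z + r.
    by rewrite /g /r; apply/rowP => i; rewrite !mxE; ring.
  rewrite 3!dotDr 2!dotZr => h1.
  have h2 : - dot v d2 <= C2 * C1 * t * l2norm v.
    by rewrite dotC; apply: le_trans hd2; rewrite -normrN ler_norm.
  have h3 : - dot v z <= l2norm v * l2norm z.
    by apply: le_trans (cauchy_schwarz v z); rewrite -normrN ler_norm.
  have h4 : - dot v r <= l2norm v * (2^-1 * t ^+ 2).
    rewrite -dotNr; apply: le_trans (dot_le _ _) _; rewrite l2N ler_wpM2l ?l2_ge0 //.
    by apply: le_trans hyh _; rewrite ler_piMl // mulr_ge0 // ltW.
  have h2' : - (t * dot v d2) <= t * (C2 * C1 * t * l2norm v) by rewrite -mulrN ler_pM2l.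
  have h3' : - (2^-1 * t ^+ 2 * dot v z) <= 2^-1 * t ^+ 2 * (l2norm v * l2norm z).
    by rewrite -mulrN ler_pM2l // mulr_gt0.
  by rewrite /C3; move: h1 h2' h3' h4; lra.
pose a := l2norm (v - G).
have aE : l2norm g = s * a.
  have -> : g = s *: (v - G) by rewrite /v addrC addKr scalerA mulfV ?gt_eqF // scale1r.
  by rewrite l2Z gtr0_norm.
have Gg : 0 <= dot G g.
  rewrite /g dotBr dotDr dotZr G_d1 mulr0 addr0 subr_ge0.
  by have := GN Xy; rewrite dotBr subr_le0.
(* Testing v against yh bounds dot v g above, while dot v g is at least
   s a^2; dividing by t^2 bounds kap a^2 independently of t. *)
have ka : kap * a ^+ 2 <= C3 * (l2norm G + a).
  have vG : l2norm v <= l2norm G + a.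
    by rewrite -{1}(subrK G v) addrC; exact: l2D.
  have : s * a ^+ 2 <= C3 * t ^+ 2 * l2norm v.
    apply: le_trans vg; rewrite /v dotDl dotZl -l2_sqr aE.
    have -> : s^-1 * (s * a) ^+ 2 = s * a ^+ 2 by field; rewrite gt_eqF.
    by rewrite lerDr.
  have -> : s * a ^+ 2 = t ^+ 2 * (kap * a ^+ 2) by rewrite /s; ring.
  have -> : C3 * t ^+ 2 * l2norm v = t ^+ 2 * (C3 * l2norm v) by ring.
  rewrite ler_pM2l //.
  by move=> h; apply: le_trans h _; rewrite ler_wpM2l.
have a0 : 0 <= a by exact: l2_ge0.
have ae : a <= eps.
  rewrite leNgt; apply/negP => ea.
  have G0 := l2_ge0 G.
  have e20 : 0 < eps ^+ 2 by rewrite exprn_gt0.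
  pose b := a / eps.
  have b1 : 1 < b by rewrite ltr_pdivlMr // mul1r.
  have ba : a <= b by rewrite ler_pdivlMr // ler_piMr.
  have aE2 : a ^+ 2 / eps ^+ 2 = b ^+ 2 by rewrite /b expr_div_n.
  have b2 : b <= b ^+ 2 by rewrite expr2 ler_peMl; [|lra|lra].
  have : C3 * (l2norm G + a) <= C3 * ((l2norm G + 1) * b ^+ 2).
    rewrite ler_wpM2l // mulrDl mul1r lerD //; last by lra.
    by rewrite ler_peMr //; lra.
  move: ka; rewrite /kap mulrDl mul1r mulrAC -mulrA aE2 -mulrA.
  have : 0 < a ^+ 2 by rewrite exprn_gt0 //; lra.
  lra.
have yg : y - x - t *: d1 = - g by rewrite /g; apply/rowP => i; rewrite !mxE; ring.
exists t, y, v, yh; split; split=> //.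
rewrite yg l2N aE; split.
  have -> : kap * eps * t ^+ 2 = s * eps by rewrite /s; ring.
  by rewrite ler_pM2l.
by rewrite dotNr /v addrC addKr dotZl oppr_le0 mulr_ge0 ?dot_ge0 // invr_ge0 ltW.
Qed.

(** First-order expansion of u |-> dot (u JA(y)) v - dot u v along the ray of
direction d1: it is o(t) since y is within o(t) of K, so its constant
term cancels t dot (u B d1) v up to o(t). *)
Lemma normal_first_order u eps C : 0 < eps -> 0 <= C -> exists2 dl, 0 < dl &
  forall t y v, 0 < t -> t < dl -> X y -> normal_cone X y v ->
    l2norm v <= l2norm G + 1 -> l2norm (y - x - t *: d1) <= C * t ^+ 2 ->
    `|dot (u *m JA x) v - dot u v + t * dot (u *m B d1) v| <= eps * t.
Proof.
move=> eps0 C0; pose V := l2norm G + 1.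
have V0 : 0 < V by rewrite ltr_wpDl ?l2_ge0.
pose U := l2norm u + 1; have U0 : 0 < U by rewrite ltr_wpDl ?l2_ge0.
pose N : R := n%:R * n%:R + 1; have N0 : 0 < N by rewrite ltr_wpDl // mulr_ge0.
pose L := LR + 1; have L0 : 0 < L by rewrite ltr_wpDl.
have D0 : 0 < l2norm d1 + 1 by rewrite ltr_wpDl ?l2_ge0.
pose eta := eps / 4 / (L * U * V).
have LUV : 0 < L * U * V by rewrite !mulr_gt0.
have eta0 : 0 < eta by rewrite /eta; apply: divr_gt0 => //; exact: divr_gt0.
have NUV : 0 < N * U * V by rewrite !mulr_gt0.
have et20 : 0 < eps / 2 / (N * U * V) by apply: divr_gt0 => //; exact: divr_gt0.
have [et3 [dl3 [et30 dl30 hJ]]] := diff_along d1 JA_diff et20.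
have m10 : 0 < Num.min eta 1 by rewrite lt_min eta0 ltr01.
have [dl1 dl10 hk] := d1_tangent m10.
have C1 : 0 < C + 1 by rewrite ltr_wpDl.
pose m := Num.min (Num.min 1 (om / (l2norm d1 + 1))) (Num.min eta et3).
exists (Num.min (Num.min dl1 dl3) (m / (C + 1))).
  rewrite !lt_min dl10 dl30 /= divr_gt0 // !lt_min ltr01 eta0 et30 /= andbT.
  exact: divr_gt0.
move=> t y v t0; rewrite !lt_min => /andP[/andP[tdl1 tdl3]].
rewrite ltr_pdivlMr // !lt_min => /andP[/andP[t1 tom] /andP[teta tet3]].
move: tom; rewrite ltr_pdivlMr // => tom Xy vN vV hy.
have {tom}tom : t * (1 + C + l2norm d1) <= om.
  apply: le_trans (ltW tom); rewrite -mulrA ler_pM2l //.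
  have : 0 <= C * l2norm d1 by rewrite mulr_ge0 ?l2_ge0.
  lra.
have td1 := mulr_ge0 (ltW t0) (l2_ge0 d1).
have tC : C * t <= t * (C + 1) by rewrite mulrDr mulr1 [C * t]mulrC lerDl ltW.
have t1' : t < 1 by apply: le_lt_trans t1; rewrite mulrDr mulr1 lerDr mulr_ge0 // ltW.
have hyC b : t * (C + 1) < b -> l2norm (y - x - t *: d1) <= b * t.
  move=> hb; apply: le_trans hy _; rewrite expr2 mulrA ler_pM2r //.
  exact: le_trans tC (ltW hb).
have hyx : l2norm (y - x) <= om.
  have -> : y - x = (y - x - t *: d1) + t *: d1 by rewrite subrK.
  apply: le_trans (l2D _ _) _; rewrite l2Z gtr0_norm //.
  have : C * t ^+ 2 <= C * t by rewrite ler_wpM2l // expr2 ger_pMr // ltW.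
  by move: hy tom; lra.
have [k Kk hkx] := hk t t0 tdl1.
have hkx1 : l2norm (k - x - t *: d1) <= eta * t.
  by apply: le_trans hkx _; rewrite ler_wpM2r ?ge_min ?lexx // ltW.
have hkom : l2norm (k - x) <= om.
  have -> : k - x = (k - x - t *: d1) + t *: d1 by rewrite subrK.
  apply: le_trans (l2D _ _) _; rewrite l2Z gtr0_norm //.
  have : Num.min eta 1 * t <= t by rewrite ger_pMl // ge_min lexx orbT.
  have : 0 <= t * C by rewrite mulr_ge0 // ltW.
  by move: hkx tom; lra.
have hyk : l2norm (y - k) <= 2 * eta * t.
  have -> : y - k = (y - x - t *: d1) - (k - x - t *: d1).
    by apply/rowP => i; rewrite !mxE; ring.
  by apply: le_trans (l2BD _ _) _; have := hyC _ teta; move: hkx1; lra.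
have h1 : `|dot (u *m JA y) v - dot u v| <= eps / 2 * t.
  apply: le_trans (normal_fixed u Xy hyx vN Kk hkom) _.
  apply: (@le_trans _ _ (L * (2 * eta * t) * (U * V))).
    rewrite ler_pM ?mulr_ge0 ?l2_ge0 //.
      by rewrite ler_pM ?l2_ge0 // lerDl.
    by rewrite ler_pM ?l2_ge0 // lerDl.
  have -> : L * (2 * eta * t) * (U * V) = 2 * t * (eta * (L * U * V)) by ring.
  rewrite /eta divfK ?gt_eqF //; lra.
have h2 : `|dot (u *m (JA y - JA x - t *: B d1)) v| <= eps / 2 * t.
  apply: le_trans (cauchy_schwarz _ _) _.
  apply: (@le_trans _ _ (N * (eps / 2 / (N * U * V) * t) * U * V)).
    rewrite ler_pM ?l2_ge0 //; apply: le_trans (l2_mulmx _ _) _.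
    rewrite ler_pM ?l2_ge0 ?mulr_ge0 // ?lerDl // ler_pM ?mulr_ge0 ?lerDl //.
    by apply: hJ => //; exact: hyC.
  have -> : N * (eps / 2 / (N * U * V) * t) * U * V = eps / 2 / (N * U * V) * (N * U * V) * t by ring.
  by rewrite divfK ?gt_eqF.
have -> : dot (u *m JA x) v - dot u v + t * dot (u *m B d1) v =
  (dot (u *m JA y) v - dot u v) - dot (u *m (JA y - JA x - t *: B d1)) v.
  by rewrite !mulmxBr -scalemxAr !dotBl dotZl; ring.
by apply: le_trans (ler_normB _ _) _; lra.
Qed.

Lemma normals_bound v eps : l2norm (v - G) <= eps -> eps <= 1 -> l2norm v <= l2norm G + 1.
Proof.
move=> h e1; rewrite -(subrK G v) addrC; apply: le_trans (l2D _ _) _.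
by rewrite lerD2l (le_trans h).
Qed.

(** The expansion for u = d1 has no constant term because JA x fixes d1. *)
Lemma normal_curvature_d1 z : tangent2 X x (d1 + d2) z -> dot (d1 *m B d1) G = 0.
Proof.
move=> hz; apply/eqP; rewrite -normr_le0.
apply: (@le_mul_eps1 _ (1 + l2norm (d1 *m B d1)) _ 0); first by rewrite addr_ge0 ?l2_ge0.
move=> eps eps0 eps1; have [C C0 hC] := nearby_normals hz eps0 eps1.
have [dl dl0 hdl] := normal_first_order d1 eps0 C0.
have [t [y [v [yh [[t0 tdl _] [Xy _ vN vG [hy _]]]]]]] := hC dl dl0.
have := hdl t y v t0 tdl Xy vN (normals_bound vG eps1) hy.
rewrite d1_fixed subrr add0r normrM (gtr0_norm t0) mulrC ler_pM2r // => h1.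
have -> : dot (d1 *m B d1) G = dot (d1 *m B d1) v - dot (d1 *m B d1) (v - G).
  by rewrite dotBr; ring.
apply: le_trans (ler_normB _ _) _; rewrite add0r mulrDl mul1r lerD //.
by apply: le_trans (cauchy_schwarz _ _) _; rewrite ler_wpM2l ?l2_ge0.
Qed.

(** The candidates for z' are the rescaled second-order parts of the points y of
[nearby_normals], bounded by 2 C, and z' is a cluster point of them.  The normal v
at y separates y from the point yh that realizes z; in that inequality the
first-order part t dot d2 v, not small enough to be dropped, is replaced by
t^2 dot (d2 B d1) v through [normal_first_order]. *)
Lemma tangent2_transport z eps : tangent2 X x (d1 + d2) z -> 0 < eps ->
  exists2 z', tangent2 X x d1 z' &
    dot G z + 2 * dot (d2 *m B d1) G <= dot G z' + eps.
Proof.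
move=> hz eps0; pose b := l2norm (d2 *m B d1).
pose C1 := 4 + 2 * b + l2norm z + l2norm G.
have b0 : 0 <= b := l2_ge0 _.
have C10 : 0 < C1 by have := l2_ge0 z; have := l2_ge0 G; rewrite /C1; lra.
pose ep := Num.min 1 (eps / C1).
have ep0 : 0 < ep by rewrite lt_min ltr01 divr_gt0.
have ep1 : ep <= 1 by rewrite ge_min lexx.
have epC : ep * C1 <= eps by rewrite -ler_pdivlMr // ge_min lexx orbT.
have [C C0 hC] := nearby_normals hz ep0 ep1.
have [dl dl0 hdl] := normal_first_order d2 ep0 C0.
have step k : exists tz : R * 'rV[R]_n, exists y, [/\ 0 < tz.1, tz.1 < k.+1%:R^-1, X y &
    y - x - tz.1 *: d1 = (2^-1 * tz.1 ^+ 2) *: tz.2] /\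
    l2norm tz.2 <= 2 * C /\ dot G z + 2 * dot (d2 *m B d1) G <= dot G tz.2 + ep * C1.
  have m0 : 0 < Num.min dl k.+1%:R^-1 by rewrite lt_min dl0 invr_gt0 ltr0Sn.
  have [t [y [v [yh [[t0 + hyh] [Xy Xyh vN vG [hy vGy]]]]]]] := hC _ m0.
  rewrite lt_min => /andP[tdl tk].
  have t20 : 0 < 2^-1 * t ^+ 2 by rewrite mulr_gt0 ?invr_gt0 ?exprn_gt0.
  pose z' := (2^-1 * t ^+ 2)^-1 *: (y - x - t *: d1).
  have z'E : y - x - t *: d1 = (2^-1 * t ^+ 2) *: z'.
    by rewrite scalerA mulfV ?gt_eqF // scale1r.
  exists (t, z'), y; split; first by split.
  split=> /=.
    rewrite -(ler_pM2l t20) -[X in X * l2norm _](gtr0_norm t20) -l2Z -z'E.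
    by apply: le_trans hy _; lra.
  have h1 := hdl t y v t0 tdl Xy vN (normals_bound vG ep1) hy.
  rewrite d2_killed dot0l sub0r in h1.
  have vz' : dot v z' <= dot G z'.
    move: vGy; rewrite z'E dotZr pmulr_rle0 // dotBl; lra.
  pose r := yh - x - t *: (d1 + d2) - (2^-1 * t ^+ 2) *: z.
  have := vN yh Xyh.
  have -> : yh - y = t *: d2 + (2^-1 * t ^+ 2) *: z + r - (2^-1 * t ^+ 2) *: z'.
    by rewrite -z'E /r; apply/rowP => i; rewrite !mxE; ring.
  rewrite dotBr 2!dotDr 3!dotZr => h2.
  have h3 : - dot v r <= (l2norm G + 1) * (ep * (2^-1 * t ^+ 2)).
    rewrite -dotNr; apply: le_trans (dot_le _ _) _; rewrite l2N.
    by rewrite ler_pM ?l2_ge0 // (normals_bound vG).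
  have h4 : t * dot (d2 *m B d1) v - ep * t <= dot v d2.
    by move: h1; rewrite ler_norml (dotC v) => /andP[_]; lra.
  have h5 : dot G z - ep * l2norm z <= dot v z.
    have := dot_le (G - v) z; rewrite dotBl.
    have : l2norm (G - v) * l2norm z <= ep * l2norm z.
      by rewrite ler_wpM2r ?l2_ge0 // l2B.
    lra.
  have h6 : dot (d2 *m B d1) G - ep * b <= dot (d2 *m B d1) v.
    have := dot_le (d2 *m B d1) (G - v); rewrite dotBr -/b.
    have : b * l2norm (G - v) <= b * ep by rewrite ler_wpM2l // l2B.
    lra.
  have h7 : t * (t * (dot (d2 *m B d1) G - ep * b) - ep * t) <= t * dot v d2.
    rewrite ler_pM2l //; apply: le_trans h4; rewrite lerD2r.
    by rewrite ler_pM2l.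
  have h8 : 2^-1 * t ^+ 2 * (dot G z - ep * l2norm z) <= 2^-1 * t ^+ 2 * dot v z.
    by rewrite ler_pM2l.
  have h9 : 2^-1 * t ^+ 2 * dot v z' <= 2^-1 * t ^+ 2 * dot G z' by rewrite ler_pM2l.
  rewrite -(ler_pM2l t20) /C1; move: h2 h3 h7 h8 h9.
  have : 0 <= ep * t ^+ 2 by rewrite mulr_ge0 // ?exprn_ge0 // ltW.
  lra.
have /all_sig [tz htz] k := cid (step k).
have [|p hp] := @bounded_cluster _ _ (fun k => (tz k).2) (2 * C).
  by move=> k; case: (htz k) => y [_ []].
exists p.
  apply/tangent2P => // e dl' e0 dl'0; have [N hN] := small_inv dl'0.
  have [k Nk hk] := hp e N e0; have [y [[t0 tk Xy yE] _]] := htz k.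
  exists (tz k).1, y; split=> //; first exact: lt_trans tk (hN k Nk).
  have t20 : 0 < 2^-1 * (tz k).1 ^+ 2 by rewrite mulr_gt0 ?invr_gt0 ?exprn_gt0.
  rewrite yE -scalerBr l2Z gtr0_norm // mulrC ler_pM2r //; exact: ltW.
apply: (@le_mul_eps _ (l2norm G)) => [|e e0]; first exact: l2_ge0.
have [k _ hk] := hp e 0%N e0; have [y [_ [_ h]]] := htz k.
have h1 : dot G ((tz k).2 - p) <= l2norm G * e.
  by apply: le_trans (dot_le _ _) _; rewrite ler_wpM2l ?l2_ge0 // ltW.
by move: h h1 epC; rewrite dotBr; lra.
Qed.

End SecondOrderTransport.

(** * The r-th singular value of a matrix of rank r *)

Section SpectralGap.
Local Open Scope sesquilinear_scope.

Lemma mxrank_diag (F : fieldType) n (d : 'rV[F]_n) :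
  \rank (diag_mx d) = (\sum_(i < n) (d 0%R i != 0%R))%N.
Proof.
elim: n d => [|n IH] d; first by rewrite big_ord0 flatmx0 mxrank0.
pose l : 'rV[F]_1 := @lsubmx _ 1 1 n d; pose r : 'rV[F]_n := @rsubmx _ 1 1 n d.
have -> : diag_mx d = block_mx (diag_mx l) 0 0 (diag_mx r).
  by rewrite -diag_mx_row /l /r hsubmxK.
have -> : \rank (block_mx (diag_mx l) 0 0 (diag_mx r)) =
    (\rank (diag_mx l) + \rank (diag_mx r))%N by exact: rank_diag_block_mx.
rewrite IH big_ord_recl; congr (_ + _)%N.
  rewrite [diag_mx l]mx11_scalar mxE eqxx mulr1n rank_rV -scalemx1 scaler_eq0 oner_eq0 orbF.
  rewrite /l mxE; congr (nat_of_bool (d _ _ != 0)); exact/val_inj.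
apply: eq_bigr => i _; rewrite /r mxE; congr (nat_of_bool (d _ _ != 0)); exact/val_inj.
Qed.

Lemma char_poly_conj (F : fieldType) n (U A : 'M[F]_n) : U \in unitmx ->
  char_poly (invmx U *m A *m U) = char_poly A.
Proof.
move=> Uu; rewrite /char_poly /char_poly_mx !map_mxM.
have UU : map_mx polyC (invmx U) *m map_mx polyC U = 1%:M.
  by rewrite -map_mxM mulVmx // map_mx1.
have -> : 'X%:M - map_mx polyC (invmx U) *m map_mx polyC A *m map_mx polyC U =
  map_mx polyC (invmx U) *m ('X%:M - map_mx polyC A) *m map_mx polyC U.
  rewrite mulmxBr mulmxBl; congr (_ - _).
  by rewrite scalar_mxC -mulmxA UU mulmx1.
by rewrite !det_mulmx mulrAC -det_mulmx UU det1 mul1r.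
Qed.

(** A nonincreasing nonnegative list with exactly r nonzero terms starts with
them, so its r-th term is the least nonzero one. *)
Lemma sorted_threshold (R : realType) (s : seq R) r : (0 < r)%N ->
  sorted >=%R s -> (forall a, a \in s -> 0 <= a) ->
  count (fun a : R => a != 0%R) s = r ->
  0 < s`_r.-1 /\ forall a, a \in s -> a != 0 -> s`_r.-1 <= a.
Proof.
move=> r0 ss s0 cs; pose q := s`_r.-1.
have mono i j : (i <= j)%N -> (j < size s)%N -> s`_j <= s`_i.
  move=> ij js; apply: (@sorted_leq_nth _ (>=%R) ge_trans lexx) => //.
  exact: leq_ltn_trans js.
have rs : (r <= size s)%N by rewrite -cs count_size.
have q0 : 0 < q.
  rewrite lt_def s0 ?mem_nth ?prednK // andbT; apply/negP => /eqP q0.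
  have : (count (fun a : R => a != 0%R) s <= r.-1)%N.
    rewrite -(cat_take_drop r.-1 s) count_cat -[leqRHS]addn0 leq_add //.
      by apply: leq_trans (count_size _ _) _; rewrite size_take_min geq_minl.
    rewrite leqn0 -leqn0 leqNgt -has_count; apply/hasPn => a /(nthP 0)[i].
    rewrite size_drop => hi <-; rewrite nth_drop negbK eq_le s0 ?mem_nth -?ltn_subRL // andbT.
    by rewrite -[leRHS]q0; apply: mono; rewrite ?leq_addr // -ltn_subRL.
  by rewrite cs leqNgt prednK // leqnn.
split=> // a /(nthP 0)[i isz <-] a0.
have [ir|ri] := ltnP i r; first by apply: mono => //; rewrite -ltnS prednK.
rewrite leNgt; apply/negP => aq.
have : (r.+1 <= count (fun a : R => a != 0%R) s)%N.
  rewrite -(cat_take_drop r s) count_cat -addn1 leq_add //.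
    have -> : count (fun a : R => a != 0%R) (take r s) = size (take r s).
      apply/eqP; rewrite -all_count; apply/(all_nthP 0) => j.
      rewrite size_takel // => jr; rewrite nth_take //.
      by apply: lt0r_neq0; apply: lt_le_trans q0 _; apply: mono; rewrite -ltnS prednK.
    by rewrite size_takel.
  rewrite -has_count; apply/hasP; exists s`_i => //.
  by rewrite -(subnKC ri) -nth_drop mem_nth // size_drop ltn_sub2r // (leq_ltn_trans ri).
by rewrite cs ltnn.
Qed.

Import complex.
Local Open Scope complex_scope.
Variable R : realType.
Local Notation toC := (real_complex R).

Lemma mxrank_gram n p (B : 'M[R]_(n, p)) : \rank (B^T *m B) = \rank B.
Proof.
rewrite -(mxrank_tr B) -[RHS](mxrank_mul_ker B^T B) -[LHS]addn0; congr (_ + _)%N.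
apply/esym/eqP; rewrite mxrank_eq0; apply/rowV0P => v.
rewrite sub_capmx => /andP[/submxP[w ->] /sub_kermxP h].
by apply/eqP; rewrite -dot_eq0 dot_trmx trmx_mul trmxK mulmxA h mul0mx mxE.
Qed.

Section Gram.
Variables (n p : nat) (B : 'M[R]_(n, p)).
Let G := B^T *m B.
Let GC : 'M[R[i]]_p := map_mx toC G.
Let BC : 'M[R[i]]_(n, p) := map_mx toC B.

(** The spectral theorem is applied to the Gram matrix seen over the complex
numbers; its eigenvalues are real, and a i are their real parts. *)
Let BC_conj : BC^t* = BC^T.
Proof.
apply/matrixP => i j; rewrite !mxE; apply/conj_Creal/complex_realP.
by exists (B j i).
Qed.

Let GCE : GC = BC^t* *m BC.
Proof. by rewrite BC_conj /GC map_mxM map_trmx. Qed.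

Let GCt : GC^t* = GC.
Proof.
by rewrite {1}GCE trmx_mul map_mxM trmxCK -GCE.
Qed.

Let U := spectralmx GC.
Let d := spectral_diag GC.
Let a i : R := complex.Re (d 0 i).

Let GC_diag : GC = invmx U *m diag_mx d *m U.
Proof. by apply/orthomx_spectralP/normalmxP; rewrite GCt. Qed.

Let Uu : U \in unitmx. Proof. exact: spectral_unit. Qed.

Let invU : invmx U = U^t*. Proof. exact/invmx_unitary/spectral_unitarymx. Qed.

Let d_ge0 i : 0 <= d 0 i.
Proof.
have : diag_mx d = (U *m BC^t*) *m (U *m BC^t*)^t*.
  rewrite trmx_mul map_mxM trmxCK -invU mulmxA -(mulmxA U) -GCE [X in U *m X]GC_diag.
  by rewrite !mulmxA mulmxV // mul1mx mulmxK.
move=> /matrixP /(_ i i); rewrite !mxE eqxx mulr1n => ->.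
by apply: sumr_ge0 => k _; rewrite !mxE mul_conjC_ge0.
Qed.

Let dE i : d 0 i = toC (a i).
Proof. by rewrite /a RRe_real // ger0_real. Qed.

Let char_poly_G : char_poly G = \prod_i ('X - (a i)%:P).
Proof.
apply: (@map_poly_inj _ _ toC); rewrite map_char_poly -/GC GC_diag char_poly_conj //.
rewrite char_poly_trig ?diag_mx_is_trig // rmorph_prod; apply: eq_bigr => i _.
by rewrite mxE eqxx mulr1n dE rmorphB /= map_polyX map_polyC.
Qed.

Let y (w : 'rV[R]_p) := map_mx toC w *m invmx U.

Let quad (w : 'rV[R]_p) (e : 'rV[R[i]]_p) :
  (map_mx toC w *m (invmx U *m diag_mx e *m U) *m (map_mx toC w)^T) 0 0 =
  \sum_i e 0 i * `|y w 0 i| ^+ 2.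
Proof.
have wt : (map_mx toC w)^T = (map_mx toC w)^t*.
  apply/matrixP => i j; rewrite !mxE; apply/esym/conj_Creal/complex_realP.
  by exists (w j i).
have -> : map_mx toC w *m (invmx U *m diag_mx e *m U) *m (map_mx toC w)^T =
    y w *m diag_mx e *m (y w)^t*.
  have -> : (y w)^t* = U *m (map_mx toC w)^T.
    rewrite /y trmx_mul map_mxM -wt; congr (_ *m _).
    by rewrite invU trmxCK.
  by rewrite /y !mulmxA.
rewrite mxE; apply: eq_bigr => i _.
by rewrite mul_mx_diag !mxE normCK; ring.
Qed.

Lemma eigenseq_gram : perm_eq (eigenseq G) [seq a i | i <- enum 'I_p] /\
  sorted >=%R (eigenseq G).
Proof.
have bigE : \prod_(b <- [seq a i | i <- enum 'I_p]) ('X - b%:P) = \prod_i ('X - (a i)%:P).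
  by rewrite big_map big_enum.
have [ss hs] : sorted >=%R (eigenseq G) /\
    char_poly G = \prod_(b <- eigenseq G) ('X - b%:P).
  apply: (@xgetPex _ [::] [set s : seq R | sorted >=%R s /\
    char_poly G = \prod_(b <- s) ('X - b%:P)]).
  exists (sort >=%R [seq a i | i <- enum 'I_p]); split.
    by apply: sort_sorted => u v; exact: le_total.
  by rewrite char_poly_G -bigE; apply: perm_big; rewrite perm_sym perm_sort.
by split=> //; apply: prod_XsubC_eq; rewrite -hs char_poly_G bigE.
Qed.

(** In an orthonormal eigenbasis of the Gram matrix the squares of the two sides
compare termwise, each eigenvalue being either zero or at least the r-th one. *)
Lemma singval_rank_gap r : (0 < r)%N -> \rank B = r -> 0 < singval r B /\
  forall w : 'rV[R]_p,
    singval r B * l2norm (w *m B^T) <= l2norm (w *m B^T *m B).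
Proof.
move=> r0 Br; have [pe ss] := eigenseq_gram.
have memE b : b \in eigenseq G -> exists i, b = a i.
  by rewrite (perm_mem pe) => /mapP[i _ ->]; exists i.
have a0 i : 0 <= a i by rewrite -ler0c -dE.
have cnt : count (fun b : R => b != 0%R) (eigenseq G) = r.
  rewrite (permP pe) -Br -mxrank_gram -/G -(mxrank_map toC) -/GC GC_diag.
  rewrite mxrankMfree ?row_free_unit // eqmxMfull ?row_full_unit ?unitmx_inv //.
  rewrite mxrank_diag count_map -sum1_count big_mkcond big_enum /=.
  by apply: eq_bigr => i _; rewrite dE fmorph_eq0; case: (_ != _).
have [q0 hq] : 0 < (eigenseq G)`_r.-1 /\
    forall b, b \in eigenseq G -> b != 0 -> (eigenseq G)`_r.-1 <= b.
  by apply: sorted_threshold => // b /memE[i ->].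
rewrite /singval -/G; set q := _`_r.-1 in q0 hq *.
split=> [|w]; first by rewrite sqrtr_gt0.
rewrite -ler_sqr ?nnegrE ?mulr_ge0 ?sqrtr_ge0 ?l2_ge0 // exprMn sqr_sqrtr ?(ltW q0) //.
have e1 : toC (l2norm (w *m B^T) ^+ 2) = \sum_i toC (a i) * `|y w 0 i| ^+ 2.
  rewrite l2_sqr dot_mulmxl trmxK -mulmxA -/G dotC dot_trmx.
  have -> : toC ((w *m G *m w^T) 0 0) = (map_mx toC w *m GC *m (map_mx toC w)^T) 0 0.
    by rewrite map_trmx -!map_mxM [RHS]mxE.
  by rewrite GC_diag quad; apply: eq_bigr => i _; rewrite dE.
have e2 : toC (l2norm (w *m B^T *m B) ^+ 2) = \sum_i toC (a i ^+ 2) * `|y w 0 i| ^+ 2.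
  have GT : G^T = G by rewrite /G trmx_mul trmxK.
  rewrite -mulmxA -/G l2_sqr dot_mulmxl GT dotC dot_trmx -mulmxA.
  have -> : toC ((w *m G *m (G *m w^T)) 0 0) = (map_mx toC w *m (GC *m GC) *m (map_mx toC w)^T) 0 0.
    by rewrite map_trmx -!map_mxM [RHS]mxE !mulmxA.
  have -> : GC *m GC = invmx U *m diag_mx (\row_i (d 0 i * d 0 i)) *m U.
    by rewrite -mulmx_diag {1 2}GC_diag !mulmxA mulmxK.
  by rewrite quad; apply: eq_bigr => i _; rewrite mxE dE rmorphXn expr2.
rewrite -lecR rmorphM /= e1 e2 mulr_sumr; apply: ler_sum => i _.
rewrite mulrA ler_wpM2r ?exprn_ge0 // -rmorphM lecR expr2.
have [->|ai] := eqVneq (a i) 0; first by rewrite !mulr0.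
rewrite ler_wpM2r // hq // (perm_mem pe); apply/mapP; exists i => //.
by rewrite mem_enum.
Qed.

End Gram.
End SpectralGap.

(** * Derivatives of bilinear expressions *)

Section DifferentialCalculus.
Variable R : realType.

Lemma bounded_continuous (V W : normedModType (R : numFieldType)) (f : {linear V -> W}) (C : R) :
  (forall h, `|f h| <= C * `|h|) -> continuous f.
Proof.
move=> hC v; apply/cvgrPdist_le => e e0; near=> w.
rewrite -linearB; apply: le_trans (hC _) _.
have C1 : 0 < `|C| + 1 by rewrite ltr_wpDl.
apply: (@le_trans _ _ ((`|C| + 1) * `|v - w|)).
  by rewrite ler_wpM2r // (le_trans (ler_norm _)) // lerDl.
rewrite mulrC -ler_pdivlMr //; near: w.
by apply: cvgr_dist_le => //; rewrite divr_gt0.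
Unshelve. all: by end_near. Qed.

Lemma is_diff_intro (V W : normedModType (R : numFieldType)) (F L : V -> W) x (C : R) :
  linear L -> (forall h, `|L h| <= C * `|h|) ->
  (forall e : R, 0 < e -> \forall h \near (0 : V), `|F (x + h) - F x - L h| <= e * `|h|) ->
  is_diff x F L.
Proof.
move=> linL hC hF.
pose LL : {linear V -> W} := HB.pack L (GRing.isLinear.Build _ _ _ _ L linL).
have cL : continuous LL by apply: (@bounded_continuous _ _ LL C); exact: hC.
have dF : F \o shift x = cst (F x) + LL +o_ 0 id.
  apply/eqaddoP => e e0; near=> h.
  rewrite !fctE /= opprD addrA [h + x]addrC; near: h; exact: hF.
have dL : 'd F x = LL :> (V -> W) by exact: diff_unique.
apply: DiffDef => //; apply/diff_locallyP; rewrite dL; split=> //.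
Unshelve. all: by end_near. Qed.

Lemma is_diffE (V W : normedModType (R : numFieldType)) (F L : V -> W) x : is_diff x F L ->
  differentiable F x /\ forall v, 'D_v F x = L v.
Proof. by move=> [dF dL]; split=> // v; rewrite deriveE // dL. Qed.

Lemma derive_dirD (V W : normedModType (R : numFieldType)) (F : V -> W) x u v :
  differentiable F x -> 'D_(u + v) F x = 'D_u F x + 'D_v F x.
Proof. by move=> dF; rewrite !deriveE // linearD. Qed.

Lemma diff_near (V W : normedModType (R : numFieldType)) (F : V -> W) x : differentiable F x ->
  forall e : R, 0 < e -> \forall h \near (0 : V),
    `|F (x + h) - F x - 'd F x h| <= e * `|h|.
Proof.
move=> /diff_locally /eqaddoP dF e e0; near=> h.
have -> : F (x + h) - F x - 'd F x h = (F \o shift x - (cst (F x) + 'd F x)) h.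
  by rewrite !fctE /= opprD addrA [h + x]addrC.
by near: h; exact: dF.
Unshelve. all: by end_near. Qed.

(** The product rule for a bounded bilinear b, of which matrix products and the
inner product are instances. *)
Lemma derive_bilinear (U V1 V2 W : normedModType (R : numFieldType)) (b : V1 -> V2 -> W) (C : R)
    (F1 : U -> V1) (F2 : U -> V2) x :
  (forall v, linear (b ^~ v)) -> (forall u, linear (b u)) ->
  (forall u v, `|b u v| <= C * `|u| * `|v|) ->
  differentiable F1 x -> differentiable F2 x ->
  differentiable (fun y => b (F1 y) (F2 y)) x /\
  forall v, 'D_v (fun y => b (F1 y) (F2 y)) x = b ('D_v F1 x) (F2 x) + b (F1 x) ('D_v F2 x).
Proof.
move=> lin1 lin2 hb0 d1 d2.
suff h : is_diff x (fun y => b (F1 y) (F2 y))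
    (fun h => b ('d F1 x h) (F2 x) + b (F1 x) ('d F2 x h)).
  by have [dB hB] := is_diffE h; split=> // v; rewrite hB -!deriveE.
have C0 : 0 < `|C| + 1 by rewrite ltr_wpDl.
have hb u v : `|b u v| <= (`|C| + 1) * (`|u| * `|v|).
  apply: le_trans (hb0 u v) _; rewrite -mulrA ler_wpM2r ?mulr_ge0 //.
  by rewrite (le_trans (ler_norm _)) // lerDl.
move: (`|C| + 1) C0 hb => {hb0}C C0 hb.
have b1D u u' v : b (u + u') v = b u v + b u' v.
  by have := lin1 v 1 u u'; rewrite !scale1r.
have b2D u v v' : b u (v + v') = b u v + b u v'.
  by have := lin2 u 1 v v'; rewrite !scale1r.
have [k1 k10 h1] := linear_lipschitz (diff_continuous d1).
have [k2 k20 h2] := linear_lipschitz (diff_continuous d2).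
apply: (@is_diff_intro _ _ _ _ _ (C * (k1 * `|F2 x| + k2 * `|F1 x|))).
- move=> k u v; rewrite !linearP.
  rewrite (lin1 (F2 x) k) (lin2 (F1 x) k) scalerDr.
  by rewrite !addrA; congr (_ + _); rewrite -!addrA; congr (_ + _); exact: addrC.
- move=> h; apply: le_trans (ler_normD _ _) _.
  rewrite mulrDr mulrDl; apply: lerD; apply: le_trans (hb _ _) _;
    rewrite -mulrA ler_pM2l //.
    by rewrite mulrAC ler_wpM2r.
  by rewrite mulrC mulrAC ler_wpM2r.
move=> e e0; pose D := C * (`|F2 x| + k2 + 1 + k1 * (k2 + 1) + `|F1 x|).
have D0 : 0 < D + 1.
  by rewrite ltr_wpDl // !(mulr_ge0, addr_ge0) // ltW.
pose e' := Num.min (e / (D + 1)) 1.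
have e'0 : 0 < e' by rewrite lt_min ltr01 divr_gt0.
near=> h.
have r1 : `|F1 (x + h) - F1 x - 'd F1 x h| <= e' * `|h| by near: h; exact: diff_near.
have r2 : `|F2 (x + h) - F2 x - 'd F2 x h| <= e' * `|h| by near: h; exact: diff_near.
have hh : `|h| <= e' by near: h; apply: cvgr0_norm_le => //; exact: cvg_id.
have e'1 : e' <= 1 by rewrite ge_min lexx orbT.
move: (F1 (x + h)) (F2 (x + h)) r1 r2 => f1 f2 r1 r2.
set s1 := f1 - _ - _ in r1; set s2 := f2 - _ - _ in r2.
have e1 : f1 = F1 x + 'd F1 x h + s1.
  by rewrite /s1 -[f1 - _ - _]addrA -opprD [RHS]addrC subrK.
have e2 : f2 = F2 x + ('d F2 x h + s2).
  by rewrite [RHS]addrA /s2 -[f2 - _ - _]addrA -opprD [RHS]addrC subrK.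
have hf2 : `|'d F2 x h + s2| <= (k2 + 1) * `|h|.
  apply: le_trans (ler_normD _ _) _; have := h2 h; have : e' * `|h| <= `|h| by rewrite ler_piMl.
  by move: r2; lra.
have nf2 : `|f2| <= `|F2 x| + k2 + 1.
  rewrite e2 -addrA; apply: le_trans (ler_normD _ _) _; rewrite lerD2l.
  apply: le_trans hf2 _; have k21 : 0 <= k2 + 1 by rewrite addr_ge0 // ltW.
  by rewrite ler_piMr // (le_trans hh).
have -> : b f1 f2 - b (F1 x) (F2 x) - (b ('d F1 x h) (F2 x) + b (F1 x) ('d F2 x h)) =
    b s1 f2 + b ('d F1 x h) ('d F2 x h + s2) + b (F1 x) s2.
  have -> : b f1 f2 = (b (F1 x) (F2 x) + (b ('d F1 x h) (F2 x) + b (F1 x) ('d F2 x h))) +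
      (b s1 f2 + b ('d F1 x h) ('d F2 x h + s2) + b (F1 x) s2).
    rewrite {1}e1 2!b1D {1}e2 (b2D (F1 x)) (b2D (F1 x)).
    have -> : b ('d F1 x h) f2 = b ('d F1 x h) (F2 x) + b ('d F1 x h) ('d F2 x h + s2).
      by rewrite {1}e2 b2D.
    by rewrite (AC ((1*2)*2*1) ((1*(4*2))*(6*5*3))).
  by rewrite -[LHS]addrA -opprD addrAC subrr add0r.
apply: le_trans (ler_normD _ _) _.
have t1 := ler_normD (b s1 f2) (b ('d F1 x h) ('d F2 x h + s2)).
have t2 : `|b s1 f2| <= C * (e' * `|h| * (`|F2 x| + k2 + 1)).
  by apply: le_trans (hb _ _) _; rewrite ler_pM2l // ler_pM.
have t3 : `|b ('d F1 x h) ('d F2 x h + s2)| <= C * (k1 * e' * ((k2 + 1) * `|h|)).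
  apply: le_trans (hb _ _) _; rewrite ler_pM2l // ler_pM //.
  by apply: le_trans (h1 h) _; rewrite ler_pM2l.
have t4 : `|b (F1 x) s2| <= C * (`|F1 x| * (e' * `|h|)).
  by apply: le_trans (hb _ _) _; rewrite ler_pM2l // ler_wpM2l.
have t5 : e' * D * `|h| <= e * `|h|.
  rewrite ler_wpM2r //; apply: (@le_trans _ _ (e' * (D + 1))).
    by rewrite ler_wpM2l ?lerDl // ltW.
  by rewrite -ler_pdivlMr // ge_min lexx.
by move: t1 t2 t3 t4 t5; rewrite /D; lra.
Unshelve. all: by end_near. Qed.

End DifferentialCalculus.

(** * Symmetry of the second derivative *)

Section SecondDerivatives.
Variable R : realType.

Lemma norm_mulmx k m n (M : 'M[R]_(k, m)) (N : 'M[R]_(m, n)) :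
  `|M *m N| <= m%:R * `|M| * `|N|.
Proof.
rewrite [leLHS]mx_normrE; apply: bigmax_le => [|[i j] _ /=].
  by rewrite !mulr_ge0.
rewrite mxE; apply: le_trans (ler_norm_sum _ _ _) _.
rewrite -mulrA mulr_natl -[X in _ *+ X]card_ord -sumr_const.
by apply: ler_sum => l _; rewrite normrM ler_pM // coord_le_norm.
Qed.

Lemma norm_trmx m n (M : 'M[R]_(m, n)) : `|M^T| <= `|M|.
Proof.
rewrite [leLHS]mx_normrE; apply: bigmax_le => [|[i j] _ /=]; first exact: normr_ge0.
by rewrite mxE coord_le_norm.
Qed.

Lemma norm_dot n (u v : 'rV[R]_n) : `|dot u v| <= n%:R * `|u| * `|v|.
Proof.
rewrite dot_trmx; apply: le_trans (coord_le_norm _ _ _) _.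
by apply: le_trans (norm_mulmx _ _) _; rewrite ler_wpM2l ?norm_trmx // mulr_ge0.
Qed.

Lemma derive_mulmx (V : normedModType (R : numFieldType)) k m n (F : V -> 'M[R]_(k, m))
    (H : V -> 'M[R]_(m, n)) x : differentiable F x -> differentiable H x ->
  differentiable (fun y => F y *m H y) x /\
  forall v, 'D_v (fun y => F y *m H y) x = 'D_v F x *m H x + F x *m 'D_v H x.
Proof.
move=> dF dH; apply: (@derive_bilinear _ _ _ _ _ (fun M N => M *m N) m%:R) => //.
- by move=> N a M1 M2; rewrite mulmxDl scalemxAl.
- by move=> M a N1 N2; rewrite mulmxDr scalemxAr.
- by move=> M N; exact: norm_mulmx.
Qed.

Lemma derive_mulmx_tr (V : normedModType (R : numFieldType)) m n (F : V -> 'rV[R]_m)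
    (H : V -> 'M[R]_(n, m)) x : differentiable F x -> differentiable H x ->
  differentiable (fun y => F y *m (H y)^T) x /\
  forall v, 'D_v (fun y => F y *m (H y)^T) x = 'D_v F x *m (H x)^T + F x *m ('D_v H x)^T.
Proof.
move=> dF dH; apply: (@derive_bilinear _ _ _ _ _ (fun (M : 'rV_m) N => M *m N^T) m%:R) => //.
- by move=> N a M1 M2; rewrite mulmxDl scalemxAl.
- by move=> M a N1 N2; rewrite linearP mulmxDr scalemxAr.
- move=> M N; apply: le_trans (norm_mulmx _ _) _.
  by rewrite ler_wpM2l ?norm_trmx // mulr_ge0.
Qed.

Lemma derive_dot (V : normedModType (R : numFieldType)) m (F H : V -> 'rV[R]_m) x :
  differentiable F x -> differentiable H x ->
  differentiable (fun y => dot (F y) (H y) : R) x /\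
  forall v, 'D_v (fun y => dot (F y) (H y) : R) x = dot ('D_v F x) (H x) + dot (F x) ('D_v H x).
Proof.
move=> dF dH; apply: (@derive_bilinear _ _ _ _ _ (fun u v => dot u v : R) m%:R) => //.
- by move=> v a u1 u2; rewrite dotDl dotZl.
- by move=> u a v1 v2; rewrite dotDr dotZr.
- by move=> u v; exact: norm_dot.
Qed.

Lemma is_derive_line n (g : 'rV[R]_n -> R) (q v : 'rV[R]_n) (t : R) :
  differentiable g (q + t *: v) ->
  is_derive t 1 (fun s : R => g (q + s *: v)) ('D_v g (q + t *: v)).
Proof.
move=> dg; have dv := diff_derivable (v := v) dg.
have E : (fun h : R => h^-1 *: (((fun s : R => g (q + s *: v)) \o shift t) (h *: 1)
      - g (q + t *: v))) =
    (fun h : R => h^-1 *: ((g \o shift (q + t *: v)) (h *: v) - g (q + t *: v))).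
  apply/funext => h /=; congr (_ *: (g _ - _)).
  by rewrite [h *: 1]mulr1 scalerDl addrC -addrA [t *: v + q]addrC.
apply: DeriveDef; first by rewrite /derivable E.
by rewrite /derive E.
Qed.

Lemma second_order_coef_unique (D : R -> R) (a b : R) :
  (forall e, 0 < e -> exists2 dl, 0 < dl & forall t, 0 < t -> t < dl ->
     `|D t - t ^+ 2 * a| <= e * t ^+ 2) ->
  (forall e, 0 < e -> exists2 dl, 0 < dl & forall t, 0 < t -> t < dl ->
     `|D t - t ^+ 2 * b| <= e * t ^+ 2) -> a = b.
Proof.
move=> ha hb; apply/eqP; rewrite -subr_eq0 -normr_le0.
apply: (@le_mul_eps _ 2 _ 0) => // e e0.
have [d1 d10 h1] := ha e e0; have [d2 d20 h2] := hb e e0.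
pose t := Num.min d1 d2 / 2.
have m0 : 0 < Num.min d1 d2 by rewrite lt_min d10.
have t0 : 0 < t by rewrite divr_gt0.
have : t < Num.min d1 d2 by rewrite /t; lra.
rewrite lt_min => /andP[td1 td2].
have k1 := h1 t t0 td1; have k2 := h2 t t0 td2.
have t20 : 0 < t ^+ 2 by rewrite exprn_gt0.
rewrite add0r -(ler_pM2l t20) -[X in X * `|_|](gtr0_norm t20) -normrM.
have -> : t ^+ 2 * (a - b) = (D t - t ^+ 2 * b) - (D t - t ^+ 2 * a) by ring.
by apply: le_trans (ler_normB _ _) _; move: k1 k2; lra.
Qed.

(** Both mixed derivatives are limits of the same second-order difference
quotient, by the mean value theorem in one of the two variables; this needs the
Jacobian to be differentiable at x only. *)
Lemma second_derivative_sym n m (A : 'rV[R]_n -> 'rV[R]_m) (Y : set 'rV[R]_n) x u v w :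
  open Y -> Y x -> (forall y, Y y -> differentiable A y) ->
  differentiable (jacobian A) x ->
  dot w (u *m 'D_v (jacobian A) x) = dot w (v *m 'D_u (jacobian A) x).
Proof.
move=> oY Yx dA dJ; pose g y := dot w (A y).
pose D t (u v : 'rV[R]_n) := (g (x + t *: u + t *: v) - g (x + t *: v)) - (g (x + t *: u) - g x).
have Dsym t : D t u v = D t v u.
  by rewrite /D [x + t *: v + _]addrAC; ring.
have dg y : Y y -> differentiable g y /\
    forall h, 'D_h g y = dot w (h *m jacobian A y).
  move=> /dA dAy; have [dgy hg] := derive_dot (differentiable_cst w y) dAy.
  split=> // h; apply: etrans (hg h) _.
  by rewrite derive_cst dot0l add0r deriveEjacobian.
have main (a b : 'rV[R]_n) e : 0 < e -> exists2 dl, 0 < dl & forall t, 0 < t -> t < dl ->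
    `|D t a b - t ^+ 2 * dot w (b *m 'D_a (jacobian A) x)| <= e * t ^+ 2.
  move=> e0; have [dlY dlY0 hY] := open_l2 oY Yx.
  pose S := l2norm a + l2norm b + 1.
  have S0 : 0 < S by rewrite ltr_wpDl // addr_ge0 ?l2_ge0.
  pose N : R := (l2norm w + 1) * (n%:R * m%:R + 1) * (l2norm b + 1).
  have N0 : 0 < N by rewrite !mulr_gt0 // ltr_wpDl // ?mulr_ge0 ?l2_ge0.
  have e'0 : 0 < e / 2 / N / S by do 3! apply: divr_gt0 => //.
  have [dlJ dlJ0 hJ] := diff_l2 dJ e'0.
  exists (Num.min dlY dlJ / S); first by rewrite divr_gt0 // lt_min dlY0.
  move=> t t0; rewrite ltr_pdivlMr // lt_min => /andP[tY tJ].
  have near s c : 0 <= s -> s <= t -> 0 <= c -> c <= t ->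
      l2norm (c *: a + s *: b) <= t * S.
    move=> s0 st c0 ct; apply: le_trans (l2D _ _) _; rewrite !l2Z !ger0_norm //.
    have h1 : c * l2norm a <= t * l2norm a by rewrite ler_wpM2r ?l2_ge0.
    have h2 : s * l2norm b <= t * l2norm b by rewrite ler_wpM2r ?l2_ge0.
    by rewrite /S; lra.
  have inY s c : 0 <= s -> s <= t -> 0 <= c -> c <= t -> Y (x + c *: a + s *: b).
    move=> s0 st c0 ct; apply: hY; rewrite -[x + _ + _]addrA [x + _]addrC addrK.
    exact: le_lt_trans (near _ _ s0 st c0 ct) tY.
  have Jexp s c : 0 <= s -> s <= t -> 0 <= c -> c <= t ->
      `|jacobian A (x + c *: a + s *: b) - jacobian A x
        - 'D_(c *: a + s *: b) (jacobian A) x| <= e / 2 / N * t.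
    move=> s0 st c0 ct; have h := near _ _ s0 st c0 ct.
    rewrite -[x + _ + _]addrA; apply: le_trans (hJ _ (le_lt_trans h tJ)) _.
    apply: (@le_trans _ _ (e / 2 / N / S * (t * S))); first by rewrite ler_pM2l.
    by rewrite [t * S]mulrC mulrA divfK // gt_eqF.
  pose psi s := g (x + t *: a + s *: b) - g (x + 0 *: a + s *: b).
  pose dpsi s := dot w (b *m (jacobian A (x + t *: a + s *: b)
                              - jacobian A (x + 0 *: a + s *: b))).
  have hpsi s : 0 <= s -> s <= t -> is_derive s 1 psi (dpsi s).
    move=> s0 st; rewrite /dpsi mulmxBr dotBr.
    have Y1 := inY _ _ s0 st (ltW t0) (lexx t).
    have Y2 := inY _ _ s0 st (lexx 0) (ltW t0).
    apply: is_deriveB.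
      by have [dg1 dgE] := dg _ Y1; rewrite -dgE; exact: is_derive_line.
    by have [dg1 dgE] := dg _ Y2; rewrite -dgE; exact: is_derive_line.
  have [||s] := @MVT R psi dpsi 0 t t0.
  - by move=> s; rewrite in_itv /= => /andP[s0 st]; apply: hpsi; exact: ltW.
  - apply: derivable_within_continuous => s; rewrite in_itv /= => /andP[s0 st].
    by have [] := hpsi s s0 st.
  rewrite in_itv /= => /andP[/ltW s0 /ltW st].
  have -> : psi t - psi 0 = D t a b.
    by rewrite /psi /D !scale0r !addr0; ring.
  rewrite subr0 => ->.
  have J1 := Jexp _ _ s0 st (ltW t0) (lexx t).
  have J2 := Jexp _ _ s0 st (lexx 0) (ltW t0).
  pose r := (jacobian A (x + t *: a + s *: b) - jacobian A x
        - 'D_(t *: a + s *: b) (jacobian A) x) -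
     (jacobian A (x + 0 *: a + s *: b) - jacobian A x
        - 'D_(0 *: a + s *: b) (jacobian A) x).
  have regroup (M1 M2 M0 E1 E2 : 'M[R]_(n, m)) :
      M1 - M2 = (E1 - E2) + ((M1 - M0 - E1) - (M2 - M0 - E2)).
    by apply/matrixP => i j; rewrite !mxE; ring.
  have rE : jacobian A (x + t *: a + s *: b) - jacobian A (x + 0 *: a + s *: b) =
      t *: 'D_a (jacobian A) x + r.
    have -> : t *: 'D_a (jacobian A) x =
        'D_(t *: a + s *: b) (jacobian A) x - 'D_(0 *: a + s *: b) (jacobian A) x.
      by rewrite !deriveE // scale0r add0r linearD addrK linearZ.
    exact: regroup.
  have -> : dpsi s * t - t ^+ 2 * dot w (b *m 'D_a (jacobian A) x) = t * dot w (b *m r).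
    by rewrite /dpsi rE mulmxDr dotDr -scalemxAr dotZr; ring.
  rewrite normrM gtr0_norm // expr2 mulrA [leRHS]mulrC ler_pM2l //.
  apply: le_trans (cauchy_schwarz _ _) _.
  have rn : `|r| <= e / N * t.
    apply: le_trans (ler_normB _ _) _.
    have -> : e / N * t = e / 2 / N * t + e / 2 / N * t by field; rewrite gt_eqF.
    exact: (lerD J1 J2).
  apply: (@le_trans _ _ ((l2norm w + 1) * ((n%:R * m%:R + 1) * (e / N * t) * (l2norm b + 1)))).
    rewrite ler_pM ?l2_ge0 // ?lerDl //; apply: le_trans (l2_mulmx _ _) _.
    rewrite [m%:R * _]mulrC ler_pM ?l2_ge0 ?mulr_ge0 // ?lerDl //.
    by rewrite ler_pM ?mulr_ge0 // lerDl.
  have -> : (l2norm w + 1) * ((n%:R * m%:R + 1) * (e / N * t) * (l2norm b + 1)) =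
    e / N * N * t by rewrite /N; ring.
  by rewrite divfK ?gt_eqF // mulrC.
have main' e : 0 < e -> exists2 dl, 0 < dl & forall t, 0 < t -> t < dl ->
    `|D t u v - t ^+ 2 * dot w (u *m 'D_v (jacobian A) x)| <= e * t ^+ 2.
  by move=> /(main v u) [dl dl0 h]; exists dl => // t t0 tdl; rewrite Dsym; exact: h.
exact: second_order_coef_unique main' (main u v).
Qed.

End SecondDerivatives.

(** * Gradient and Hessian of the penalized objective *)

Section GradientsHessians.
Variables (R : realType) (n : nat).

Lemma derive_eq_on (V W : normedModType (R : numFieldType)) (F H : V -> W) (Y : set V) x :
  open Y -> Y x -> (forall y, Y y -> F y = H y) -> differentiable H x ->
  differentiable F x /\ forall v, 'D_v F x = 'D_v H x.
Proof.
move=> oY Yx FH dH; have [C C0 hC] := linear_lipschitz (diff_continuous dH).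
suff /is_diffE [dF hF] : is_diff x F ('d H x).
  by split=> // v; rewrite hF deriveE.
apply: (@is_diff_intro _ _ _ _ _ _ C) => //.
  by move=> a u v; rewrite linearP.
move=> e e0; have /nbhs_ballP [dl /= dl0 hdl] : nbhs x Y by apply: open_nbhs_nbhs.
near=> h; rewrite (FH x Yx) (FH (x + h)); first by near: h; exact: (diff_near dH e0).
apply: hdl; rewrite -ball_normE /= opprD addrA subrr add0r normrN.
by near: h; apply: cvgr0_norm_lt => //; exact: cvg_id.
Unshelve. all: by end_near. Qed.

Lemma derive_addZ (V W : normedModType (R : numFieldType)) (F H : V -> W) (b : R) x :
  differentiable F x -> differentiable H x ->
  differentiable (fun y => F y + b *: H y) x /\
  forall v, 'D_v (fun y => F y + b *: H y) x = 'D_v F x + b *: 'D_v H x.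
Proof.
move=> dF dH; have iF : is_diff x F ('d F x) by exact: differentiableP.
have iH : is_diff x H ('d H x) by exact: differentiableP.
have iZ : is_diff x (b *: H) (b *: ('d H x : V -> W)) by exact: is_diffZ.
have iD : is_diff x (F + b *: H) (('d F x : V -> W) + b *: ('d H x : V -> W)) by exact: is_diffD.
have [dFH hFH] := is_diffE iD; split=> // v.
by rewrite (deriveE _ dF) (deriveE _ dH); exact: hFH.
Qed.

Lemma derive_chain (U V W : normedModType (R : numFieldType)) (F : U -> V) (H : V -> W) x :
  differentiable F x -> differentiable H (F x) ->
  differentiable (fun y => H (F y)) x /\
  forall v, 'D_v (fun y => H (F y)) x = 'D_('D_v F x) H (F x).
Proof.
move=> dF dH; have iF : is_diff x F ('d F x) by exact: differentiableP.
have iH : is_diff (F x) H ('d H (F x)) by exact: differentiableP.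
have iC : is_diff x (H \o F) ('d H (F x) \o 'd F x) by exact: is_diff_comp.
have [dC hC] := is_diffE iC; split=> // v.
by rewrite (deriveE _ dF) (deriveE _ dH); exact: hC.
Qed.

Lemma dot_delta m (u : 'rV[R]_m) i : dot (delta_mx 0 i) u = u 0 i.
Proof.
rewrite /dot (bigD1 i) //= big1 => [|j ji]; first by rewrite mxE !eqxx mul1r addr0.
by rewrite mxE eqxx (negPf ji) mul0r.
Qed.

Lemma derive_grad (f : 'rV[R]_n -> R) x v : differentiable f x ->
  'D_v f x = dot v (grad f x).
Proof.
move=> df; rewrite deriveE // {1}[v]row_sum_delta linear_sum; apply: eq_bigr => i _.
by rewrite linearZ /= mxE deriveE.
Qed.

Lemma gradP (f : 'rV[R]_n -> R) x (g : 'rV[R]_n) :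
  (forall v, 'D_v f x = dot v g) -> grad f x = g.
Proof. by move=> h; apply/rowP => i; rewrite mxE h dot_delta. Qed.

Lemma dot_mulmxv (M : 'M[R]_n) d : dot d (mulmxv M d) = dot (d *m M) d.
Proof. by rewrite /mulmxv dot_mulmxl. Qed.

Lemma hess_quadratic (f : 'rV[R]_n -> R) x d : differentiable (grad f) x ->
  dot d (mulmxv (hess f x) d) = dot ('D_d (grad f) x) d.
Proof. by move=> df; rewrite dot_mulmxv /hess -deriveEjacobian. Qed.

(** The left side uses the Hessians of the components of c, the right side the
derivative of its Jacobian, the form in which the identities differentiate. *)
Lemma hess_comb_quadratic p (c : 'rV[R]_n -> 'rV[R]_p) (Y : set 'rV[R]_n) x d lam :
  open Y -> Y x -> (forall y, Y y -> differentiable c y) ->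
  differentiable (jacobian c) x ->
  dot d (mulmxv (hess_comb c x lam) d) = dot lam (d *m 'D_d (jacobian c) x).
Proof.
move=> oY Yx dc dJ; rewrite dot_mulmxv /hess_comb mulmx_sumr.
rewrite [in RHS]/dot; rewrite (_ : dot _ _ = \sum_i dot (d *m (lam 0 i *: hess (fun y => c y 0 i) x)) d); last first.
  elim/big_rec2: _ => [|i u v _ IH]; first by rewrite dot0l.
  by rewrite dotDl IH.
apply: eq_bigr => i _; rewrite -scalemxAr dotZl; congr (_ * _).
have gE y : Y y -> grad (fun y => c y 0 i) y = cst (delta_mx 0 i) y *m (jacobian c y)^T.
  move=> /dc dcy; apply/rowP => j; rewrite mxE.
  have := congr1 (fun M : 'rV[R]_p => M 0 i) (derive_mx (diff_derivable (v := delta_mx 0 j) dcy)).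
  rewrite deriveEjacobian // [RHS]mxE => <-.
  by rewrite -!rowE /= !mxE.
have [dH hH] := derive_mulmx_tr (differentiable_cst (delta_mx 0 i : 'rV[R]_p) x) dJ.
have [dG hG] := derive_eq_on oY Yx gE dH.
rewrite -deriveEjacobian // hG hH derive_cst mul0mx add0r.
by rewrite dot_mulmxl trmxK dot_delta.
Qed.

Lemma hess_lagrangian_quadratic (f : 'rV[R]_n -> R) p (c : 'rV[R]_n -> 'rV[R]_p)
    (Y : set 'rV[R]_n) x d lam :
  open Y -> Y x -> (forall y, Y y -> differentiable c y) ->
  differentiable (grad f) x -> differentiable (jacobian c) x ->
  dot d (mulmxv (hess f x + hess_comb c x lam) d) =
  dot ('D_d (grad f) x) d + dot lam (d *m 'D_d (jacobian c) x).
Proof.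
move=> oY Yx dc df dJ; rewrite -(hess_quadratic d df) -(hess_comb_quadratic d lam oY Yx dc dJ).
by rewrite !dot_mulmxv mulmxDr dotDl.
Qed.

Section Objective.
Variables (p : nat) (Y : set 'rV[R]_n).
Variables (f : 'rV[R]_n -> R) (c : 'rV[R]_n -> 'rV[R]_p) (A : 'rV[R]_n -> 'rV[R]_n).
Variable beta : R.

Lemma grad_cdp_obj y : differentiable f (A y) -> differentiable A y -> differentiable c y ->
  grad (cdp_obj f c A beta) y =
  grad f (A y) *m (jacobian A y)^T + beta *: (c y *m (jacobian c y)^T).
Proof.
move=> df dA dc; have [dn hn] := derive_dot dc dc.
have [dfA hfA] := derive_chain dA df.
have [dh hh] := @derive_addZ _ _ (fun y => f (A y)) (fun y => dot (c y) (c y) : R) (beta / 2) y dfA dn.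
apply: gradP => v.
have -> : cdp_obj f c A beta = (fun y => f (A y) + (beta / 2) *: (dot (c y) (c y) : R)).
  by apply/funext => z; rewrite /cdp_obj l2_sqr.
rewrite hh hn hfA derive_grad // !deriveEjacobian // dotDr dotZr !dot_mulmxl.
by rewrite (dotC (c y)) dot_mulmxl /GRing.scale /=; field.
Qed.

Hypotheses (oY : open Y) (f_diff : forall y, differentiable f y).
Hypotheses (A_diff : forall y, Y y -> differentiable A y)
  (c_diff : forall y, Y y -> differentiable c y).
Variable x : 'rV[R]_n.
Hypotheses (Yx : Y x) (gf_diff : differentiable (grad f) (A x))
  (JA_diff : differentiable (jacobian A) x) (Jc_diff : differentiable (jacobian c) x).
Hypothesis cx : c x = 0.

(** Since c vanishes at x, the penalty contributes only through the Jacobian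
of c. *)
Lemma hess_cdp_obj d : dot d (mulmxv (hess (cdp_obj f c A beta) x) d) =
  dot ('D_(d *m jacobian A x) (grad f) (A x)) (d *m jacobian A x)
  + dot (grad f (A x)) (d *m 'D_d (jacobian A) x)
  + beta * l2norm (d *m jacobian c x) ^+ 2.
Proof.
have [dgA hgA] := derive_chain (A_diff Yx) gf_diff.
have [d1 h1] := derive_mulmx_tr dgA JA_diff.
have [d2 h2] := derive_mulmx_tr (c_diff Yx) Jc_diff.
have [d3 h3] := derive_addZ beta d1 d2.
have [|dg hg] := @derive_eq_on _ _ (grad (cdp_obj f c A beta)) _ Y x oY Yx _ d3.
  by move=> y Yy; rewrite grad_cdp_obj //; [exact: A_diff|exact: c_diff].
rewrite hess_quadratic // hg h3 h1 h2 hgA cx mul0mx addr0.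
rewrite (deriveEjacobian _ (A_diff Yx)) (deriveEjacobian _ (c_diff Yx)).
by rewrite !dotDl dotZl !dot_mulmxl !trmxK l2_sqr dot_mulmxl.
Qed.
End Objective.

End GradientsHessians.

(** * Consequences of the rank conditions *)

Section DataUnpacking.
Variable R : realType.

Lemma loc_lipschitz_at n (W : normedModType (R : numFieldType)) (X : set 'rV[R]_n)
    (F : 'rV[R]_n -> W) x : X x -> [locally [lipschitz F y | y in X]] ->
  exists L dl, [/\ 0 <= L, 0 < dl & forall y k, X y -> X k ->
    l2norm (y - x) < dl -> l2norm (k - x) < dl -> `|F y - F k| <= L * l2norm (y - k)].
Proof.
move=> Xx /(_ (x, x) (conj Xx Xx)) [M0 [M0r hM]].
have /hM : M0 < `|M0| + 1 by rewrite (le_lt_trans (ler_norm _)) // ltrDl.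
move: (`|M0| + 1) (ltr_wpDl (normr_ge0 M0) ltr01) => M M_gt0 h.
have [[B1 B2] [/= /nbhs_l2 [e1 e10 h1] /nbhs_l2 [e2 e20 h2]] hB] : nbhs (x, x) _ := h.
exists M, (Num.min e1 e2); split; [exact: ltW|by rewrite lt_min e10|].
move=> y k Xy Xk; rewrite !lt_min => /andP[y1 _] /andP[_ k2].
have := hB (y, k) (conj (h1 _ y1) (h2 _ k2)) (conj Xy Xk).
rewrite /= => h3; apply: le_trans h3 _.
by rewrite ler_pM2l // norm_le_l2.
Qed.

Lemma mxrank_has_dim n p r (M : 'M[R]_(n, p)) (S : set 'rV[R]_p) : has_dim S r ->
  (forall u, S u <-> exists v, u = v *m M) -> \rank M = r.
Proof.
move=> [U SU <-] hS; pose f : 'Hom('rV[R]_(\rank M), 'rV[R]_p) := linfun (mulmxr (row_base M)).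
have fE u : f u = u *m row_base M by rewrite lfunE.
have ker0 : lker f == 0%VS.
  by apply/lker0P => u v; rewrite !fE; apply: row_free_inj; exact: row_base_free.
have -> : U = limg f.
  apply/vspaceP => u; have -> : (u \in U) = `[< S u >].
    by apply/idP/asboolP; rewrite SU.
  apply/asboolP/memv_imgP => [/hS [v ->]|[v _ ->]].
    have /submxP [w vw] : (v *m M <= row_base M)%MS by rewrite eq_row_base submxMl.
    by exists w; rewrite ?memvf // fE vw.
  rewrite fE; apply/hS; have /submxP [w ->] : (v *m row_base M <= M)%MS.
    by rewrite (submx_trans (submxMl _ _)) // eq_row_base.
  by exists w.
rewrite limg_dim_eq ?(eqP ker0) ?capv0 // dimvf dim_matrix; exact/esym/mul1n.
Qed.

Lemma has_dim_eq n (S T : set 'rV[R]_n) r : has_dim S r -> has_dim T r ->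
  S `<=` T -> T `<=` S.
Proof.
move=> [U -> dU] [V -> dV] UV; suff -> : U = V by [].
by apply/eqP; rewrite eqEdim dU dV leqnn andbT; apply/subvP => u uU; apply: UV.
Qed.

(** The image of the lineality space is contained in that of the direction space
and has the same dimension. *)
Lemma lineality_onto_image n p (X : set 'rV[R]_n) (P : 'M[R]_n) (J : 'M[R]_(n, p)) x r :
  is_orthoproj (aff_dir X) P -> X x ->
  has_dim [set mulmxv J^T d | d in aff_dir X] r ->
  has_dim [set mulmxv J^T d | d in
     [set d | tangent_cone X x d /\ tangent_cone X x (- d)]] r ->
  forall d, aff_dir X d -> exists l,
    [/\ tangent_cone X x l, tangent_cone X x (- l) & l *m J = d *m J].
Proof.
move=> Pp Xx h1 h2 d dE.
have [|l [l1 l2] lE] := has_dim_eq h2 h1 _ (ex_intro2 _ _ d dE erefl).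
  by move=> _ [l [l1 _] <-]; exists l => //; exact: (tangent_aff_dir Pp Xx l1).
by exists l; split=> //; rewrite -[J]trmxK.
Qed.

Lemma normal_tangent_le0 n (X : set 'rV[R]_n) x v d : X x -> normal_cone X x v ->
  tangent_cone X x d -> dot v d <= 0.
Proof.
move=> Xx vN /tangentP -/(_ Xx) h.
apply: (@le_mul_eps _ (l2norm v) _ 0) => [|e e0]; first exact: l2_ge0.
have [t [y [t0 _ Xy hy]]] := h e 1 e0 ltr01.
rewrite -(ler_pM2l t0) -dotZr add0r.
have -> : t *: d = (y - x) - (y - x - t *: d) by rewrite opprB addrC subrK.
rewrite dotBr; have := vN y Xy; have := dot_le v (- (y - x - t *: d)).
rewrite dotNr l2N; have : l2norm v * l2norm (y - x - t *: d) <= l2norm v * (e * t).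
  by rewrite ler_wpM2l // l2_ge0.
lra.
Qed.

(** The representative u of d modulo the kernel of J, taken in the row space of
the transpose of P J: this is the orthogonal complement of the kernel in the
direction space, where the r-th singular value bounds J from below. *)
Lemma kernel_complement n p (X : set 'rV[R]_n) (P : 'M[R]_n) (J : 'M[R]_(n, p)) r d :
  is_orthoproj (aff_dir X) P -> (0 < r)%N ->
  has_dim [set mulmxv J^T d | d in aff_dir X] r -> aff_dir X d ->
  0 < singval r (P *m J) /\
  exists u, [/\ aff_dir X u, u *m J = d *m J,
    singval r (P *m J) * l2norm u <= l2norm (u *m J) &
    forall w, aff_dir X w -> w *m J = 0 -> dot u w = 0].
Proof.
move=> Pp r0 hr dE; have PT := orthoproj_tr Pp; pose B := P *m J.
have rB : \rank B = r.
  apply: mxrank_has_dim hr _ => u; split=> [[w wE <-]|[v ->]].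
    by exists w; rewrite /mulmxv trmxK /B mulmxA ((aff_dirP Pp w).1 wE).
  exists (v *m P); rewrite /mulmxv ?trmxK ?mulmxA //.
  by apply/(aff_dirP Pp); case: Pp => _ PP _; rewrite -mulmxA PP.
have [s0 hs] := singval_rank_gap r0 rB; split=> //.
have /submxP [w wE] : (d *m B <= B^T *m B)%MS.
  apply: submx_trans (submxMl d B) _.
  by rewrite -(mxrank_leqif_sup (submxMl B^T B)).2 mxrank_gram eqxx.
have inE v : aff_dir X v -> v *m B = v *m J.
  by move=> vE; rewrite /B mulmxA ((aff_dirP Pp v).1 vE).
have uE : aff_dir X (w *m B^T).
  apply/(aff_dirP Pp); case: Pp => _ PP _.
  by rewrite /B trmx_mul PT -!mulmxA PP.
exists (w *m B^T); split=> //.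
- by rewrite -(inE _ uE) -(inE _ dE) wE; exact: esym (mulmxA _ _ _).
- by rewrite -(inE _ uE).
- by move=> v vE vJ; rewrite dot_mulmxl trmxK inE // vJ dot0r.
Qed.

End DataUnpacking.

(** * Lipschitz quotients of the Jacobian *)

Section LipschitzDerivative.
Variables (R : realType) (n : nat) (X : set 'rV[R]_n) (P : 'M[R]_n) (x : 'rV[R]_n).
Hypothesis P_proj : is_orthoproj (aff_dir X) P.
Hypothesis X_convex : convex_set (X : set (convex_lmodType 'rV[R]_n)).
Hypothesis Xx : X x.

(** Every direction of the affine hull is, up to scale, the difference of two
feasible ones, so quotients over points of X control the derivative along the
whole direction space and not only along tangent directions. *)
Lemma lipschitz_derivative_bound (JA : 'rV[R]_n -> 'M[R]_n) (rho k C : R) w v d :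
  differentiable JA x -> 0 < rho -> 0 <= k ->
  (forall y z, X y -> X z -> l2norm (y - x) <= rho -> l2norm (z - x) <= rho ->
     y != z -> k * l2norm w * (opnorm (JA y - JA z) / l2norm (y - z)) <= C) ->
  aff_dir X d ->
  k * `|dot w (v *m 'D_d JA x)| <= C * l2norm d * l2norm v.
Proof.
move=> dJ rho0 k0 hL dE.
have [->|d0] := eqVneq d 0.
  by rewrite derive0 mulmx0 dot0r normr0 l2_0 !mulr0 mul0r.
have [b [eta [bE eta0 hb]]] := relint_direction P_proj X_convex Xx.
have ld0 : 0 < l2norm d by rewrite l2_gt0.
pose nu := eta / l2norm d; have nu0 : 0 < nu by rewrite divr_gt0.
pose e := nu *: d.
have eE : aff_dir X e by exact: (aff_dirZ P_proj).
have le : l2norm e = eta by rewrite l2Z gtr0_norm // divfK // gt_eqF.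
have E0 : aff_dir X 0 by apply/(aff_dirP P_proj); rewrite mul0mx.
suff main : k * `|dot w (v *m 'D_e JA x)| <= C * l2norm e * l2norm v.
  move: main; have -> : 'D_e JA x = nu *: 'D_d JA x by rewrite !deriveE // linearZ.
  rewrite -scalemxAr dotZr normrM l2Z !(gtr0_norm nu0) => main.
  rewrite -(ler_pM2l nu0); move: main; congr (_ <= _); ring.
pose N := 2 * k * (l2norm w * (n%:R * n%:R * l2norm v)).
have N0 : 0 <= N by rewrite !mulr_ge0 ?l2_ge0.
apply: (le_mul_eps N0) => eps eps0.
have [et1 [dl1 [et10 dl10 h1]]] := diff_along b dJ eps0.
have [et2 [dl2 [et20 dl20 h2]]] := diff_along (b + e) dJ eps0.
have S0 : 0 < l2norm b + eta by rewrite ltr_wpDl ?l2_ge0.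
pose m := Num.min (Num.min 1 (rho / (l2norm b + eta))) (Num.min dl1 dl2).
have m0 : 0 < m by rewrite !lt_min ltr01 dl10 dl20 divr_gt0.
pose t := m / 2; have t0 : 0 < t by rewrite divr_gt0.
have : t < m by rewrite /t; lra.
rewrite !lt_min => /andP[/andP[t1 trho] /andP[tdl1 tdl2]].
rewrite ltr_pdivlMr // in trho.
pose y := x + t *: b; pose z := x + t *: (b + e).
have Xy : X y by have := hb 0 t E0; rewrite l2_0 addr0; apply; rewrite ltW.
have Xz : X z by apply: hb; rewrite ?le // ltW.
have yx : y - x = t *: b by rewrite /y addrC addKr.
have zx : z - x = t *: (b + e) by rewrite /z addrC addKr.
have zy : z - y = t *: e by rewrite -[z](subrK x) zx -[y](subrK x) yx scalerDr; apply/rowP => i; rewrite !mxE; ring.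
have yrho : l2norm (y - x) <= rho.
  rewrite yx l2Z gtr0_norm //; apply: le_trans (ltW trho).
  by rewrite ler_pM2l // lerDl ltW.
have zrho : l2norm (z - x) <= rho.
  rewrite zx l2Z gtr0_norm //; apply: le_trans (ltW trho).
  by rewrite ler_pM2l // -le l2D.
have lzy : l2norm (z - y) = t * eta by rewrite zy l2Z gtr0_norm // le.
have zy0 : z != y by rewrite -subr_eq0 -l2_eq0 lzy gt_eqF // mulr_gt0.
have := hL z y Xz Xy zrho yrho zy0; rewrite lzy mulrA ler_pdivrMr ?mulr_gt0 // => hop.
have r1 := h1 t y t0 tdl1; rewrite yx subrr l2_0 in r1.
have r2 := h2 t z t0 tdl2; rewrite zx subrr l2_0 in r2.
have {}r1 := r1 (mulr_ge0 (ltW et10) (ltW t0)); have {}r2 := r2 (mulr_ge0 (ltW et20) (ltW t0)).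
pose rem := (JA z - JA x - t *: 'D_(b + e) JA x) - (JA y - JA x - t *: 'D_b JA x).
have remE : JA z - JA y = t *: 'D_e JA x + rem.
  have regroup (M1 M2 M0 E1 E2 : 'M[R]_n) :
      M1 - M2 = (E1 - E2) + ((M1 - M0 - E1) - (M2 - M0 - E2)).
    by apply/matrixP => i j; rewrite !mxE; ring.
  have -> : t *: 'D_e JA x = t *: 'D_(b + e) JA x - t *: 'D_b JA x.
    rewrite -scalerBr; congr (_ *: _).
    by rewrite !deriveE // linearD addrC addKr.
  exact: regroup.
have nrem : `|rem| <= 2 * eps * t.
  apply: le_trans (ler_normB _ _) _.
  have -> : 2 * eps * t = eps * t + eps * t by ring.
  exact: lerD r2 r1.
have hrem : `|dot w (v *m rem)| <= l2norm w * (n%:R * n%:R * (2 * eps * t) * l2norm v).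
  apply: le_trans (cauchy_schwarz _ _) _; rewrite ler_wpM2l ?l2_ge0 //.
  apply: le_trans (l2_mulmx _ _) _; rewrite ler_wpM2r ?l2_ge0 //.
  by apply: ler_wpM2l nrem; exact: mulr_ge0.
have hJ : `|dot w (v *m (JA z - JA y))| <= l2norm w * (opnorm (JA z - JA y) * l2norm v).
  by apply: le_trans (cauchy_schwarz _ _) _; rewrite ler_wpM2l ?l2_ge0 // opnorm_trP.
have E1 : t * dot w (v *m 'D_e JA x) = dot w (v *m (JA z - JA y)) - dot w (v *m rem).
  by rewrite remE mulmxDr dotDr -scalemxAr dotZr addrK.
have h3 : t * `|dot w (v *m 'D_e JA x)| <= l2norm w * (opnorm (JA z - JA y) * l2norm v)
   + l2norm w * (n%:R * n%:R * (2 * eps * t) * l2norm v).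
  rewrite -[X in X * _](gtr0_norm t0) -normrM E1.
  by apply: le_trans (ler_normB _ _) _; exact: lerD hJ hrem.
rewrite -(ler_pM2l t0) mulrCA; apply: le_trans (ler_wpM2l k0 h3) _.
have hop' := ler_wpM2r (l2_ge0 v) hop; rewrite le /N.
set o := opnorm _ in hop' *.
have -> : t * (C * eta * l2norm v + 2 * k * (l2norm w * (n%:R * n%:R * l2norm v)) * eps) =
  C * (t * eta) * l2norm v + k * (l2norm w * (n%:R * n%:R * (2 * eps * t) * l2norm v)) by ring.
rewrite mulrDr lerD2r; apply: le_trans hop'.
by rewrite le_eqVlt; apply/orP; left; apply/eqP; ring.
Qed.

End LipschitzDerivative.

(** * Differentiated identities and the penalty threshold *)

Section DissolvingIdentities.
Variables (R : realType) (n p : nat) (K : set 'rV[R]_n) (x d : 'rV[R]_n).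
Variables (A : 'rV[R]_n -> 'rV[R]_n) (c : 'rV[R]_n -> 'rV[R]_p).
Hypothesis Kx : K x.
Hypothesis d_tangent : forall e : R, 0 < e -> exists2 dl : R, 0 < dl &
  forall t : R, 0 < t -> t < dl -> exists2 k, K k & l2norm (k - x - t *: d) <= e * t.

(** An identity that holds on K only can be differentiated along the directions
tangent to K. *)
Lemma derive_eq0_tangent (W : normedModType (R : numFieldType)) (F : 'rV[R]_n -> W) :
  differentiable F x -> (forall k, K k -> F k = 0) -> 'D_d F x = 0.
Proof.
move=> dF F0; apply: diff_eq0_along => // e dl e0 dl0.
have [dl1 dl10 h] := d_tangent e0.
pose m := Num.min dl dl1; have m0 : 0 < m by rewrite lt_min dl0.
have t0 : 0 < m / 2 by rewrite divr_gt0.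
have : m / 2 < m by lra.
rewrite {2}/m lt_min => /andP[tdl tdl1].
have [k Kk hk] := h _ t0 tdl1.
by exists (m / 2), k; split=> //; rewrite !F0.
Qed.

Lemma dissolving_fixes_tangent : differentiable A x -> (forall k, K k -> A k = k) ->
  d *m jacobian A x = d.
Proof.
move=> dA AK; have dI : differentiable (@id 'rV[R]_n) x by exact: ex_diff.
have [dF hF] := derive_addZ (-1) dA dI.
have := @derive_eq0_tangent _ _ dF.
rewrite hF derive_id deriveEjacobian // scaleN1r => h; apply/subr0_eq; apply: h.
by move=> k /AK ->; rewrite scaleN1r subrr.
Qed.

Lemma dissolving_second_order (e : 'rV[R]_n) :
  differentiable (jacobian A) x -> differentiable (jacobian c) x ->
  (forall k, K k -> jacobian A k *m jacobian c k = 0) ->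
  e *m 'D_d (jacobian A) x *m jacobian c x = - (e *m jacobian A x *m 'D_d (jacobian c) x).
Proof.
move=> dA dc AcK; have [dF hF] := derive_mulmx dA dc.
have := @derive_eq0_tangent _ _ dF AcK; rewrite hF => /(congr1 (mulmx e)).
by rewrite mulmxDr mulmx0 !mulmxA => /eqP; rewrite addr_eq0 => /eqP.
Qed.

End DissolvingIdentities.

Section Threshold.
Variables (R : realType) (n p r : nat) (X : set 'rV[R]_n).
Variables (f : 'rV[R]_n -> R) (c : 'rV[R]_n -> 'rV[R]_p).
Variables (A : 'rV[R]_n -> 'rV[R]_n) (RA : 'rV[R]_n -> 'M[R]_n) (P : 'M[R]_n).

Lemma sup0_ub (S : set R) a : S a -> (a%:E <= Defs.sup0 S)%E.
Proof. by move=> Sa; apply: ereal_sup_ubound; exists a => //; right. Qed.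

(** The second term of the threshold, its suprema evaluated at x and at the pair
(y, z), with the denominator cleared. *)
Lemma beta_bound_lipschitz x rho beta y z : X x -> 0 < rho ->
  0 < sval_r c r P x ->
  (beta_bound X f c A RA r P x rho <= beta%:E)%E ->
  X y -> X z -> l2norm (y - x) <= rho -> l2norm (z - x) <= rho -> y != z ->
  (1 + opnorm (jacobian A x) + opnorm (jacobian A x) ^+ 2) * l2norm (grad f (A x)) *
    (opnorm (jacobian A y - jacobian A z) / l2norm (y - z))
  <= sval_r c r P x ^+ 2 * beta.
Proof.
move=> Xx rho0 s0 hb Xy Xz yrho zrho yz.
set m := opnorm (jacobian A x); set l := opnorm _ / _; set s := sval_r _ _ _ _ in s0 *; set g := l2norm _.
have Tx : Theta X x rho x by split=> //; rewrite subrr l2_0 ltW.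
have m0 : 0 <= m by exact: opnorm_ge0.
have g0 : 0 <= g by exact: l2_ge0.
have l0 : 0 <= l by rewrite divr_ge0 ?opnorm_ge0 ?l2_ge0.
have hg : (g%:E <= M_f f A (Theta X x rho))%E by apply: sup0_ub; exists x.
have hm : (m%:E <= M_A A (Theta X x rho))%E by apply: sup0_ub; exists x.
have hl : (l%:E <= L_A A (Theta X x rho))%E by apply: sup0_ub; exists (y, z).
have : ((s ^- 2 * (g * l * (1 + m + m ^+ 2)))%:E <= beta%:E)%E.
  apply: le_trans hb; rewrite /beta_bound le_max; apply/orP; right.
  rewrite EFinM lee_wpmul2l //; first by rewrite lee_fin invr_ge0 exprn_ge0 // ltW.
  have hgl : ((g * l)%:E <= M_f f A (Theta X x rho) * L_A A (Theta X x rho))%E.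
    by rewrite EFinM; apply: lee_pmul.
  have h1m : ((1 + m + m ^+ 2)%:E <= 1 + M_A A (Theta X x rho) + M_A A (Theta X x rho) ^+ 2)%E.
    rewrite !EFinD; apply: leeD; first exact: leeD.
    by rewrite expr2 EFinM expe2; apply: lee_pmul.
  rewrite EFinM; apply: lee_pmul => //.
    by rewrite lee_fin mulr_ge0.
  by rewrite lee_fin !addr_ge0 ?exprn_ge0.
rewrite lee_fin -ler_pdivlMl ?invr_gt0 ?exprn_gt0 // invrK => h.
by apply: le_trans h; rewrite le_eqVlt; apply/orP; left; apply/eqP; ring.
Qed.

End Threshold.

(** Since w = u - u M with orthogonal terms, |w|^2 <= (1 + |M|^2) |u|^2, which is
at most (1 + |M| + |M|^2) |u|^2; the factor cancels and s |u| <= N remains. *)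
Lemma oblique_bound (R : realType) n (M : 'M[R]_n) (u w : 'rV[R]_n) (s b q N : R) :
  0 < s -> 0 <= b -> u *m M = u - w -> dot u (u *m M) = 0 -> s * l2norm u <= N ->
  (1 + opnorm M + opnorm M ^+ 2) * q <= s ^+ 2 * b * l2norm w * l2norm w ->
  q <= b * N ^+ 2.
Proof.
move=> s0 b0 uM orth us; have m0 := opnorm_ge0 M.
have nu := opnorm_trP M u; move: (opnorm M) m0 nu => m m0 nu.
have k0 : 0 < 1 + m + m ^+ 2 by rewrite ltr_wpDr ?exprn_ge0 // ltr_wpDr.
have -> : s ^+ 2 * b * l2norm w * l2norm w = s ^+ 2 * b * l2norm w ^+ 2 by ring.
have wn : l2norm w ^+ 2 <= (1 + m + m ^+ 2) * l2norm u ^+ 2.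
  have -> : w = u - u *m M by rewrite uM opprB addrC subrK.
  rewrite pythagoras // !mulrDl mul1r -addrA lerD2l.
  have h1 : l2norm (u *m M) ^+ 2 <= m ^+ 2 * l2norm u ^+ 2.
    by rewrite -exprMn ler_sqr ?nnegrE ?mulr_ge0 ?l2_ge0.
  by apply: le_trans h1 _; rewrite lerDr mulr_ge0 // exprn_ge0 // l2_ge0.
have us2 : s ^+ 2 * l2norm u ^+ 2 <= N ^+ 2.
  have su0 : 0 <= s * l2norm u by rewrite mulr_ge0 ?l2_ge0 // ltW.
  by rewrite -exprMn ler_sqr ?nnegrE // (le_trans su0).
move=> h; rewrite -(ler_pM2l k0); apply: le_trans h _.
apply: (@le_trans _ _ (s ^+ 2 * b * ((1 + m + m ^+ 2) * l2norm u ^+ 2))).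
  by rewrite ler_wpM2l // mulr_ge0 // exprn_ge0 // ltW.
have -> : s ^+ 2 * b * ((1 + m + m ^+ 2) * l2norm u ^+ 2) =
  (1 + m + m ^+ 2) * (b * (s ^+ 2 * l2norm u ^+ 2)) by ring.
by rewrite ler_pM2l // ler_wpM2l.
Qed.

Lemma opnorm_factor_ge0 (R : realType) n (M : 'M[R]_n) :
  0 <= 1 + opnorm M + opnorm M ^+ 2.
Proof. by rewrite !addr_ge0 ?exprn_ge0 ?opnorm_ge0. Qed.

(** * The stationarity theorem *)

Lemma dot_bilinear_expansion (R : realType) (n : nat) (g u v : 'rV[R]_n) (U V : 'M[R]_n) :
  dot g ((u + v) *m (U + V)) =
    (dot g (u *m U) + dot g (u *m V)) + (dot g (v *m U) + dot g (v *m V)).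
Proof. by rewrite mulmxDl !mulmxDr !dotDr. Qed.

(** The final bookkeeping over abstract reals: a11 to a22 are the terms of
<grad f, d (B d)>, l and f2 the curvatures of c and f along d1, q the transport
term, gz and gz' the pairings of Gamma with z and z', and b the penalty. *)
Lemma curvature_balance (R : realType) (a11 a12 a21 a22 l q gz gz' f2 b eps : R) :
  a11 = l -> a12 = a21 -> a21 = - q -> gz + 2 * q <= gz' + eps / 2 ->
  - (eps / 2) < f2 + l - gz' -> - a22 <= b ->
  gz <= f2 + ((a11 + a12) + (a21 + a22)) + b + eps.
Proof. by move=> -> -> -> *; lra. Qed.

Theorem theorem3p23 (R : realType) (n p r : nat)
    (X Y : set 'rV[R]_n)
    (f : 'rV[R]_n -> R) (c : 'rV[R]_n -> 'rV[R]_p) (tau : 'rV[R]_n -> R)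
    (A : 'rV[R]_n -> 'rV[R]_n) (RA : 'rV[R]_n -> 'M[R]_n)
    (omega : 'rV[R]_n -> R)
    (P : 'M[R]_n) (Yt : set 'rV[R]_n)
    (X_closed : closed X)
    (X_convex : convex_set (X : set (convex_lmodType 'rV[R]_n)))
    (Y_open : open Y) (X_sub_Y : X `<=` Y)
    (regular : regular_data X Y f c r tau)
    (dissolving : constraint_dissolving X c A RA omega)
    (f_twice : twice_differentiable Y f (grad f))
    (c_twice : twice_differentiable Y c (jacobian c))
    (A_twice : twice_differentiable Y A (jacobian A))
    (X_sodd : second_order_dir_diff X)
    (P_proj : is_orthoproj (aff_dir X) P)
    (Yt_nbhd : manifold_nbhd X Y c Yt)
    (x : 'rV[R]_n) (x_feas : feasible X c x)
    (kappa : R) (kappaP : is_kappa X Y c r P Yt x kappa)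
    (rho : R)
    (rhoP : is_rho X c r P x
              (Num.min (tau x) (Num.min (omega x) kappa)) rho)
    (x_sosp : ncp_sosp X f c x)
    (beta : R) (beta_ge0 : 0 <= beta)
    (beta_ge : (beta_bound X f c A RA r P x rho <= beta%:E)%E) :
  cdp_sosp X (cdp_obj f c A beta) x.
Proof.
have [[f_diff _ _] _ r_gt0 reg] := regular.
have [_ A_id RA_lip RA0 nf] := dissolving.
have [Xx cx] := x_feas; have Yx := X_sub_Y _ Xx.
have fd y : differentiable f y by exact: f_diff.
have Ad y : Y y -> differentiable A y by move=> /A_twice[].
have cd y : Y y -> differentiable c y by move=> /c_twice[].
have [_ gfd] := f_twice x Yx; have [Adx JAd] := A_twice x Yx; have [cdx Jcd] := c_twice x Yx.
have [tau0 regE regL] := reg x x_feas.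
have [[rho0 rho_le _] _] := rhoP.
have [kap0 kapB] := kappaP.
have [Ax AJ] := A_id x x_feas.
have [om0 nfx] := nf x x_feas.
have PE := orthoproj_tr P_proj.
set J := jacobian c x in AJ; set JA := jacobian A x in AJ.
have xx0 (a : R) : 0 < a -> l2norm (x - x) <= a by move=> a0; rewrite subrr l2_0 ltW.
have hE : has_dim [set mulmxv J^T d | d in aff_dir X] r.
  exact: regE x Yx (sub_aff Xx) (xx0 _ tau0).
have lin := lineality_onto_image P_proj Xx hE (regL x Xx (xx0 _ tau0)).
(* The condition on RA, read on row vectors; RA vanishes at x itself. *)
have fixN y v : X y -> l2norm (y - x) <= omega x -> normal_cone X y v ->
    v *m (jacobian A y)^T - v = v *m (RA y)^T.
  move=> Xy yx vN; apply/subr0_eq; have := nfx y v Xy yx vN; rewrite /mulmxv.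
  have -> : (jacobian A y - 1%:M - RA y)^T = (jacobian A y)^T - 1%:M - (RA y)^T.
    by apply/matrixP => i j; rewrite !mxE [j == i]eq_sym.
  by rewrite 2!mulmxBr mulmx1.
have fixNx v : normal_cone X x v -> v *m JA^T = v.
  move=> vN; have := fixN x v Xx (xx0 _ om0) vN.
  by rewrite RA0 // trmx0 mulmx0 => /eqP; rewrite subr_eq0 => /eqP.
have [L [dlL [L0 dlL0 hL]]] := loc_lipschitz_at Xx RA_lip.
pose om := Num.min (omega x) (dlL / 2).
have omgt0 : 0 < om by rewrite lt_min om0 divr_gt0.
have LR0 : 0 <= n%:R * n%:R * L by rewrite !mulr_ge0.
have nfixed y v u k : X y -> l2norm (y - x) <= om -> normal_cone X y v ->
    feasible X c k -> l2norm (k - x) <= om ->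
    `|dot (u *m jacobian A y) v - dot u v|
      <= n%:R * n%:R * L * l2norm (y - k) * (l2norm u * l2norm v).
  move=> Xy; rewrite le_min => /andP[yom ydl] vN Kk; rewrite le_min => /andP[_ kdl].
  rewrite dot_mulmxl -dotBr fixN //.
  apply: le_trans (cauchy_schwarz _ _) _.
  have h1 : `|RA y| <= L * l2norm (y - k).
    have := hL y k Xy Kk.1; rewrite (RA0 k Kk) subr0; apply; lra.
  have h2 : l2norm (v *m (RA y)^T) <= n%:R * n%:R * (L * l2norm (y - k)) * l2norm v.
    apply: le_trans (l2_mulmx _ _) _; rewrite ler_wpM2r ?l2_ge0 //.
    by rewrite ler_wpM2l ?mulr_ge0 // (le_trans (norm_trmx _)).
  apply: le_trans (ler_wpM2l (l2_ge0 u) h2) _.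
  by rewrite le_eqVlt; apply/orP; left; apply/eqP; ring.
have s_ge0 : 0 <= 2 / sval_r c r P x by rewrite divr_ge0 // sqrtr_ge0.
(* A distance is an infimum, so the error bound only gives a zero of c up to e. *)
have errb y e : X y -> l2norm (y - x) <= kappa -> 0 < e ->
    exists m, [/\ aff_dir X (m - x), c m = 0 &
      l2norm (m - y) <= 2 / sval_r c r P x * l2norm (c y) + e].
  move=> Xy yk e0; have [hd _] := kapB y (X_sub_Y _ Xy) (sub_aff Xy) yk.
  have [||m [_ am cm] hm] := @dist_lt _ _ y (manifold X c Yt) (2 / sval_r c r P x * l2norm (c y) + e).
  - by exists x; split=> //; [case: Yt_nbhd => _ h _ _; exact: h|exact: sub_aff].
  - by apply: le_lt_trans hd _; rewrite ltrDl.
  exists m; split=> //; first exact: aff_subr.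
  by rewrite l2B ltW.
have TK d : tangent_cone X x d -> d *m J = 0 -> forall e : R, 0 < e ->
    exists2 dl : R, 0 < dl & forall t : R, 0 < t -> t < dl ->
      exists2 k, feasible X c k & l2norm (k - x - t *: d) <= e * t.
  move=> Td dJ e e0.
  have [dl dl0 h] := tangent_feasible_set X_convex Xx P_proj cdx cx lin s_ge0 kap0 errb Td dJ e0.
  by exists dl => // t t0 tdl; have [k [Xk ck hk]] := h t t0 tdl; exists k.
(* JA fixes the kernel of J, first on tangent directions and then on their span. *)
have fixT d : tangent_cone X x d -> d *m J = 0 -> d *m JA = d.
  move=> Td dJ; apply: (dissolving_fixes_tangent x_feas (TK d Td dJ)) => // k Kk.
  by case: (A_id k Kk).
have fixE d : aff_dir X d -> d *m J = 0 -> d *m JA = d.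
  move=> dE dJ; have [w1 [w2 [a [T1 J1 T2 J2 ->]]]] :=
    kernel_span X_convex Xx P_proj lin dE dJ.
  by rewrite -scalemxAl mulmxBl !fixT.
have inT d : tangent_cone X x d -> tangent_cone X x (d *m JA).
  move=> Td; apply: polar_normal_tangent => // v vN.
  by rewrite dot_mulmxl (fixNx v vN) dotC (normal_tangent_le0 Xx vN Td).
have JJ d : d *m JA *m J = 0 by rewrite -mulmxA AJ mulmx0.
set h := cdp_obj f c A beta.
have gh : grad h x = grad f x *m JA^T.
  by rewrite grad_cdp_obj ?Ax // cx mul0mx scaler0 addr0.
pose G := - (grad f x *m JA^T).
(* Apply JA^T, which fixes v and kills the gradients of c. *)
have multE lam v : normal_cone X x v -> grad f x + mulmxv J lam + v = 0 -> v = G.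
  move=> vN /(congr1 (mulmx^~ JA^T)); rewrite !mulmxDl mul0mx (fixNx v vN) /mulmxv.
  rewrite -mulmxA -trmx_mul AJ trmx0 mulmx0 addr0 => e.
  by apply/eqP; rewrite /G -addr_eq0 addrC e.
have [[_ [lam0 [v0 [v0N v0E]]]] sosp] := x_sosp.
have GN : normal_cone X x G by rewrite -(multE lam0 v0).
split; first by split=> //; exists G => //; rewrite gh subrr.
move=> d [Td dh]; rewrite gh -/G.
have dG : dot G d = 0 by rewrite /G dotNl dotC -gh dh oppr0.
have gfAx : differentiable (grad f) (A x) by rewrite Ax.
rewrite (@hess_cdp_obj _ _ _ Y) //.
rewrite Ax -/JA -/J; set Q := (X in (0 <= X%:E - _)%E).
rewrite sube_ge0; last by apply/orP; right.
apply: ge_ereal_sup => _ [z z2 <-]; rewrite lee_fin.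
pose d1 := d *m JA; pose d2 := d - d1.
have T1 : tangent_cone X x d1 by exact: inT.
have J1 : d1 *m J = 0 by exact: JJ.
have F1 : d1 *m JA = d1 by exact: fixT.
have F2 : d2 *m JA = 0 by rewrite mulmxBl F1 subrr.
have dd : d = d1 + d2 by rewrite addrC subrK.
have G1 : dot G d1 = 0 by rewrite dotC /d1 dot_mulmxl fixNx // dotC.
have crit : ncp_critical X f c x d1.
  by split=> //; rewrite dotC /d1 dot_mulmxl -gh.
have d2E : aff_dir X d2.
  by apply: (aff_dirB P_proj); [exact: (tangent_aff_dir P_proj Xx Td)
                              |exact: (tangent_aff_dir P_proj Xx T1)].
pose B u := 'D_u (jacobian A) x.
have z2' : tangent2 X x (d1 + d2) z by rewrite -dd.
have TK1 := TK d1 T1 J1.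
have curv : dot (d1 *m B d1) G = 0.
  exact: (normal_curvature_d1 X_closed X_convex Xx x_feas GN JAd LR0 omgt0 nfixed
    F1 F2 G1 TK1 z2').
have curv2 (w : 'rV[R]_n) : w *m B d1 *m J = - (w *m JA *m 'D_d1 (jacobian c) x).
  by apply: (dissolving_second_order x_feas TK1 w JAd Jcd) => k Kk; case: (A_id k Kk).
have sym : dot (grad f x) (d1 *m B d2) = dot (grad f x) (d2 *m B d1).
  exact: second_derivative_sym Y_open Yx Ad JAd.
(* u - d2 is killed by J, hence fixed by JA; as d2 JA = 0 this gives
   u JA = u - d2, orthogonal to u. *)
have bound : - dot (grad f x) (d2 *m B d2) <= beta * l2norm (d2 *m J) ^+ 2.
  have [s0 [u [uE uJ us orth]]] := kernel_complement P_proj r_gt0 hE d2E.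
  have udE : aff_dir X (u - d2) := aff_dirB P_proj uE d2E.
  have a1E : u *m JA = u - d2.
    have udJ : (u - d2) *m J = 0 by rewrite mulmxBl uJ subrr.
    by rewrite -(fixE _ udE udJ) mulmxBl F2 subr0.
  have ua : dot u (u *m JA) = 0 by apply: orth; [rewrite a1E|exact: JJ].
  have lip y y' : X y -> X y' -> l2norm (y - x) <= rho -> l2norm (y' - x) <= rho ->
      y != y' -> (1 + opnorm JA + opnorm JA ^+ 2) * l2norm (grad f x) *
        (opnorm (jacobian A y - jacobian A y') / l2norm (y - y'))
      <= sval_r c r P x ^+ 2 * beta.
    move=> Xy Xy' h1 h2 yy'.
    by have := beta_bound_lipschitz Xx rho0 s0 beta_ge Xy Xy' h1 h2 yy'; rewrite Ax.
  have main := lipschitz_derivative_bound P_proj X_convex Xx d2 JAd rho0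
    (opnorm_factor_ge0 _) lip d2E.
  rewrite uJ in us.
  have hb := oblique_bound s0 beta_ge0 a1E ua us main.
  by apply: le_trans hb; rewrite -normrN ler_norm.
apply/ler_addgt0Pr => eps eps0; have eps2 : 0 < eps / 2 by rewrite divr_gt0.
have [z' z'2 hz'] := tangent2_transport X_closed X_convex Xx x_feas GN JAd LR0 omgt0 nfixed
  F2 G1 TK1 z2' eps2.
have : ((- (eps / 2))%:E < ereal_sup
      [set (dot d1 (mulmxv (hess f x + hess_comb c x lg.1) d1))%:E
           - support_fun lg.2 (tangent2 X x d1) | lg in ncp_multipliers X f c x])%E.
  by apply: lt_le_trans (sosp d1 crit); rewrite lte_fin oppr_lt0.
move=> /ereal_sup_gt [_ [[lam v] [/= mE vN] <-]].
have vG := multE lam v vN mE; rewrite vG in mE * => hlam.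
have {}hlam : - (eps / 2) < dot ('D_d1 (grad f) x) d1 + dot lam (d1 *m 'D_d1 (jacobian c) x)
    - dot G z'.
  rewrite -lte_fin; apply: lt_le_trans hlam _; rewrite EFinB; apply: leeB.
    by rewrite (hess_lagrangian_quadratic d1 lam Y_open Yx cd gfd Jcd).
  by apply: ereal_sup_ubound; exists z'.
have gfE w : dot (grad f x) w = - dot lam (w *m J) - dot G w.
  have -> : grad f x = - (lam *m J^T) - G.
    by apply/eqP; rewrite -opprD -addr_eq0 addrA mE.
  by rewrite dotBl dotNl dot_mulmxl trmxK dotC.
have e1 : dot (grad f x) (d1 *m B d1) = dot lam (d1 *m 'D_d1 (jacobian c) x).
  by rewrite gfE curv2 F1 (dotC G) curv dotNr opprK subr0.
have e2 : dot (grad f x) (d2 *m B d1) = - dot (d2 *m B d1) G.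
  by rewrite gfE curv2 F2 mul0mx oppr0 dot0r oppr0 sub0r dotC.
have BD : B d = B d1 + B d2 := etrans (congr1 B dd) (derive_dirD d1 d2 JAd).
have e3 : dot (grad f x) (d *m B d) =
    (dot (grad f x) (d1 *m B d1) + dot (grad f x) (d1 *m B d2))
    + (dot (grad f x) (d2 *m B d1) + dot (grad f x) (d2 *m B d2)).
  have hE2 : d *m B d = (d1 + d2) *m (B d1 + B d2) := f_equal2 mulmx dd BD.
  exact: (etrans (congr1 (dot (grad f x)) hE2) (dot_bilinear_expansion _ _ _ _ _)).
have e4 : d *m J = d2 *m J := etrans (congr1 (mulmx^~ J) dd)
  (etrans (mulmxDl d1 d2 J) (etrans (congr1 (+%R^~ _) J1) (add0r _))).
have fin := curvature_balance e1 sym e2 hz' hlam bound.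
have QE : Q = dot ('D_d1 (grad f) x) d1
    + ((dot (grad f x) (d1 *m B d1) + dot (grad f x) (d1 *m B d2))
      + (dot (grad f x) (d2 *m B d1) + dot (grad f x) (d2 *m B d2)))
    + beta * l2norm (d2 *m J) ^+ 2.
  exact: (f_equal2 +%R (congr1 (+%R (dot ('D_d1 (grad f) x) d1)) e3)
    (congr1 (fun w => beta * l2norm w ^+ 2) e4)).
rewrite QE; exact: fin.
Qed.
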